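(* Let $H\in(0,1)$, $H\ne1/2$, let $u>0$, and let $X_t=u+\vartheta t-\xi_t$, $t\ge0$, where $\xi_t=W_t+B^H_t$ is the mixed fractional Brownian motion and $\vartheta$ is the unknown drift parameter. Let $\psi(u)=\psi(\vartheta,u)=\mathbf{P}\left(\inf_{t\ge0}X_t<0\right)$ be the ultimate ruin probability, let $\hat\vartheta_{T'}$ be the maximum likelihood estimator of $\vartheta$ based on the continuous-time observation $(X_t)_{0\le t\le T'}$, and let $\hat\psi(u)=\psi(\hat\vartheta_{T'},u)$. Then, as $T'\to\infty$, the following convergences in distribution hold: (i) for $H>1/2$, $$T'^{\,1-H}\left(\hat\psi(u)-\psi(u)\right)\longrightarrow\mathcal{N}\left(0,\ \frac{2H\,\Gamma(H+1/2)\,\Gamma(3-2H)}{\Gamma(3/2-H)}\,\left(\partial_\vartheta\psi(u)\right)^2\right);$$ (ii) for $H<1/2$, $$\sqrt{T'}\left(\hat\psi(u)-\psi(u)\right)\longrightarrow\mathcal{N}\left(0,\ \left(\partial_\vartheta\psi(u)\right)^2\right).$$ Here $\Gamma(\cdot)$ is the Gamma function and $\partial_\vartheta\psi(u)$ is the derivative of $\psi(\vartheta,u)$ with respect to $\vartheta$ at the true parameter value.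
   Context: $W=(W_t)_{t\ge0}$ is a standard Brownian motion and $B^H=(B^H_t)_{t\ge0}$ is an independent fractional Brownian motion with Hurst parameter $H$, i.e. a centered Gaussian process with covariance $R(s,t)=\mathbf{E}B^H_tB^H_s=\frac12(t^{2H}+s^{2H}-|t-s|^{2H})$. The value of $H$ is known. With $Y_t=X_t-u=\vartheta t-\xi_t$, the maximum likelihood estimator is $$\hat\vartheta_{T'}=\frac{\int_0^{T'}g(t,T')\,dY_t}{\int_0^{T'}g(t,T')\,dt},$$ where for each $t>0$ the function $g(\cdot,t)\in L^2([0,t])$ is the unique solution of $$g(s,t)+\frac{\partial}{\partial s}\int_0^t g(r,t)\frac{\partial}{\partial r}R(r,s)\,dr=1,\qquad 0<s\le t.$$ The function $\psi(\vartheta,u)$ is regarded as a (continuously differentiable) function of $\vartheta$ for fixed $u$. *)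

(* Defs.v *)
From HB Require Import structures.
From mathcomp Require Import all_boot all_order all_algebra.
From mathcomp Require Import all_classical all_reals all_analysis.
Set Implicit Arguments.
Unset Strict Implicit.
Unset Printing Implicit Defensive.
Import Order.TTheory GRing.Theory Num.Theory.
Import numFieldNormedType.Exports.
Local Open Scope classical_set_scope.
Local Open Scope ring_scope.

(* Only meant for 0 < x, where the integral converges. *)
Definition Gamma (R : realType) (x : R) : R :=
  \int[lebesgue_measure]_(t in `]0, +oo[) (t `^ (x - 1) * expR (- t)).

(* N(m, v), parametrized by its variance v; [normal_prob m 0] is not the point
   mass at m, hence the case distinction. *)
Definition gaussian_prob (R : realType) (m v : R) :
    probability (measurableTypeR R) R :=
  if v == 0 then
    @dirac _ (measurableTypeR R) m R : probability (measurableTypeR R) R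
  else normal_prob m (Num.sqrt v) : probability (measurableTypeR R) R.

Definition has_law (R : realType) (d : measure_display)
    (Omega : measurableType d) (P : probability Omega R)
    (X : Omega -> R) (mu : probability (measurableTypeR R) R) : Prop :=
  forall A : set (measurableTypeR R), measurable A -> P (X @^-1` A) = mu A.

Definition cvg_in_distribution (R : realType) (d : measure_display)
    (Omega : measurableType d) (P : probability Omega R)
    (Z : R -> Omega -> R) (mu : probability (measurableTypeR R) R) : Prop :=
  forall f : R -> R, continuous f -> (exists M : R, forall x, `|f x| <= M) ->
    (\int[P]_w (f (Z T w))%:E)%E @[T --> +oo] --> (\int[mu]_x (f x)%:E)%E.

Section processes.
Context (R : realType) (d : measure_display) (Omega : measurableType d).
Context (P : probability Omega R).
Implicit Type X : R -> {RV P >-> R}.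

Definition continuous_paths X : Prop :=
  forall w, {within `[0, +oo[, continuous (fun t : R => X t w)}.

Definition sigma_of X (D : set R) : set (set Omega) :=
  <<s [set X t @^-1` A | t in D
        & A in (measurable : set (set (measurableTypeR R)))] >>.

Definition independent_processes X Y : Prop :=
  forall A B, sigma_of X `[0, +oo[ A -> sigma_of Y `[0, +oo[ B ->
    P (A `&` B) = (P A * P B)%E.

Definition standard_brownian X : Prop :=
  [/\ {ae P, forall w, X 0 w = 0},
      (forall s t : R, 0 <= s <= t ->
         has_law P (fun w => X t w - X s w) (gaussian_prob 0 (t - s))),
      (forall s t : R, 0 <= s <= t ->
         forall (A : set Omega) (C : set (measurableTypeR R)),
         sigma_of X `[0, s] A -> measurable C ->
         let incr := [set w | C (X t w - X s w)] in
         P (A `&` incr) = (P A * P incr)%E)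
    & continuous_paths X].

Definition gaussian_process X : Prop :=
  forall (n : nat) (c t : 'I_n -> R), (forall i, 0 <= t i) ->
    exists m v : R, 0 <= v /\
      has_law P (fun w => \sum_(i < n) c i * X (t i) w) (gaussian_prob m v).

Definition fbm_cov (H s t : R) : R :=
  2^-1 * (t `^ (2 * H) + s `^ (2 * H) - `|t - s| `^ (2 * H)).

(* Continuity of the paths makes infima over all t >= 0 measurable. *)
Definition fractional_brownian (H : R) X : Prop :=
  [/\ gaussian_process X,
      (forall t : R, 0 <= t -> 'E_P[X t]%E = 0%E),
      (forall s t : R, 0 <= s -> 0 <= t ->
         'E_P[fun w => (X t w * X s w)%R]%E = (fbm_cov H s t)%:E)
    & continuous_paths X].

Definition mixed_fbm X Y : R -> Omega -> R := fun t w => X t w + Y t w.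

Definition risk_process (xi : R -> Omega -> R) (theta u : R) :
  R -> Omega -> R := fun t w => u + theta * t - xi t w.

Definition ruin_prob (xi : R -> Omega -> R) (theta u : R) : R :=
  fine (P [set w | (ereal_inf
    [set (risk_process xi theta u t w)%:E | t in `[0%R, +oo[] < 0)%E]).

(* A step function is encoded by the list of its terms (c, (a, b)), standing
   for c times the indicator of ]a, b]. *)
Definition step_fun (s : seq (R * (R * R))) (x : R) : R :=
  \sum_(p <- s) p.1 * \1_(`]p.2.1, p.2.2] : set R) x.

Definition step_integral (Y : R -> Omega -> R) (s : seq (R * (R * R)))
    (w : Omega) : R :=
  \sum_(p <- s) p.1 * (Y p.2.2 w - Y p.2.1 w).

(* S is a version of the integral over [0, T] of the deterministic function f
   against Y: the L^2(P)-limit of the integrals of step functions converging to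
   f in L^2([0, T]).  For Y = theta t - xi this is the closure of the integral
   on step functions, so that S is determined by f almost surely, for every
   0 < H < 1. *)
Definition wiener_integral (Y : R -> Omega -> R) (T : R) (f : R -> R)
    (S : {RV P >-> R}) : Prop :=
  exists s : nat -> seq (R * (R * R)),
    [/\ (forall n p, p \in s n -> [/\ 0 <= p.2.1, p.2.1 <= p.2.2 & p.2.2 <= T]),
        (\int[lebesgue_measure]_(x in `[0%R, T])
           ((step_fun (s n) x - f x) ^+ 2)%:E)%E @[n --> \oo] --> 0%E
      & (\int[P]_w ((step_integral Y (s n) w - S w) ^+ 2)%:E)%E
           @[n --> \oo] --> 0%E].

(* S T stands for the integral of g(., T) against Y over [0, T]. *)
Definition drift_mle (g : R -> R -> R) (S : R -> {RV P >-> R}) (T : R)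
    (w : Omega) : R :=
  S T w / \int[lebesgue_measure]_(t in `[0, T]) g t T.

End processes.

(* g = g(., t) is a solution in L^2([0, t]) of
     g(s) + d/ds \int_0^t g(r) (dR/dr)(r, s) dr = 1,   0 < s <= t.
   The derivative in s is relative to ]0, t], hence one-sided at s = t: for
   H < 1/2 the solution has no two-sided derivative there.  The derivative
   dR/dr may fail to exist at the points r = 0 and r = s only. *)
Definition mle_kernel (R : realType) (H t : R) (g : R -> R) : Prop :=
  let h s r := g r * derive1 (fun r' => fbm_cov H r' s) r in
  let F s := \int[lebesgue_measure]_(r in `[0, t]) h s r in
  [/\ measurable_fun `[0, t] g,
      (\int[lebesgue_measure]_(r in `[0%R, t]) (g r ^+ 2)%:E < +oo)%E
    & forall s : R, 0 < s <= t ->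
      lebesgue_measure.-integrable `[0, t] (EFin \o h s) /\
      (F x - F s) / (x - s) @[x --> within `]0, t] s^'] --> 1 - g s].

(* Main.v *)
(* With G the integral of the kernel g(., T) over [0, T] and Z its Wiener
   integral against xi, the estimation error is - Z / G.  The kernel equation
   says that E[(xi_s - xi_0) Z] = s on [0, T].  Hence E[Z^2] = G, and the
   Gaussian variable Z / G has law N(0, 1 / G) for each T.

   Cauchy-Schwarz inequalities then squeeze G.  Testing Z against xi_T - xi_0,
   and the Brownian part of the approximating integrals against W_T - W_0,
   gives T^2 / (T + T^(2H)) <= G <= T, which is sharp for H < 1/2.  For
   H > 1/2 the same is done with step functions increasing to the equilibrium
   density (x (T - x))^(1/2 - H), whose potential for the covariance of the
   fractional Brownian motion is constant on [0, T]; both bounds then agree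
   to leading order T^(2 - 2H).

   Since psi is monotone, hence measurable, and differentiable at theta, the
   expectation of f(a_T (psi(theta_hat) - psi(theta))) is a standard normal
   integral to which dominated convergence applies. *)

Require Import Defs.
From HB Require Import structures.
From mathcomp Require Import all_boot all_order all_algebra.
From mathcomp Require Import all_classical all_reals all_analysis.
From mathcomp Require Import measurable_realfun.
From mathcomp Require Import ring lra.
Set Implicit Arguments.
Unset Strict Implicit.
Unset Printing Implicit Defensive.
Import Order.TTheory GRing.Theory Num.Theory.
Import numFieldNormedType.Exports.
Local Open Scope classical_set_scope.
Local Open Scope ring_scope.

(** * Functions with an integrable right derivative everywhere *)

(** The kernel equation is pointwise: it gives the derivative of an integral at each point, with [g]
    merely square integrable. Integrating it calls for a fundamental theorem of calculus for a
    derivative that exists everywhere but may be discontinuous. Relating it to E[(xi_s - xi_0) Z] is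
    the other obstacle. For H < 1/2 the kernel |x|^(2H - 1) is unbounded, and for H <= 1/4 it is not
    even locally square integrable, so the L^2 convergence of step functions to [g] cannot be tested
    against it. Averaging over short windows in s replaces it by differences of |x|^(2H), which are
    bounded; continuity of both sides in s then undoes the average. For H > 1/2, let M be the mass
    of the equilibrium density on [0, 1] and c its constant potential, both of them Beta integrals
    up to a factor. On [0, T] the density has mass T M and energy T^(2H) c M, so that G behaves like
    (T M)^2 / (T^(2H) c M), which gives the variance c / M. For a fixed step profile the Brownian
    energy is only of order T. *)

Section everywhere_derivative.
Context {R : realType}.
Notation mu := (@lebesgue_measure R).

Lemma within_continuous_eps (K : R -> R) (A : set R) (c : R) :
  {within A, continuous K} -> A c -> forall e, 0 < e ->
  exists2 d, 0 < d & forall x, A x -> `|x - c| < d -> `|K x - K c| < e.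
Proof.
move=> /subspace_continuousP/(_ c) cK Ac e e0.
have /cvgrPdist_lt/(_ e e0) := cK Ac.
move=> [d /= d0 H]; exists d => // x Ax xc.
by rewrite distrC; apply: H => //=; rewrite distrC.
Qed.

(** Continuous induction with slack e (x - a). The supremum of the points where the relaxed
    inequality holds is again such a point: [K] is continuous and [Phi], which may jump, only jumps
    upwards. The Dini condition then pushes past any supremum below b. *)
Lemma dini_le (Phi K : R -> R) (a b : R) : a <= b ->
  {in `[a, b] &, {homo Phi : x y / x <= y}} ->
  {within `[a, b], continuous K} ->
  (forall x, a <= x < b -> forall e, 0 < e ->
    \forall y \near x^'+, K y - K x <= Phi y - Phi x + e * (y - x)) ->
  K b - K a <= Phi b - Phi a.
Proof.
move=> ab ndPhi cK dini.
suff H e : 0 < e -> K b - K a <= Phi b - Phi a + e * (b - a).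
  apply/ler_addgt0Pr => e e0.
  have ba1 : 0 < b - a + 1 by rewrite ltr_wpDl ?subr_ge0.
  apply: (le_trans (H (e / (b - a + 1)) _)); first by rewrite divr_gt0.
  rewrite lerD2l -mulrA -[leRHS]mulr1 ler_pM2l// mulrC ler_pdivrMr// mul1r.
  by rewrite lerDl.
move=> e0.
pose S := [set x | a <= x <= b /\ K x - K a <= Phi x - Phi a + e * (x - a)].
have Sa : S a by split; rewrite ?lexx ?ab// !subrr mulr0 addr0.
have supS : has_sup S by split; [exists a|exists b => x [/andP[]]].
pose c := sup S.
have ac : a <= c by apply: ub_le_sup => //; case: supS.
have cb : c <= b by apply: ge_sup; [exists a|move=> x [/andP[]]].
have Sc : S c.
  split; first by rewrite ac.
  apply/ler_addgt0Pr => d d0.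
  have [r r0 Hr] := @within_continuous_eps K `[a, b]%classic c cK
    (ltac:(by rewrite /= in_itv/= ac cb)) d d0.
  have [x [xab Sx] cx] := sup_adherent r0 supS.
  have xc : x <= c by apply: ub_le_sup => //; case: supS.
  have : `|K x - K c| < d.
    by apply: Hr; rewrite /= ?in_itv//= distrC ger0_norm ?subr_ge0// ltrBlDl -ltrBlDr.
  rewrite distrC => /ltW/ler_normlW Kxc.
  have Pxc : Phi x <= Phi c.
    by apply: ndPhi => //; rewrite in_itv/= ?xab// ac cb.
  have exc : e * (x - a) <= e * (c - a) by rewrite ler_pM2l// lerB.
  by move: Sx Kxc Pxc exc; set u := e * _; set v := e * _; lra.
move: cb; rewrite le_eqVlt => /predU1P[cbE|cb]; first by case: Sc; rewrite cbE.
have /(_ e e0) := dini c (ltac:(by rewrite ac cb)).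
move=> H.
have : \forall y \near c^'+, False.
  near=> y.
  have cy : c < y by near: y; exact: nbhs_right_gt.
  have yb : y < b by near: y; exact: nbhs_right_lt.
  have Sy : S y.
    split; first by rewrite (ltW yb) (le_trans ac (ltW cy)).
    have : K y - K c <= Phi y - Phi c + e * (y - c) by near: y.
    by case: Sc => _; rewrite !mulrBr; lra.
  have : y <= c by apply: ub_le_sup => //; case: supS.
  by rewrite leNgt cy.
by case/filter_ex.
Unshelve. all: by end_near. Qed.

Lemma integral_scale_indic (c : R) (A D : set R) : 0 <= c ->
  measurable A -> measurable D ->
  (\int[mu]_(x in D) (c * \1_A x)%:E = c%:E * mu (A `&` D))%E.
Proof.
move=> c0 mA mD; under eq_integral do rewrite EFinM.
rewrite ge0_integralZl_EFin ?integral_indic//.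
exact/measurable_EFinP/measurable_indic.
Qed.

(* phi is the sum over k of e times the indicator of an open neighbourhood of
   {k e < p}. *)
Lemma vitali_caratheodory (p : R -> R) (D : set R) (e : R) :
  measurable D -> (mu D < +oo)%E -> measurable_fun D p ->
  (forall x, D x -> 0 <= p x) -> 0 < e ->
  exists phi : R -> \bar R, [/\ lower_semicontinuous phi,
    (forall x, 0 <= phi x)%E,
    (forall x, D x -> (p x)%:E <= phi x)%E &
    (\int[mu]_(x in D) phi x <=
      \int[mu]_(x in D) (p x)%:E + e%:E * mu D + (e ^+ 2)%:E)%E].
Proof.
move=> mD Doo mp p0 e0.
pose E k := D `&` [set x | k%:R * e < p x].
have mE k : measurable (E k).
  rewrite /E.
  have := mp mD `]k%:R * e, +oo[%classic (measurable_itv _).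
  by congr (measurable _); apply/seteqP; split => x /=; rewrite in_itv/= andbT.
have ED k : E k `<=` D by exact: subIsetl.
have Eoo k : (mu (E k) < +oo)%E.
  exact: le_lt_trans (le_measure mu (mem_set (mE k)) (mem_set mD) (ED k)) Doo.
(* The excesses of [U k] over [E k] then sum to at most e, and weighted by e they give the error
   term e^2. *)
pose dl (k : nat) := e / (2 ^ k.+1)%:R.
have dl0 k : 0 < dl k by rewrite divr_gt0// ltr0n expn_gt0.
have [U HU] : {U : nat -> set R & forall k, [/\ open (U k), E k `<=` U k &
    (mu (U k `\` E k) < (dl k)%:E)%E]}.
  by apply: (@choice _ _ (fun k V => [/\ open V, E k `<=` V &
    (mu (V `\` E k) < (dl k)%:E)%E])) => k; exact: (lebesgue_regularity_outer (mE k) (Eoo k) (dl0 k)).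
have mU k : measurable (U k) by apply: open_measurable; case: (HU k).
pose psi k x : \bar R := (e * \1_(U k) x)%:E.
have psi0 k x : (0 <= psi k x)%E by rewrite lee_fin mulr_ge0// ltW.
have mpsi k : measurable_fun D (psi k).
  by apply/measurable_EFinP; apply: measurable_funM => //; exact: measurable_indic.
exists (fun x => \sum_(k <oo) psi k x)%E; split.
- move=> x c ax.
  have [n cn] : exists n, (c%:E < \sum_(0 <= k < n) psi k x)%E.
    apply: contrapT => /forallNP H; move: ax; apply/negP; rewrite -leNgt.
    apply: lime_le; first by apply: is_cvg_nneseries => *; exact: psi0.
    by apply: nearW => n; rewrite leNgt; apply/negP; exact: H.
  (* A partial sum cannot drop near x, because each [U k] containing x is open and contains a
     neighbourhood of x. *)
  have near_le m : \forall y \near x,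
      (\sum_(0 <= k < m) psi k x <= \sum_(0 <= k < m) psi k y)%E.
    elim: m => [|m IH]; first by near=> y; rewrite !big_nil.
    have Hm : \forall y \near x, (psi m x <= psi m y)%E.
      have [xU|xU] := pselect (U m x); last first.
        by near=> y; rewrite {1}/psi indicE memNset// mulr0.
      have : nbhs x (U m) by apply: open_nbhs_nbhs; split => //; case: (HU m).
      by apply: filterS => y yU; rewrite /psi !indicE !mem_set.
    by near=> y; rewrite !big_nat_recr//=; apply: leeD; near: y.
  exists [set y | (\sum_(0 <= k < n) psi k x <= \sum_(0 <= k < n) psi k y)%E].
    exact: near_le.
  move=> y /= Hy; apply: (lt_le_trans (lt_le_trans cn Hy)).
  by apply: nneseries_lim_ge => *; exact: psi0.
- by move=> x; apply: nneseries_ge0 => *; exact: psi0.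
- move=> x Dx.
  (* With n the least integer such that p x <= n e, the first n terms at x all equal e. *)
  have [n [pn Hn]] : exists n : nat, p x <= n%:R * e /\ forall k, (k < n)%N -> k%:R * e < p x.
    have [m pm] : exists m : nat, p x <= m%:R * e.
      exists (Num.truncn (p x / e)).+1.
      by rewrite -ler_pdivrMr// ltW// truncnS_gt.
    elim: m pm => [|m IH] pm; first by exists 0%N.
    have [/IH//|pm'] := leP (p x) (m%:R * e).
    exists m.+1; split => // k; rewrite ltnS => km.
    by apply: le_lt_trans pm'; rewrite ler_pM2r// ler_nat.
  apply: (@le_trans _ _ (\sum_(0 <= k < n) psi k x)%E); last first.
    by apply: nneseries_lim_ge => *; exact: psi0.
  rewrite (@eq_big_nat _ _ _ _ _ _ (fun=> e%:E)); last first.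
    move=> k kn; have [_ EU _] := HU k.
    rewrite /psi indicE mem_set ?mulr1//; apply: EU; split => //=.
    by apply: Hn; case/andP: kn.
  by rewrite sumEFin lee_fin sumr_const_nat subn0 -[leRHS]mulr_natl.
- rewrite integral_nneseries//.
  apply: (@le_trans _ _ (\sum_(k <oo) (e%:E * mu (E k) + (e ^+ 2 / (2 ^ k.+1)%:R)%:E))%E).
    apply: lee_nneseries => [k _ _|k _]; first exact: integral_ge0.
    rewrite (integral_scale_indic (ltW e0))//.
    rewrite expr2 -mulrA EFinM -muleDr//; last by rewrite fin_num_adde_defl.
    rewrite lee_pmul2l//.
    apply: (@le_trans _ _ (mu (U k))).
      exact: (le_measure mu (mem_set (measurableI _ _ (mU k) mD)) (mem_set (mU k)) (@subIsetl _ _ _)).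
    have [_ EU dE] := HU k.
    rewrite -(setDUK EU) measureU//; last 3 first.
    + exact: mE.
    + exact: (measurableD (mU k) (mE k)).
    + by rewrite setDE setICA setICr setI0.
    by rewrite leeD2l// ltW.
  apply: le_trans.
    apply: epsilon_trick.
    + by move=> k; rewrite mule_ge0// lee_fin ltW.
    + by rewrite exprn_ge0// ltW.
  rewrite leeD2r//.
  rewrite (eq_eseriesr (g := fun k => (\int[mu]_(x in D) (e * \1_(E k) x)%:E)%E)); last first.
    move=> k _.
    by rewrite (integral_scale_indic (ltW e0))// (setIidl (@ED k)).
  have mpsi' k : measurable_fun D (fun x => (e * \1_(E k) x)%:E).
    by apply/measurable_EFinP; apply: measurable_funM => //; exact: measurable_indic.
  have psi0' k x : (0 <= (e * \1_(E k) x)%:E)%E by rewrite lee_fin mulr_ge0// ltW.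
  rewrite -integral_nneseries//.
  have -> : (\int[mu]_(x in D) (p x)%:E + e%:E * mu D = \int[mu]_(x in D) ((p x)%:E + (cst e%:E) x))%E.
    rewrite ge0_integralD//.
    + by rewrite integral_cst.
    + exact/measurable_EFinP.
    + by move=> x _; rewrite lee_fin ltW.
  apply: ge0_le_integral => //.
  + by move=> x _; apply: nneseries_ge0.
  + exact: (@ge0_emeasurable_sum _ _ _ D (fun k x => (e * \1_(E k) x)%:E) xpredT (fun k x _ _ => psi0' k x) (fun k _ => mpsi' k)).
  + by apply: emeasurable_funD => //; exact/measurable_EFinP.
  move=> x Dx; apply: lime_le; first by apply: is_cvg_nneseries => *; exact: psi0'.
  apply: nearW => n; rewrite -EFinD sumEFin lee_fin.
  elim: n => [|n IH]; first by rewrite big_nil addr_ge0 ?p0// ltW.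
  rewrite big_nat_recr//=.
  (* If x lies in [E n], then n e < p x, and the n + 1 terms up to this one sum to at most n e + e
     <= p x + e. *)
  have [xE|xE] := pselect (E n x); last by rewrite indicE memNset// mulr0 addr0.
  rewrite indicE mem_set// mulr1 lerD2r.
  apply: (@le_trans _ _ (n%:R * e)); last by case: xE => _ /ltW.
  apply: (@le_trans _ _ (\sum_(0 <= k < n) e)).
    by apply: ler_sum => k _; rewrite ler_piMr// ?ltW// indicE; case: (_ \in _).
  by rewrite sumr_const_nat subn0 -[leLHS]mulr_natl.
Unshelve. all: by end_near. Qed.

Lemma integrable_cst_itv (a b c : R) : mu.-integrable `[a, b] (cst c%:E).
Proof.
apply/integrableP; split => //; rewrite integral_cst//= lebesgue_measure_itv/=.
by case: ifP => _; rewrite ?mule0// -EFinD -EFinM ltry.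
Qed.

(** Truncating f below at -N and adding N makes it nonnegative. A lower semicontinuous majorant then
    exceeds its value at x, up to a small error, just to the right of x, so its indefinite integral
    grows at least as fast as F + N x there and [dini_le] applies. The truncation is removed by
    dominated convergence. *)
Let derivative_le (f F : R -> R) (a b : R) : a < b ->
  mu.-integrable `[a, b] (EFin \o f) -> {within `[a, b], continuous F} ->
  (forall x, a <= x < b -> (F y - F x) / (y - x) @[y --> x^'+] --> f x) ->
  F b - F a <= \int[mu]_(x in `[a, b]) f x.
Proof.
move=> ab intf cF dF.
have mf : measurable_fun `[a, b] f by apply/measurable_EFinP; exact: measurable_int intf.
have muab : mu `[a, b] = (b - a)%:E by rewrite lebesgue_measure_itv/= lte_fin ab.
pose fN (N : nat) x := Num.max (f x) (- N%:R).
have mfN N : measurable_fun `[a, b] (fN N) by apply: measurable_maxr.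
have fNf N x : `|fN N x| <= `|f x|.
  rewrite /fN /Num.max; case: ltP => // h; rewrite normrN ger0_norm//.
  have h0 : f x <= 0 by rewrite (le_trans (ltW h))// oppr_le0.
  by rewrite ler0_norm// lerNr ltW.
have ifN N : mu.-integrable `[a, b] (EFin \o fN N).
  apply: le_integrable intf => //; first by apply/measurable_EFinP; exact: mfN.
  by move=> x _; rewrite lee_fin.
have H N : F b - F a <= \int[mu]_(x in `[a, b]) fN N x.
  pose p x := fN N x + N%:R.
  have ip : mu.-integrable `[a, b] (EFin \o p).
    rewrite (_ : _ \o _ = (EFin \o fN N) \+ (cst N%:R%:E))%E//.
    by apply: integrableD => //; exact: integrable_cst_itv.
  have Ip : \int[mu]_(x in `[a, b]) p x = \int[mu]_(x in `[a, b]) fN N x + N%:R * (b - a).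
    rewrite RintegralD//; first by rewrite Rintegral_cst//= lebesgue_measure_itv/= lte_fin ab.
    by exact: integrable_cst_itv.
  suff Hp : F b - F a + N%:R * (b - a) <= \int[mu]_(x in `[a, b]) p x.
    by move: Hp; rewrite Ip; lra.
  have p0 x : 0 <= p x.
    by rewrite /p -lerBlDr sub0r le_max lexx orbT.
  apply/ler_addgt0Pr => d d0.
  (* The cap at 1 gives e^2 <= e, so that both error terms of [vitali_caratheodory] together stay
     below d. *)
  pose e := Num.min 1 (d / (b - a + 1)).
  have ba1 : 0 < b - a + 1 by rewrite ltr_wpDl ?subr_ge0// ltW.
  have e0 : 0 < e by rewrite lt_min ltr01 divr_gt0.
  have ed : e * (b - a) + e ^+ 2 <= d.
    apply: (@le_trans _ _ (e * (b - a + 1))).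
      have : e * e <= e * 1 by rewrite ler_pM2l// ge_min lexx.
      by rewrite expr2; lra.
    by rewrite -ler_pdivlMr// ge_min lexx orbT.
  have [phi [lsc phi0 pphi Iphi]] := @vitali_caratheodory p `[a, b]%classic e
    (measurable_itv _) (ltac:(by rewrite muab ltry))
    (ltac:(by apply/measurable_EFinP; exact: measurable_int ip)) (fun x _ => p0 x) e0.
  have mphi : measurable_fun setT phi by exact: lower_semicontinuous_measurable.
  have Ipf : (\int[mu]_(x in `[a, b]) (p x)%:E)%E \is a fin_num by exact: integrable_fin_num ip.
  have Iphioo : (\int[mu]_(x in `[a, b]) phi x < +oo)%E.
    apply: (le_lt_trans Iphi); rewrite muab -EFinM -(fineK Ipf) -!EFinD; exact: ltry.
  pose Phi x := fine (\int[mu]_(t in `[a, x]) phi t).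
  have fPhi x : x <= b -> (\int[mu]_(t in `[a, x]) phi t)%E \is a fin_num.
    move=> xb; rewrite ge0_fin_numE ?integral_ge0//; apply: le_lt_trans Iphioo.
    apply: ge0_subset_integral => //; first exact: measurable_funTS.
    by apply: subset_itvl; rewrite bnd_simp.
  have PhiB x y : a <= x -> x <= y -> y <= b ->
      ((Phi y)%:E = (Phi x)%:E + \int[mu]_(t in `]x, y]) phi t)%E.
    move=> ax xy yb; rewrite /Phi !fineK ?fPhi//; last exact: le_trans yb.
    rewrite (@itv_bndbnd_setU _ _ _ (BRight x)) ?bnd_simp//.
    rewrite ge0_integral_setU//; first exact: measurable_funTS.
    by apply: lt_disjoint => u v; rewrite !in_itv/= => /andP[_ ux] /andP[xv _]; exact: le_lt_trans xv.
  have -> : F b - F a + N%:R * (b - a) = (F b + N%:R * b) - (F a + N%:R * a) by ring.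
  apply: (@le_trans _ _ (Phi b - Phi a)).
    apply: (@dini_le Phi (fun x => F x + N%:R * x)) => //; first exact: ltW.
    - move=> x y; rewrite !in_itv/= => /andP[ax xb] /andP[ay yb] xy.
      by rewrite -lee_fin (PhiB x y)// leeDl// integral_ge0.
    - move=> x; apply: cvgD; first exact: cF.
      apply: cvgM; first exact: cvg_cst.
      by apply: (@continuous_subspaceT _ _ `[a, b]%classic idfun) => z; exact: cvg_id.
    move=> x /andP[ax xb] eta eta0.
    have eta2 : 0 < eta / 2 by rewrite divr_gt0.
    have xab : `[a, b]%classic x by rewrite /= in_itv/= ax ltW.
    have /cvgrPdist_lt/(_ _ eta2) Hd := dF x (ltac:(by rewrite ax xb)).
    have Hphi : exists2 V, nbhs x V & forall y, V y -> ((p x - eta / 2)%:E < phi y)%E.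
      apply: lsc; apply: lt_le_trans (pphi x xab); rewrite lte_fin; lra.
    have [V xV HV] := Hphi.
    have [r /= r0 rV] := xV.
    near=> y.
    have xy : x < y by near: y; exact: nbhs_right_gt.
    have yb : y < b by near: y; exact: nbhs_right_lt.
    have yr : y < x + r by near: y; apply: nbhs_right_lt; rewrite ltrDl.
    have Fy : F y - F x <= (f x + eta / 2) * (y - x).
      rewrite -ler_pdivrMr ?subr_gt0//.
      have : `|f x - (F y - F x) / (y - x)| < eta / 2 by near: y.
      by rewrite ltr_norml => /andP[+ _]; lra.
    have fp : f x + N%:R <= p x by rewrite lerD2r le_max lexx.
    have Iy : (p x - eta / 2) * (y - x) <= Phi y - Phi x.
      rewrite lerBrDl -lee_fin (PhiB x y) ?(ltW xy) ?(ltW yb)// EFinD leeD2l//.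
      have [h|h] := leP 0 (p x - eta / 2); last first.
        apply: (@le_trans _ _ 0%E); last exact: integral_ge0.
        by rewrite lee_fin mulr_le0_ge0 ?subr_ge0// ltW.
      apply: (@le_trans _ _ (\int[mu]_(t in `]x, y]) (cst (p x - eta / 2)%:E t))%E).
        by rewrite integral_cst//= lebesgue_measure_itv/= lte_fin xy.
      apply: ge0_le_integral => //; [exact: measurable_funTS|].
      move=> t /=; rewrite in_itv/= => /andP[xt ty]; apply/ltW/HV/rV => /=.
      by rewrite distrC ger0_norm ?subr_ge0 ?ltW// ltrBlDl (le_lt_trans ty).
    have := Fy; have := Iy; move: fp.
    move: (Phi y) (Phi x) (F y) (F x) => A B C D.
    have : 0 < y - x by rewrite subr_gt0.
    by move: (y - x) (ltac:(ring) : y = x + (y - x)) => z ->; nra.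
  rewrite {2}/Phi set_itv1 integral_set1 subr0.
  rewrite -lee_fin /Phi fineK ?fPhi//; apply: (le_trans Iphi).
  rewrite /Rintegral EFinD fineK// muab -EFinM -addeA -EFinD leeD2l//.
have cv : \int[mu]_(x in `[a, b]) fN N x @[N --> \oo] --> \int[mu]_(x in `[a, b]) f x.
  apply: fine_cvg; rewrite fineK; last exact: integrable_fin_num intf.
  refine (@dominated_cvg _ _ R mu `[a, b]%classic _ (fun N x => (fN N x)%:E) (fun x => (f x)%:E) (fun x => `|f x|%:E) _ _ _ _ _) => //.
  - by move=> N; apply/measurable_EFinP; exact: mfN.
  - move=> x _; apply: cvg_EFin; first by apply: nearW.
    apply: cvg_near_cst; near=> N.
    rewrite /= /fN /Num.max; case: ltP => // h; exfalso; move: h; apply/negP.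
    rewrite -leNgt lerNl; near: N; exact: nbhs_infty_ger.
  - exact: integrable_norm.
  - by move=> N x _; rewrite lee_fin.
apply: (cvgr_to_ge cv); exact: nearW.
Unshelve. all: by end_near. Qed.

(* The derivative need not be continuous: F is compared with the integral of a
   lower semicontinuous function slightly above f. *)
Lemma FTC_everywhere_right_derivative (f F : R -> R) (a b : R) : a < b ->
  mu.-integrable `[a, b] (EFin \o f) -> {within `[a, b], continuous F} ->
  (forall x, a <= x < b -> (F y - F x) / (y - x) @[y --> x^'+] --> f x) ->
  \int[mu]_(x in `[a, b]) f x = F b - F a.
Proof.
move=> ab intf cF dF; apply/eqP; rewrite eq_le; apply/andP; split; last first.
  exact: derivative_le.
have := @derivative_le (fun x => - f x) (fun x => - F x) a b ab.
have -> : \int[mu]_(x in `[a, b]) - f x = - \int[mu]_(x in `[a, b]) f x.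
  rewrite -mulN1r -RintegralZl//.
  by apply: eq_Rintegral => x _; rewrite mulN1r.
move=> H; rewrite -lerN2; apply: le_trans (H _ _ _); first lra.
- by have := integrableN intf.
- by move=> x; apply: cvgN; exact: cF.
- move=> x /dF h.
  rewrite (_ : (fun y => _) = (fun y => - ((F y - F x) / (y - x)))); first exact: cvgN.
  by apply/funext => y; rewrite -opprD mulNr.
Qed.

End everywhere_derivative.

(** * Normal laws *)

Section density.
Local Open Scope ereal_scope.
Context d (T : measurableType d) (R : realType).
Variables (mu nu : {measure set T -> \bar R}) (p : T -> R).
Hypothesis mp : measurable_fun setT p.
Hypothesis p0 : forall x, (0 <= p x)%R.
Hypothesis nuE : forall A, measurable A -> nu A = \int[mu]_(x in A) (p x)%:E.
Import HBNNSimple.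

Lemma ge0_integral_density (f : T -> \bar R) :
  measurable_fun setT f -> (forall x, 0 <= f x) ->
  \int[nu]_x f x = \int[mu]_x (f x * (p x)%:E).
Proof.
move=> mf f0; pose h := nnsfun_approx measurableT mf.
have hf x : (h n x)%:E @[n --> \oo] --> f x by exact: cvg_nnsfun_approx.
have mep : measurable_fun setT (EFin \o p) by exact/measurable_EFinP.
have mh n : measurable_fun setT (fun x => (h n x)%:E) by exact/measurable_EFinP.
have -> : \int[nu]_x f x = limn (fun n => \int[nu]_x (h n x)%:E).
  rewrite -monotone_convergence//.
  - by apply: eq_integral => x _; apply/esym/cvg_lim.
  - by move=> n x _; rewrite lee_fin.
  - by move=> x _ a b ab; rewrite lee_fin//; exact/lefP/nd_nnsfun_approx.
have -> : \int[mu]_x (f x * (p x)%:E) =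
    limn (fun n => \int[mu]_x ((h n x)%:E * (p x)%:E)).
  rewrite -monotone_convergence//.
  - by apply: eq_integral => x _; apply/esym/cvg_lim => //; apply: cvgeZr.
  - by move=> n; apply: emeasurable_funM.
  - by move=> n x _; rewrite mule_ge0// lee_fin.
  - by move=> x _ a b ab; rewrite lee_wpmul2r ?lee_fin//; exact/lefP/nd_nnsfun_approx.
congr (limn _); apply/funext => n.
transitivity (\int[nu]_x
   (\sum_(y \in range (h n)) (y * \1_(h n @^-1` [set y]) x)%:E)).
  by apply: eq_integral => t tE; rewrite /= fimfunE -fsumEFin.
have mind r : measurable_fun setT (fun x => (r * \1_(h n @^-1` [set r]) x)%:E).
  by apply/measurable_EFinP; exact: measurable_funM.
rewrite ge0_integral_fsum//; last by move=> m y Ey; exact: nnfun_muleindic_ge0.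
transitivity (\int[mu]_x (\sum_(y \in range (h n))
    (y * \1_(h n @^-1` [set y]) x)%:E * (p x)%:E)); last first.
  apply: eq_integral => x _.
  rewrite -ge0_mule_fsuml => [|y]; last exact: nnfun_muleindic_ge0.
  by rewrite fsumEFin // -(fimfunE _ x).
rewrite ge0_integral_fsum//; last 2 first.
  - by move=> y; apply: emeasurable_funM.
  - by move=> m y Ey; rewrite mule_ge0 ?lee_fin//; have := nnfun_muleindic_ge0 (h n) m y; rewrite -EFinM lee_fin.
apply: eq_fsbigr => r rhn.
have [r0|r0] := ltP r 0%R.
  rewrite preimage_nnfun0//.
  by rewrite !integral0_eq// => x _; rewrite indic0 mulr0 ?mul0e.
have mA : measurable (h n @^-1` [set r]) by [].
transitivity (r%:E * nu (h n @^-1` [set r])).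
  under eq_integral do rewrite EFinM.
  rewrite ge0_integralZl_EFin ?integral_indic ?setIT//.
  exact/measurable_EFinP/measurable_indic.
rewrite nuE// integral_mkcond -ge0_integralZl_EFin//; last 2 first.
  - by move=> x _; rewrite patchE; case: ifP => // _; rewrite lee_fin.
  - exact/(measurable_restrictT _ _).1/measurable_funTS.
apply: eq_integral => x _; rewrite patchE indicE.
by case: ifP => _; rewrite ?mulr1 ?mulr0 ?mule0 ?mul0e.
Qed.

End density.

(** * Probability measures on the line are determined by Lipschitz test functions *)

Section laws_on_the_line.
Context {R : realType}.
Implicit Types P Q : probability (measurableTypeR R) R.

(** A probability is the Stieltjes measure of its distribution function, and such a measure is
    unique given its values on half-open intervals. *)
Lemma eq_probability_itvNyc P Q :
  (forall a : R, P (`]-oo, a]%classic : set R) = Q (`]-oo, a]%classic : set R)) ->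
  forall A, measurable A -> P A = Q A.
Proof.
move=> PQ A mA; rewrite -(lebesgue_stieltjes_cdf_id P mA).
apply: lebesgue_stieltjes_measure_unique => // _ [[a b] /= _ <-].
rewrite lebesgue_stieltjes_cdf_id//.
have [ab|ba] := leP a b; last by rewrite set_itv_ge ?measure0// bnd_simp -leNgt ltW.
have H (S : probability (measurableTypeR R) R) :
    (S (`]-oo, b]%classic : set R) = S (`]-oo, a]%classic : set R) + S (`]a, b]%classic : set R))%E.
  rewrite -measureU//; last first.
    apply/seteqP; split => // x/=; rewrite !in_itv/= => -[xa /andP[ax _]].
    by move: ax; rewrite ltNge xa.
  congr (S _); apply/seteqP; split => x/=; rewrite !in_itv/=.
    by move=> xb; have [|] := leP x a; [left|right].
  by case=> [xa|/andP[]//]; exact: le_trans ab.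
have Pb := PQ b; rewrite !H PQ in Pb.
have fq : Q (`]-oo, a]%classic : set R) \is a fin_num by rewrite fin_num_measure.
rewrite -[LHS](addeK _ fq) -[RHS](addeK _ fq); congr (_ - _)%E.
by rewrite addeC Pb addeC.
Qed.

(** A Lipschitz majorant of the indicator of ]-oo, a], for k > 0 equal to 1 up to a and to 0 from a
    + 1/k on. The Lipschitz bound lets laws pass to L^2 limits. *)
Definition ramp (k a x : R) : R := Num.min 1 (Num.max 0 (1 - k * (x - a))).

Lemma ramp_ge0 k a x : 0 <= ramp k a x.
Proof. by rewrite /ramp le_min ler01 le_max lexx. Qed.

Lemma ramp_le1 k a x : ramp k a x <= 1.
Proof. by rewrite /ramp ge_min lexx. Qed.

Lemma ramp_lipschitz k a x y : 0 <= k -> `|ramp k a x - ramp k a y| <= k * `|x - y|.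
Proof.
move=> k0; have clip (u v : R) : u <= v ->
    0 <= Num.min 1 (Num.max 0 v) - Num.min 1 (Num.max 0 u) <= v - u.
  move=> uv; move: uv; case: (leP 0 v) => ?; case: (leP 0 u) => ?; case: (leP 1 v) => ?;
  case: (leP 1 u) => ? uv; rewrite ?(min_r (@ler01 R)); apply/andP; split; lra.
wlog xy : x y / x <= y => [H|].
  have [/H//|/ltW/H] := leP x y.
  by rewrite distrC (distrC y).
have /clip/andP[] : 1 - k * (y - a) <= 1 - k * (x - a).
  by rewrite lerD2l lerN2 ler_wpM2l// lerB.
rewrite -!/(ramp _ _ _) => h1 h2; rewrite ger0_norm// distrC ger0_norm ?subr_ge0//.
by apply: (le_trans h2); rewrite le_eqVlt; apply/orP; left; apply/eqP; ring.
Qed.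

Lemma measurable_ramp k a : measurable_fun setT (ramp k a).
Proof.
apply: measurable_minr => //; apply: measurable_maxr => //.
apply: measurable_funB => //; apply: measurable_funM => //.
exact: measurable_funB.
Qed.

Lemma integral_ramp_cvg P (a : R) :
  (\int[P]_x (ramp n%:R a x)%:E)%E @[n --> \oo] --> P (`]-oo, a]%classic : set R).
Proof.
have -> : P (`]-oo, a]%classic : set R) = (\int[P]_x (\1_(`]-oo, a]%classic : set R) x)%:E)%E.
  by rewrite integral_indic// setIT.
apply: (@dominated_cvg _ _ R P setT _ (fun n x => (ramp n%:R a x)%:E) _ (cst 1%E)) => //.
- by move=> n; apply/measurable_EFinP; exact: measurable_ramp.
- move=> x _; apply: cvg_EFin; first exact: nearW.
  apply: cvg_near_cst; rewrite indicE.
  have [xa|ax] := leP x a.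
    rewrite mem_set/= ?in_itv//=; apply: nearW => n; rewrite /ramp/=.
    have : n%:R * (x - a) <= 0 by rewrite mulr_ge0_le0 ?subr_le0.
    by move=> h; rewrite max_r ?min_l//; lra.
  rewrite memNset/= ?in_itv/= ?leNgt ?ax//; near=> n; rewrite /ramp/=.
  have : 1 <= n%:R * (x - a).
    rewrite -ler_pdivrMr ?subr_gt0//; near: n; exact: nbhs_infty_ger.
  by move=> h; rewrite max_l ?min_r//; lra.
- exact: finite_measure_integrable_cst.
- by move=> n x _; rewrite /= lee_fin ger0_norm ?ramp_ge0// ramp_le1.
Unshelve. all: by end_near. Qed.

Lemma eq_probability_ramp P Q :
  (forall n a, \int[P]_x (ramp n%:R a x)%:E = \int[Q]_x (ramp n%:R a x)%:E)%E ->
  forall A, measurable A -> P A = Q A.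
Proof.
move=> PQ; apply: eq_probability_itvNyc => a.
have := @integral_ramp_cvg P a.
under eq_cvg do rewrite PQ.
move=> /(cvg_unique (@ereal_hausdorff R)); apply; exact: integral_ramp_cvg.
Qed.

End laws_on_the_line.

(** * Affine changes of variable for Lebesgue measure *)

Section affine.
Local Open Scope ereal_scope.
Context {R : realType}.
Notation mu := (@lebesgue_measure R).

Let aff (c d : R) : R -> measurableTypeR R := fun x => (c * x + d)%R.
Let maff c d :
  measurable_fun setT (aff c d : measurableTypeR R -> measurableTypeR R).
Proof. by apply: measurable_funD => //; exact: measurable_funM. Qed.

(** The image of Lebesgue measure under x |-> c x + d, multiplied by c, agrees with Lebesgue measure
    on half-open intervals, hence everywhere. *)
Lemma ge0_integral_affine (c d : R) (D : set R) (f : R -> \bar R) : (0 < c)%R ->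
  measurable D -> measurable_fun D f -> (forall x, D x -> 0 <= f x) ->
  \int[mu]_(x in D) f x =
  c%:E * \int[mu]_(x in (fun x => c * x + d)%R @^-1` D) f (c * x + d)%R.
Proof.
move=> c0 mD mf f0.
pose m0 : {measure set (measurableTypeR R) -> \bar R} :=
  measure_function_pushforward__canonical__measure_function_Measure mu (maff c d).
pose m : {measure set (measurableTypeR R) -> \bar R} := mscale (NngNum (ltW c0)) m0.
have muE (A : set (measurableTypeR R)) : measurable A -> mu A = m A.
  apply: lebesgue_measure_unique => _ [[a b]/= _ <-].
  rewrite /m/= /mscale/= /m0/= /pushforward.
  have -> : aff c d @^-1` `]a, b] = `]((a - d) / c)%R, ((b - d) / c)%R]%classic.
    apply/seteqP; split => x; rewrite /= !in_itv/= /aff;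
    by rewrite ltr_pdivrMr// ler_pdivlMr// ltrBlDr lerBrDr mulrC.
  rewrite !lebesgue_measure_itv/= !lte_fin ltr_pM2r ?invr_gt0// ltrD2r.
  case: ifP => _; last by rewrite mule0.
  by rewrite -!EFinB -EFinM; congr (_%:E); field; rewrite gt_eqF.
rewrite (eq_measure_integral m) => [|A mA _]; last exact: muE.
rewrite /m ge0_integral_mscale//; congr (_ * _).
apply: (ge0_integral_pushforward (maff c d)) => //.
by move=> x; rewrite inE => /f0.
Qed.

Lemma ge0_integral_opp (D : set R) (f : R -> \bar R) :
  measurable D -> measurable_fun D f -> (forall x, D x -> 0 <= f x) ->
  \int[mu]_(x in D) f x = \int[mu]_(x in -%R @^-1` D) f (- x)%R.
Proof.
move=> mD mf f0.
have mN : measurable_fun setT (-%R : measurableTypeR R -> measurableTypeR R).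
  exact: oppr_measurable.
rewrite -[RHS](@ge0_integral_pushforward _ _ _ _ _ _ mN mu D f)//.
  by apply: eq_measure_integral => A mA _; exact/esym/lebesgue_measureN.
by move=> x; rewrite inE => /f0.
Qed.

End affine.

(** * Moments and rotation invariance of the standard normal law *)

Section standard_normal.
Context {R : realType}.
Notation mu := (@lebesgue_measure R).
Notation N := (@normal_prob R 0 1).
Let phi : R -> R := normal_pdf 0 1.

Let mphi : measurable_fun setT phi. Proof. exact: measurable_normal_pdf. Qed.
Let phi0 x : 0 <= phi x. Proof. exact: normal_pdf_ge0. Qed.

Let phiE x : phi x = normal_peak 1 * expR (- (x ^+ 2 / 2)).
Proof.
rewrite /phi normal_pdfE ?oner_eq0// /normal_fun subr0 expr1n; congr (_ * expR _).
by rewrite mulNr.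
Qed.

Lemma normal_prob_affine (m s : R) (A : set (measurableTypeR R)) : 0 < s ->
  measurable A ->
  normal_prob m s A = N ((fun x : R => s * x + m) @^-1` A).
Proof.
move=> s0 mA; rewrite /normal_prob (@ge0_integral_affine _ s m)//; first last.
- by move=> x _; rewrite lee_fin normal_pdf_ge0.
- by apply/measurable_EFinP/measurable_funTS; exact: measurable_normal_pdf.
rewrite -ge0_integralZl_EFin ?ltW//; first last.
- apply/measurable_EFinP/measurable_funTS.
  apply: measurableT_comp; first exact: measurable_normal_pdf.
  by apply: measurable_funD => //; exact: measurable_funM.
- by move=> x _; rewrite lee_fin normal_pdf_ge0.
- have := @measurable_funD _ _ _ setT (fun x : R => s * x) (cst m).
  move=> /(_ (measurable_funM (measurable_cst _) (@measurable_id _ _ _)) (measurable_cst _)).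
  by move=> /(_ measurableT A mA); rewrite setTI.
apply: eq_integral => x _; rewrite -EFinM; congr (_%:E).
rewrite -/(phi x) phiE normal_pdfE ?gt_eqF// /normal_fun addrK /normal_peak.
rewrite mulrA expr1n mul1r; congr (_ * expR _); last first.
  by rewrite exprMn mulNr -mulr_natr; congr (- _); field; rewrite gt_eqF.
rewrite -mulrnAr sqrtrM ?sqr_ge0// sqrtr_sqr gtr0_norm//.
by rewrite invfM mulrA divff ?gt_eqF// mul1r.
Qed.

(** Presenting N(m, v) as an image of the standard normal law absorbs the degenerate case v = 0 once
    and for all. *)
Lemma gaussian_prob_affine (m v : R) (A : set (measurableTypeR R)) : 0 <= v ->
  measurable A ->
  gaussian_prob m v A = N ((fun x : R => Num.sqrt v * x + m) @^-1` A).
Proof.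
move=> v0 mA; rewrite /gaussian_prob; have [->|vn0] := eqVneq v 0.
  rewrite sqrtr0 /= diracE.
  have -> : (fun x : R => 0 * x + m) = cst m by apply/funext => x; rewrite mul0r add0r.
  rewrite preimage_cst; case: (m \in A) => /=; last by rewrite measure0.
  by have /= -> := @probability_setT _ _ _ (normal_prob 0 1).
have s0 : 0 < Num.sqrt v by rewrite sqrtr_gt0 lt_neqAle eq_sym vn0.
exact: normal_prob_affine.
Qed.

Lemma integral_std_normal (f : R -> \bar R) : measurable_fun setT f ->
  (forall x, 0 <= f x)%E ->
  (\int[N]_x f x = \int[mu]_x (f x * (phi x)%:E))%E.
Proof. by move=> mf f0; apply: ge0_integral_density. Qed.

Lemma std_normal_opp (f : R -> \bar R) : measurable_fun setT f ->
  (forall x, 0 <= f x)%E ->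
  (\int[N]_x f x = \int[N]_x f (- x)%R)%E.
Proof.
move=> mf f0; rewrite !integral_std_normal//; last first.
  by apply: measurableT_comp => //; exact: oppr_measurable.
have /= H := @ge0_integral_opp _ setT (fun x => f x * (phi x)%:E)%E measurableT.
rewrite H; first last.
- by move=> x _; apply: mule_ge0; [exact: f0|rewrite lee_fin; exact: phi0].
- by apply: emeasurable_funM; [exact: mf|apply/measurable_EFinP; exact: mphi].
by rewrite preimage_setT; apply: eq_integral => x _; rewrite !phiE sqrrN.
Qed.

Let cphi : continuous phi.
Proof. by apply: continuous_normal_pdf; rewrite oner_eq0. Qed.

Let dphi (x : R) : is_derive x 1 phi (- x * phi x).
Proof.
have -> : phi = (fun y : R => normal_peak 1 * expR (- (y ^+ 2 / 2))).
  by apply/funext => y; exact: phiE.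
apply: is_derive_eq => /=.
by rewrite !scaler0 add0r /GRing.scale/= mulr1; field.
Qed.

Let phi_cvg : phi x @[x --> +oo] --> (0 : R).
Proof.
rewrite (_ : phi = (fun y : R => normal_peak 1 * expR (- (y ^+ 2 / 2)))); last first.
  by apply/funext => y; exact: phiE.
rewrite -(mulr0 (normal_peak 1)); apply: cvgM; first exact: cvg_cst.
apply: (cvg_comp (fun x : R => x ^+ 2 / 2) (fun x => expR (- x))); last exact: cvgr_expR.
by apply: gt0_cvgMly; [|exact: cvgr_expr2].
Qed.

Let integral_x_phi (y : R) : 0 <= y ->
  (\int[mu]_(x in `[y, +oo[) (x * phi x)%:E = (phi y)%:E)%E.
Proof.
move=> y0; rewrite (@ge0_continuous_FTC2y R _ (fun x => - phi x) y 0).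
- by rewrite sub0e -EFinN opprK.
- by move=> x yx; rewrite mulr_ge0// (le_trans y0).
- apply: continuous_subspaceT => x.
  by apply: cvgM; [exact: cvg_id|exact: cphi].
- by rewrite -oppr0; apply: cvgN; exact: phi_cvg.
- by move=> x _; apply: derivableN; have [] := dphi x.
- by apply: cvgN; apply: cvg_at_right_filter; exact: cphi.
- move=> x _; rewrite derive1E deriveN; last by have [] := dphi x.
  by have [_ ->] := dphi x; rewrite mulNr opprK.
Qed.

(** Write one factor x as the integral of dy over [0, x] and exchange: the integral of x phi(x) over
    [y, +oo[ is phi(y), so the second moment equals the total mass. Parity reduces both to the half
    line. *)
Lemma std_normal_second_moment : (\int[N]_x (x ^+ 2)%:E = 1)%E.
Proof.
rewrite integral_std_normal//; last first.
- by move=> x; rewrite lee_fin sqr_ge0.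
- by apply/measurable_EFinP; exact: measurable_funX.
have mid : measurable_fun setT (fun x : R => x) by exact: measurable_id.
have D0 : measurable [set x : R | 0 <= x].
  by rewrite -set_itvcy; exact: measurable_itv.
under eq_integral do rewrite -EFinM.
rewrite (@ge0_symfun_integralT R (fun x => x ^+ 2 * phi x)); first last.
- by move=> x; rewrite /= sqrrN !phiE sqrrN.
- move=> x; apply: cvgM; last exact: cphi.
  exact: exprn_continuous.
- by move=> x; rewrite mulr_ge0// sqr_ge0.
have <- := @integral_normal_pdf R 0 1.
rewrite (@ge0_symfun_integralT R phi)//; last by move=> x; rewrite /= !phiE sqrrN.
congr (_ * _)%E.
pose A := [set p : R * R | 0 <= p.2 <= p.1].
have mA : measurable A.
  have -> : A = setT `&` ((fun p : R * R => (0 <= p.2) && (p.2 <= p.1)) @^-1` [set true]).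
    by rewrite setTI; apply/seteqP; split.
  by apply: measurable_and => //; apply: measurable_fun_ler => //.
pose h p : \bar R := ((p.1 * phi p.1) * \1_A p)%:E.
have h0 p : (0 <= h p)%E.
  rewrite lee_fin indicE; have [|] := boolP (p \in A); last by rewrite mulr0.
  by rewrite inE => -[/andP[u v]]; rewrite mulr1 mulr_ge0// (le_trans u).
have mh : measurable_fun setT h.
  apply/measurable_EFinP; apply: measurable_funM; last exact: measurable_indic.
  by apply: measurable_funM => //; apply: measurableT_comp.
transitivity (\int[mu]_x \int[mu]_y h (x, y))%E.
  rewrite integral_mkcond; apply: eq_integral => x _; rewrite patchE.
  case: ifPn => [|x0].
    rewrite inE/= => x0.
    transitivity (\int[mu]_y ((x * phi x) * \1_(`[0, x]%classic : set R) y)%:E)%E; last first.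
      apply: eq_integral => y _; rewrite /h/=; congr (_ * _)%:E; rewrite !indicE; congr (nat_of_bool _)%:R.
    rewrite (_ : (\int[mu]_y _)%E = ((x * phi x)%:E * mu (`[0%R, x]%classic `&` setT))%E); last first.
      by apply: integral_scale_indic => //; rewrite mulr_ge0.
    rewrite setIT lebesgue_measure_itv/= lte_fin.
    have [x1|] := ltP 0 x; first by rewrite oppr0 adde0 -EFinM; congr (_%:E); ring.
    move=> x1; have -> : x = 0 by apply/eqP; rewrite eq_le x1 x0.
    by rewrite expr0n !mul0r mul0e.
  rewrite integral0_eq// => y _; rewrite /h indicE memNset ?mulr0//=.
  move=> /andP[u v]; move/negP: x0; apply; rewrite inE/=; exact: le_trans v.
rewrite fubini_tonelli// [RHS]integral_mkcond; apply: eq_integral => y _; rewrite patchE.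
case: ifPn => [|y0].
  rewrite inE/= => y0; rewrite -(integral_x_phi y0) [RHS]integral_mkcond.
  apply: eq_integral => x _; rewrite patchE /h indicE /=.
  have [xy|xy] := boolP (x \in `[y, +oo[%classic).
    have xy' : y <= x by move: xy; rewrite inE/= in_itv/= andbT.
    have -> : (x, y) \in A by apply/mem_set => /=; apply/andP; split.
    by rewrite mulr1.
  rewrite memNset ?mulr0//= => /andP[_ yx]; move/negP: xy; apply.
  by rewrite inE/= in_itv/= yx.
rewrite integral0_eq// => x _; rewrite /h indicE memNset ?mulr0//=.
by move=> /andP[u v]; move/negP: y0; apply; rewrite inE.
Qed.

Lemma std_normal_rotation (a b : R) (f : R -> \bar R) : 0 <= a -> 0 <= b ->
  measurable_fun setT f -> (forall x, 0 <= f x)%E ->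
  (\int[N]_x \int[N]_y f (a * x + b * y)%R =
   \int[N]_z f (Num.sqrt (a ^+ 2 + b ^+ 2) * z)%R)%E.
Proof.
move=> a0; rewrite le_eqVlt => /predU1P[<-|b0] mf f0.
  rewrite expr0n addr0 sqrtr_sqr ger0_norm//.
  apply: eq_integral => x _; under eq_integral do rewrite mul0r addr0.
  by rewrite integral_cst//; have /= -> := @probability_setT _ _ _ (normal_prob 0 1); rewrite mule1.
pose c := Num.sqrt (a ^+ 2 + b ^+ 2).
have c2 : c ^+ 2 = a ^+ 2 + b ^+ 2 by rewrite sqr_sqrtr// addr_ge0// sqr_ge0.
have c0 : 0 < c by rewrite sqrtr_gt0 ltr_wpDl ?sqr_ge0// exprn_gt0.
have mlin u v : measurable_fun setT (fun x : R => u * x + v).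
  by apply: measurable_funD => //; exact: measurable_funM.
have mlin' u : measurable_fun setT (fun x : R => u * x).
  exact: measurable_funM.
pose G (p : R * R) := (f (c * p.2)%R * (phi p.1 * (c / b) * phi (c * p.2 / b - a * p.1 / b))%:E)%E.
have G0 p : (0 <= G p)%E by rewrite mule_ge0// lee_fin !mulr_ge0// ?invr_ge0 ltW.
have mG : measurable_fun setT G.
  apply: emeasurable_funM.
    by apply: measurableT_comp => //; apply: measurable_funM => //.
  apply/measurable_EFinP; apply: measurable_funM.
    by apply: measurable_funM => //; apply: measurableT_comp.
  apply: measurableT_comp => //; apply: measurable_funB.
    by do 2 apply: measurable_funM => //.
  by do 2 apply: measurable_funM => //.
transitivity (\int[mu]_x \int[mu]_z G (x, z))%E.
  have inner x : (\int[N]_y f (a * x + b * y)%R * (phi x)%:E =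
      \int[mu]_z G (x, z))%E.
    rewrite integral_std_normal//; last first.
      apply: measurableT_comp => //; under eq_fun do rewrite addrC.
      exact: mlin.
    rewrite (@ge0_integral_affine _ (c / b) (- (a * x / b)))//; first last.
    - by move=> y _; rewrite mule_ge0// lee_fin.
    - apply: emeasurable_funM; last exact/measurable_EFinP.
      apply: measurableT_comp => //; under eq_fun do rewrite addrC.
      exact: mlin.
    - by rewrite divr_gt0.
    rewrite preimage_setT muleC muleA -EFinM -ge0_integralZl_EFin//; first last.
    - by rewrite mulr_ge0// divr_ge0// ltW.
    - apply: emeasurable_funM.
        apply: measurableT_comp => //.
        apply: measurable_funD => //; apply: measurable_funM => //; exact: mlin.
      by apply/measurable_EFinP; apply: measurableT_comp => //; exact: mlin.
    - by move=> y _; rewrite mule_ge0// lee_fin.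
    apply: eq_integral => z _; rewrite /G/= muleC -muleA -EFinM.
    congr (f _ * _%:E)%E; first by field; rewrite gt_eqF.
    rewrite [LHS]mulrC; congr (_ * phi _); ring.
  rewrite integral_std_normal//.
  - by apply: eq_integral => x _; exact: inner.
  - apply: (@measurable_fun_fubini_tonelli_F _ _ _ _ _ N (fun p : R * R => f (a * p.1 + b * p.2))) => //.
    apply: measurableT_comp => //.
    by apply: measurable_funD; apply: measurable_funM.
  - by move=> x; apply: integral_ge0.
rewrite fubini_tonelli//.
rewrite integral_std_normal//; last first.
  by apply: measurableT_comp.
apply: eq_integral => z _.
have E x : (G (x, z) = (f (c * z)%R * (phi z)%:E) * ((c / b) * phi (c / b * x + - (a * z / b)))%:E)%E.
  rewrite /G/= -muleA -EFinM; congr (_ * _%:E)%E.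
  rewrite !phiE.
  rewrite [RHS](_ : _ = (c / b) * normal_peak 1 * normal_peak 1 * (expR (- (z ^+ 2 / 2)) * expR (- ((c / b * x + - (a * z / b)) ^+ 2 / 2)))); last by ring.
  rewrite [LHS](_ : _ = (c / b) * normal_peak 1 * normal_peak 1 * (expR (- (x ^+ 2 / 2)) * expR (- ((c * z / b - a * x / b) ^+ 2 / 2)))); last by ring.
  rewrite -!expRD; congr (_ * expR _).
  apply/eqP; rewrite -subr_eq0; apply/eqP.
  (* The difference of the two exponents is a multiple of c^2 - (a^2 + b^2); displaying that factor
     lets [field] conclude without knowing that it vanishes. *)
  transitivity ((c ^+ 2 - (a ^+ 2 + b ^+ 2)) * (x ^+ 2 - z ^+ 2) / (2 * b ^+ 2)).
    by field; rewrite gt_eqF.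
  by rewrite c2 subrr !mul0r.
under eq_integral do rewrite E.
rewrite ge0_integralZl//; last 3 first.
- apply/measurable_EFinP; apply: measurable_funM => //.
  by apply: measurableT_comp => //; exact: mlin.
- by move=> x _; rewrite lee_fin mulr_ge0// divr_ge0// ltW.
- by rewrite mule_ge0// lee_fin.
rewrite -[RHS]mule1; congr (_ * _)%E.
have := @integral_normal_pdf R 0 1.
rewrite (@ge0_integral_affine _ (c / b) (- (a * z / b)))//; first last.
- by move=> y _; rewrite lee_fin.
- exact/measurable_EFinP.
- by rewrite divr_gt0.
rewrite preimage_setT -ge0_integralZl_EFin//; last 3 first.
- by move=> y _; rewrite lee_fin.
- by apply/measurable_EFinP; apply: measurableT_comp => //; exact: mlin.
- by rewrite divr_ge0// ltW.
Qed.

End standard_normal.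

Section centered_normal.
Context {R : realType} {d : measure_display} {Omega : measurableType d}.
Variable P : probability Omega R.
Notation N := (@normal_prob R 0 1).

(* X is distributed as s times a standard normal variable; s may be 0. *)
Definition centered_normal (X : Omega -> R) (s : R) : Prop :=
  forall A : set (measurableTypeR R), measurable A ->
    P (X @^-1` A) = N ((fun x : R => s * x) @^-1` A).

Let mscale_fun (s : R) :
  measurable_fun setT ((fun x : R => s * x) : measurableTypeR R -> measurableTypeR R).
Proof. exact: measurable_funM. Qed.

Lemma has_law_centered_normal X (v : R) : 0 <= v ->
  has_law P X (gaussian_prob 0 v) -> centered_normal X (Num.sqrt v).
Proof.
move=> v0 H A mA; rewrite H// gaussian_prob_affine//.
by congr (N _); apply/seteqP; split => x /=; rewrite addr0.
Qed.

Lemma ge0_integral_centered_normal X s (f : R -> \bar R) :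
  measurable_fun setT X -> centered_normal X s ->
  measurable_fun setT f -> (forall x, 0 <= f x)%E ->
  (\int[P]_w f (X w) = \int[N]_x f (s * x)%R)%E.
Proof.
move=> mX Xs mf f0.
have mX' : measurable_fun setT (X : Omega -> measurableTypeR R) by exact: mX.
rewrite -(@ge0_integral_pushforward _ _ _ _ _ _ mX' P setT f)//.
rewrite -[RHS](@ge0_integral_pushforward _ _ _ _ _ _ (mscale_fun s) N setT f)//.
by apply: eq_measure_integral => A mA _; exact: Xs.
Qed.

Lemma centered_normalZ X s c : centered_normal X s ->
  centered_normal (fun w => c * X w) (c * s).
Proof.
move=> Xs A mA.
have mA' : measurable ((fun x : R => c * x) @^-1` A : set (measurableTypeR R)).
  by rewrite -[X in measurable X]setTI; exact: mscale_fun.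
have := Xs _ mA'; rewrite /preimage/= => ->.
by congr (N _); apply/seteqP; split => x /=; rewrite mulrA.
Qed.

Lemma centered_normalN X s : centered_normal X s -> centered_normal X (- s).
Proof.
move=> Xs A mA; rewrite Xs//.
have mB t : measurable ((fun x : R => t * x) @^-1` A : set (measurableTypeR R)).
  by rewrite -[X in measurable X]setTI; exact: mscale_fun.
have intN (B : set (measurableTypeR R)) : measurable B ->
    (N B = \int[N]_x (\1_B x)%:E)%E.
  by move=> ?; rewrite integral_indic// setIT.
rewrite !intN// std_normal_opp//.
- apply: eq_integral => x _; rewrite !indicE; congr (nat_of_bool _)%:R%:E.
  by apply/idP/idP; rewrite !inE/= mulrN mulNr.
- by apply/measurable_EFinP; apply: measurable_indic; exact: mB.
Qed.

Lemma centered_normal_second_moment X s : measurable_fun setT X ->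
  centered_normal X s -> (\int[P]_w (X w ^+ 2)%:E = (s ^+ 2)%:E)%E.
Proof.
move=> mX Xs.
rewrite (@ge0_integral_centered_normal X s (fun x => (x ^+ 2)%:E))//; last first.
- by move=> x; rewrite lee_fin sqr_ge0.
- by apply/measurable_EFinP; exact: measurable_funX.
under eq_integral do rewrite exprMn EFinM.
rewrite ge0_integralZl_EFin ?sqr_ge0//; last 2 first.
- by move=> x _; rewrite lee_fin sqr_ge0.
- by apply/measurable_EFinP; exact: measurable_funX.
by rewrite std_normal_second_moment mule1.
Qed.

(** X and - X have the same law, so the positive and negative parts of X have the same integral,
    which is finite. *)
Lemma centered_normal_mean0 X s : P.-integrable setT (EFin \o X) ->
  centered_normal X s -> (\int[P]_w (X w)%:E = 0)%E.
Proof.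
move=> iX Xs.
have mX : measurable_fun setT X by apply/measurable_EFinP; exact: measurable_int iX.
have /integrable_pos_fin_num fp := iX.
rewrite integralE.
suff -> : (\int[P]_w (fun w => (X w)%:E)^\- w = \int[P]_w (fun w => (X w)%:E)^\+ w)%E.
  by rewrite subee//; exact: fp.
pose f (x : R) : \bar R := (Num.max x 0)%:E.
have mf : measurable_fun setT f.
  by apply/measurable_EFinP; apply: measurable_maxr.
have f0 x : (0 <= f x)%E by rewrite lee_fin le_max lexx orbT.
transitivity (\int[P]_w f (- X w)%R)%E.
  by apply: eq_integral => w _; rewrite funenegE /f EFin_max EFinN.
transitivity (\int[P]_w f (X w))%E; last first.
  by apply: eq_integral => w _; rewrite funeposE /f EFin_max.
rewrite [RHS](ge0_integral_centered_normal _ Xs)//.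
have Xs' : centered_normal (fun w => - X w) s.
  have := centered_normalN (centered_normalZ (-1) Xs).
  by rewrite mulN1r opprK; under eq_fun do rewrite mulN1r.
by rewrite (ge0_integral_centered_normal _ Xs')//; exact: measurableT_comp.
Qed.

(** Centering X at m and applying [centered_normal_mean0] identifies m as the mean. This serves
    Gaussian processes whose law is given with unspecified parameters. *)
Lemma centered_normal_of_has_law X (m v : R) : 0 <= v ->
  has_law P X (gaussian_prob m v) -> P.-integrable setT (EFin \o X) ->
  (\int[P]_w (X w)%:E = 0)%E -> centered_normal X (Num.sqrt v).
Proof.
move=> v0 H iX X0.
have Y : centered_normal (fun w => X w - m) (Num.sqrt v).
  move=> A mA.
  have mA' : measurable ((fun x : R => x - m) @^-1` A : set (measurableTypeR R)).
    rewrite -[X in measurable X]setTI.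
    have : measurable_fun setT ((fun x : R => x - m) : measurableTypeR R -> measurableTypeR R).
      exact: measurable_funB.
    exact.
  have := H _ mA'; rewrite gaussian_prob_affine// /preimage/= => ->.
  by congr (N _); apply/seteqP; split => x /=; rewrite addrK.
suff m0 : m = 0 by move: Y; rewrite m0; under eq_fun do rewrite subr0.
have im : P.-integrable setT (EFin \o cst m) by exact: finite_measure_integrable_cst.
have iY : P.-integrable setT (EFin \o (fun w => X w - m)).
  have := integrableB measurableT iX im.
  by apply: eq_integrable => // x _; rewrite /= EFinB.
have := centered_normal_mean0 iY Y.
under eq_integral do rewrite EFinB.
rewrite integralB_EFin// X0 sub0e integral_cst//= probability_setT mule1.
by move=> /eqP; rewrite -EFinN eqe oppr_eq0 => /eqP.
Qed.

(** Independence makes the joint law a product measure, determined by its values on rectangles. The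
    joint law is therefore the image of N x N under (a x, b y), and the rotation lemma gives the law
    of the sum. *)
Lemma centered_normalD X Y a b : 0 <= a -> 0 <= b ->
  measurable_fun setT X -> measurable_fun setT Y ->
  (forall A B : set (measurableTypeR R), measurable A -> measurable B ->
    P (X @^-1` A `&` Y @^-1` B) = (P (X @^-1` A) * P (Y @^-1` B))%E) ->
  centered_normal X a -> centered_normal Y b ->
  centered_normal (fun w => X w + Y w) (Num.sqrt (a ^+ 2 + b ^+ 2)).
Proof.
move=> a0 b0 mX mY indep Xa Yb A mA.
pose T := measurableTypeR R.
have mXY : measurable_fun setT ((fun w => (X w, Y w)) : Omega -> (T * T)%type).
  exact: measurable_fun_pair.
pose m : {measure set (T * T) -> \bar R} :=
  measure_function_pushforward__canonical__measure_function_Measure P mXY.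
have mS : measurable_fun setT ((fun p => (a * p.1, b * p.2)) : (T * T)%type -> (T * T)%type).
  by apply: measurable_fun_pair; apply: measurable_funM.
pose m' : {measure set (T * T) -> \bar R} :=
  measure_function_pushforward__canonical__measure_function_Measure (N \x N)%E mS.
have mX' : measurable_fun setT (X : Omega -> T) by exact: mX.
have mY' : measurable_fun setT (Y : Omega -> T) by exact: mY.
pose X' : {mfun Omega >-> T} := HB.pack_for {mfun Omega >-> T} (X : Omega -> T)
  (isMeasurableFun.Build _ _ Omega T X mX').
pose Y' : {mfun Omega >-> T} := HB.pack_for {mfun Omega >-> T} (Y : Omega -> T)
  (isMeasurableFun.Build _ _ Omega T Y mY').
pose muX : probability T R := distribution P X'.
pose muY : probability T R := distribution P Y'.
have mm' C : measurable C -> m C = m' C.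
  move=> mC; transitivity ((muX \x muY)%E C); [symmetry|].
    exact: product_measure_unique.
  apply: product_measure_unique => // E F mE mF.
  rewrite /m'/= /pushforward.
  transitivity ((N \x N)%E (((fun x : R => a * x) @^-1` E) `*` ((fun x : R => b * x) @^-1` F))).
    by congr ((N \x N)%E _).
  rewrite product_measure1E ?Xa ?Yb//.
  - by congr (_ * _)%E; [exact/esym/(Xa E mE)|exact/esym/(Yb F mF)].
  - by rewrite -[X in measurable X]setTI; exact: mscale_fun.
  - by rewrite -[X in measurable X]setTI; exact: mscale_fun.
have madd : measurable_fun setT ((fun p => p.1 + p.2) : (T * T)%type -> T).
  exact: measurable_funD.
have mC : measurable ((fun p : T * T => p.1 + p.2 : T) @^-1` A).
  by rewrite -[X in measurable X]setTI; exact: madd.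
transitivity (m ((fun p : T * T => p.1 + p.2 : T) @^-1` A)); first by [].
rewrite mm'//.
pose f (x : R) : \bar R := (\1_A x)%:E.
have mf : measurable_fun setT f by apply/measurable_EFinP; exact: measurable_indic.
have f0 x : (0 <= f x)%E by rewrite lee_fin.
transitivity (\int[N]_x \int[N]_y f (a * x + b * y)%R)%E.
  have mC' : measurable ((fun p : T * T => a * p.1 + b * p.2 : T) @^-1` A).
    rewrite -[X in measurable X]setTI.
    have mab : measurable_fun setT ((fun p => a * p.1 + b * p.2) : (T * T)%type -> T).
      by apply: measurable_funD; apply: measurable_funM.
    exact: mab.
  transitivity ((N \x N)%E ((fun p : T * T => a * p.1 + b * p.2 : T) @^-1` A)); first by [].
  rewrite -(setIT (_ @^-1` A)) -integral_indic//.
  rewrite (@fubini_tonelli1 _ _ _ _ _ N N (fun z => (\1_((fun p : T * T => a * p.1 + b * p.2 : T) @^-1` A) z)%:E))//.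
  by apply/measurable_EFinP; apply: measurable_indic.
rewrite std_normal_rotation//.
by rewrite /f integral_indic ?setIT// -[X in measurable X]setTI; exact: mscale_fun.
Qed.

(** Integrals of ramps determine the law. They converge on the side of [P] by the Lipschitz bound
    and L^2 convergence, and on the side of the normal law by dominated convergence in the scale. *)
Lemma centered_normal_L2_limit (X_ : nat -> Omega -> R) (s_ : nat -> R) (X : Omega -> R) (s : R) :
  (forall n, measurable_fun setT (X_ n)) -> measurable_fun setT X ->
  (forall n, centered_normal (X_ n) (s_ n)) -> s_ n @[n --> \oo] --> s ->
  (\int[P]_w ((X_ n w - X w) ^+ 2)%:E)%E @[n --> \oo] --> 0%E ->
  centered_normal X s.
Proof.
move=> mX_ mX Xs_ ss XX A mA.
pose T := measurableTypeR R.
have mX' : measurable_fun setT (X : Omega -> T) by exact: mX.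
pose X' : {mfun Omega >-> T} := HB.pack_for {mfun Omega >-> T} (X : Omega -> T)
  (isMeasurableFun.Build _ _ Omega T X mX').
pose S' : {mfun T >-> T} := HB.pack_for {mfun T >-> T} ((fun x : R => s * x) : T -> T)
  (isMeasurableFun.Build _ _ T T _ (mscale_fun s)).
apply: (@eq_probability_ramp R (distribution P X') (distribution N S')) => // k a.
have mramp : measurable_fun setT (EFin \o @ramp R k%:R a).
  by apply/measurable_EFinP; exact: measurable_ramp.
have ramp0 x : (0 <= (ramp k%:R a x)%:E)%E by rewrite lee_fin ramp_ge0.
rewrite ge0_integral_distribution// ge0_integral_distribution//.
have cvN : (\int[N]_x (ramp k%:R a (s_ n * x))%:E)%E @[n --> \oo] -->
    (\int[N]_x (ramp k%:R a (s * x))%:E)%E.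
  apply: (@dominated_cvg _ _ R N setT _ (fun n x => (ramp k%:R a (s_ n * x))%:E) _ (cst 1%E)) => //.
  - by move=> n; apply: (measurableT_comp mramp); exact: (mscale_fun (s_ n)).
  - move=> x _; apply: cvg_EFin; first exact: nearW.
    apply/cvgrPdist_le => e e0.
    have ssx : s_ n * x @[n --> \oo] --> s * x by apply: cvgM => //; exact: cvg_cst.
    have ek0 : 0 < e / (k%:R + 1) by rewrite divr_gt0// ltr_wpDl.
    move/cvgrPdist_le : ssx => /(_ _ ek0); apply: filterS => n H /=.
    apply: (le_trans (ramp_lipschitz _ _ _ _)) => //.
    apply: (@le_trans _ _ ((k%:R + 1) * (e / (k%:R + 1)))).
      by rewrite ler_pM// lerDl.
    by rewrite mulrC divfK// gt_eqF// ltr_wpDl.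
  - exact: finite_measure_integrable_cst.
  - by move=> n x _; rewrite /= lee_fin ger0_norm ?ramp_ge0// ramp_le1.
have cvP : (\int[P]_w (ramp k%:R a (X_ n w))%:E)%E @[n --> \oo] -->
    (\int[P]_w (ramp k%:R a (X w))%:E)%E.
  have rint Y : measurable_fun setT Y -> P.-integrable setT (fun w => (ramp k%:R a (Y w))%:E).
    move=> mY; apply: (@le_integrable _ _ _ _ _ _ _ (cst 1%E)) => //.
    + exact: measurableT_comp mramp mY.
    + by move=> w _; rewrite /= lee_fin !ger0_norm ?ramp_ge0// ramp_le1.
    + exact: finite_measure_integrable_cst.
  have mD n : measurable_fun setT (fun w => ((X_ n w - X w) ^+ 2)%:E).
    by apply/measurable_EFinP/measurable_funX; exact: measurable_funB.
  have fin0 : (\int[P]_w (ramp k%:R a (X w))%:E)%E \is a fin_num by exact: integrable_fin_num (rint _ mX).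
  rewrite -(fineK fin0); apply/fine_cvgP; split.
    by apply: nearW => n; exact: integrable_fin_num (rint _ (mX_ n)).
  apply/cvgrPdist_le => e e0.
  (* k |x| <= e / 2 + k^2 x^2 / (2 e) *)
  have C0 : 0 < (k%:R ^+ 2 + 1) / (2 * e) by rewrite divr_gt0 ?mulr_gt0// ltr_wpDl// sqr_ge0.
  have e20 : 0 < e / 2 / ((k%:R ^+ 2 + 1) / (2 * e)) by rewrite divr_gt0// divr_gt0.
  move/fine_cvgP : XX => [Xfin /cvgrPdist_le/(_ _ e20)].
  move: Xfin; apply: filterS2 => n /= Xfin.
  rewrite sub0r normrN ger0_norm; last by rewrite fine_ge0// integral_ge0// => w _; rewrite lee_fin sqr_ge0.
  rewrite ler_pdivlMr// => Hn.
  rewrite -fineB//; last exact: integrable_fin_num (rint _ (mX_ n)).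
  rewrite -integralB_EFin; [|exact: measurableT|exact: rint|exact: rint].
  have iB : P.-integrable setT (EFin \o (fun w => ramp k%:R a (X w) - ramp k%:R a (X_ n w))).
    have := integrableB measurableT (rint _ mX) (rint _ (mX_ n)).
    by apply: eq_integrable => // x _; rewrite /= EFinB.
  have -> : fine (\int[P]_x ((ramp k%:R a (X x))%:E - (ramp k%:R a (X_ n x))%:E)) =
      \int[P]_x (ramp k%:R a (X x) - ramp k%:R a (X_ n x)) by [].
  apply: (le_trans (le_normr_Rintegral measurableT iB)).
  rewrite -lee_fin /Rintegral fineK; last first.
    by apply: integrable_fin_num => //; have := integrable_norm iB.
  apply: (@le_trans _ _ (\int[P]_w ((cst (e / 2)%:E) w + ((k%:R ^+ 2 + 1) / (2 * e))%:E * ((X_ n w - X w) ^+ 2)%:E))%E).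
    apply: ge0_le_integral => //.
    + apply/measurable_EFinP; apply: measurableT_comp => //.
      by apply/measurable_EFinP; exact: measurable_int iB.
    + by apply: emeasurable_funD => //; exact: measurable_funeM.
    move=> w _; rewrite -EFinM -EFinD lee_fin.
    apply: (le_trans (ramp_lipschitz _ _ _ _)) => //.
    rewrite distrC -[(X_ n w - X w) ^+ 2]real_normK ?num_real//.
    have : 0 <= `|X_ n w - X w| by [].
    move: (`|X_ n w - X w|) => z z0.
    have k0 : 0 <= k%:R :> R by [].
    rewrite -subr_ge0 (_ : _ - _ = ((e - k%:R * z) ^+ 2 + z ^+ 2) / (2 * e)); last first.
      by field; rewrite gt_eqF.
    by rewrite divr_ge0 ?addr_ge0 ?sqr_ge0// mulr_ge0// ltW.
  rewrite ge0_integralD//; last 3 first.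
  + by move=> w _; rewrite lee_fin divr_ge0// ltW.
  + by move=> w _; rewrite mule_ge0// lee_fin ?sqr_ge0// ltW.
  + exact: measurable_funeM.
  rewrite integral_cst//= probability_setT mule1 ge0_integralZl_EFin//; last 2 first.
  + by move=> w _; rewrite lee_fin sqr_ge0.
  + exact: ltW.
  rewrite -(fineK Xfin) -EFinM -EFinD lee_fin.
  by rewrite mulrC in Hn; rewrite [leRHS]splitr lerD2l.
apply: (cvg_unique (@ereal_hausdorff R) cvP).
apply: cvg_trans cvN; apply: near_eq_cvg; apply: nearW => n.
by rewrite -(ge0_integral_centered_normal _ (Xs_ n) mramp).
Qed.

Lemma integral_centered_normal (X : Omega -> R) s (f : R -> \bar R) :
  measurable_fun setT X -> centered_normal X s -> measurable_fun setT f ->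
  (\int[P]_w f (X w) = \int[N]_x f (s * x)%R)%E.
Proof.
move=> mX Xs mf; rewrite integralE [RHS]integralE.
have -> : (fun w => f (X w))^\+%E = (fun w => f^\+%E (X w)) by exact: funepos_comp.
have -> : (fun w => f (X w))^\-%E = (fun w => f^\-%E (X w)) by exact: funeneg_comp.
have -> : (fun x => f (s * x)%R)^\+%E = (fun x => f^\+%E (s * x)) by exact: (funepos_comp f ( *%R s)).
have -> : (fun x => f (s * x)%R)^\-%E = (fun x => f^\-%E (s * x)) by exact: (funeneg_comp f ( *%R s)).
rewrite (ge0_integral_centered_normal mX Xs (measurable_funepos mf))//.
rewrite (ge0_integral_centered_normal mX Xs (measurable_funeneg mf))//.
Qed.

End centered_normal.

(** * Square integrable random variables *)

Section square_integrable.
Context {R : realType} {d : measure_display} {Omega : measurableType d}.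
Variable P : probability Omega R.
Implicit Types X Y Z : Omega -> R.

Definition sqint X : Prop :=
  measurable_fun setT X /\ P.-integrable setT (fun w => (X w ^+ 2)%:E).

Lemma sqintP X : measurable_fun setT X ->
  (\int[P]_w (X w ^+ 2)%:E < +oo)%E -> sqint X.
Proof.
move=> mX foo; split => //; apply/integrableP; split.
  by apply/measurable_EFinP; exact: measurable_funX.
under eq_integral do rewrite /= ger0_norm ?sqr_ge0//.
exact: foo.
Qed.

Lemma sqint_cst (c : R) : sqint (fun=> c).
Proof.
split; first exact: measurable_cst.
exact: (@finite_measure_integrable_cst _ _ _ P setT (c ^+ 2)).
Qed.

Lemma sqint_integrableM X Y : sqint X -> sqint Y ->
  P.-integrable setT (EFin \o (fun w => X w * Y w)).
Proof.
move=> [mX iX] [mY iY].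
apply: (le_integrable _ _ _ (integrableD measurableT iX iY)) => //.
  by apply/measurable_EFinP; exact: measurable_funM.
move=> w _; rewrite /= lee_fin [leRHS]ger0_norm ?addr_ge0 ?sqr_ge0//.
rewrite normrM -(real_normK (num_real (X w))) -(real_normK (num_real (Y w))).
move: `|X w| `|Y w| (normr_ge0 (X w)) (normr_ge0 (Y w)) => x y x0 y0.
have := sqr_ge0 (x - y); rewrite sqrrB mulr2n => h.
by have := mulr_ge0 x0 y0; lra.
Qed.

Lemma sqint_integrable X : sqint X -> P.-integrable setT (EFin \o X).
Proof.
move=> /sqint_integrableM /(_ (sqint_cst 1)).
by apply: eq_integrable => // w _; rewrite /= mulr1.
Qed.

Lemma sqintD X Y : sqint X -> sqint Y -> sqint (fun w => X w + Y w).
Proof.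
move=> sX sY; have iXY := sqint_integrableM sX sY.
have [mX iX] := sX; have [mY iY] := sY; split; first exact: measurable_funD.
have i1 := integrableD measurableT (integrableD measurableT iX iY)
  (integrableD measurableT iXY iXY).
by apply: eq_integrable i1 => // w _; rewrite /= -!EFinD; congr (_%:E); ring.
Qed.

Lemma sqintZ (c : R) X : sqint X -> sqint (fun w => c * X w).
Proof.
move=> [mX iX]; split; first exact: measurable_funM.
have := integrableZl measurableT (c ^+ 2) iX.
by apply: eq_integrable => // w _; rewrite /= -EFinM exprMn.
Qed.

Lemma sqintN X : sqint X -> sqint (fun w => - X w).
Proof. by move=> /(sqintZ (-1)); under eq_fun do rewrite mulN1r. Qed.

Lemma sqintB X Y : sqint X -> sqint Y -> sqint (fun w => X w - Y w).
Proof. by move=> sX /sqintN; exact: sqintD. Qed.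

Definition ip X Y : R := \int[P]_w (X w * Y w).

Lemma ipC X Y : ip X Y = ip Y X.
Proof. by rewrite /ip; apply: eq_Rintegral => w _; rewrite mulrC. Qed.

Lemma ipDl X Y Z : sqint X -> sqint Y -> sqint Z ->
  ip (fun w => X w + Y w) Z = ip X Z + ip Y Z.
Proof.
move=> sX sY sZ; rewrite /ip -RintegralD//; try exact: sqint_integrableM.
by apply: eq_Rintegral => w _; rewrite mulrDl.
Qed.

Lemma ipZl (c : R) X Y : sqint X -> sqint Y ->
  ip (fun w => c * X w) Y = c * ip X Y.
Proof.
move=> sX sY; rewrite /ip -RintegralZl//; try exact: sqint_integrableM.
by apply: eq_Rintegral => w _; rewrite mulrA.
Qed.

Lemma ipDr X Y Z : sqint X -> sqint Y -> sqint Z ->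
  ip Z (fun w => X w + Y w) = ip Z X + ip Z Y.
Proof. by move=> sX sY sZ; rewrite ipC ipDl// ![ip _ Z]ipC. Qed.

Lemma ipZr (c : R) X Y : sqint X -> sqint Y ->
  ip Y (fun w => c * X w) = c * ip Y X.
Proof. by move=> sX sY; rewrite ipC ipZl// ipC. Qed.

Lemma ipNl X Y : sqint X -> sqint Y -> ip (fun w => - X w) Y = - ip X Y.
Proof.
by move=> sX sY; under eq_fun do rewrite -mulN1r; rewrite ipZl// mulN1r.
Qed.

Lemma ipNr X Y : sqint X -> sqint Y -> ip Y (fun w => - X w) = - ip Y X.
Proof. by move=> sX sY; rewrite ipC ipNl// ipC. Qed.

Lemma ipBl X Y Z : sqint X -> sqint Y -> sqint Z ->
  ip (fun w => X w - Y w) Z = ip X Z - ip Y Z.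
Proof. by move=> sX sY sZ; rewrite ipDl ?ipNl//; exact: sqintN. Qed.

Lemma ipBr X Y Z : sqint X -> sqint Y -> sqint Z ->
  ip Z (fun w => X w - Y w) = ip Z X - ip Z Y.
Proof. by move=> sX sY sZ; rewrite ipC ipBl// ![ip _ Z]ipC. Qed.

Lemma ip_ge0 X : 0 <= ip X X.
Proof. by apply: Rintegral_ge0 => w _; rewrite -expr2 sqr_ge0. Qed.

Lemma ip_sqrE X : sqint X -> (\int[P]_w (X w ^+ 2)%:E)%E = (ip X X)%:E.
Proof.
move=> sX; rewrite /ip /Rintegral fineK.
  by apply: eq_integral => w _; rewrite expr2.
exact: integrable_fin_num (sqint_integrableM sX sX).
Qed.

Lemma ip_cauchy_schwarz X Y : sqint X -> sqint Y ->
  ip X Y ^+ 2 <= ip X X * ip Y Y.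
Proof.
move=> sX sY.
have H (t : R) : 0 <= ip X X - 2 * t * ip X Y + t ^+ 2 * ip Y Y.
  have sZ : sqint (fun w => t * Y w) by exact: sqintZ.
  have := ip_ge0 (fun w => X w - t * Y w).
  have sB := sqintB sX sZ.
  rewrite ipBl// !ipBr// !ipZl// !ipZr// ![ip Y X]ipC.
  by move/le_trans; apply; rewrite le_eqVlt; apply/orP; left; apply/eqP; ring.
have [Y0|Y0] := eqVneq (ip Y Y) 0.
  have [->|XY0] := eqVneq (ip X Y) 0; first by rewrite Y0 mulr0 expr0n.
  (* When Y has norm 0 the quadratic in t is affine, and this t would give it the value -1. *)
  have := H ((ip X X + 1) / (2 * ip X Y)).
  rewrite Y0 mulr0 addr0 (_ : 2 * _ * _ = ip X X + 1); first by lra.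
  by field; rewrite XY0.
have Yp : 0 < ip Y Y by rewrite lt_neqAle eq_sym Y0 ip_ge0.
have := H (ip X Y / ip Y Y).
rewrite (_ : _ + _ = ip X X - ip X Y ^+ 2 / ip Y Y); last by field; rewrite Y0.
by rewrite subr_ge0 ler_pdivrMr.
Qed.

Lemma ip_cauchy_schwarz_norm X Y : sqint X -> sqint Y ->
  `|ip X Y| <= Num.sqrt (ip X X) * Num.sqrt (ip Y Y).
Proof.
move=> sX sY; rewrite -sqrtrM ?ip_ge0// -sqrtr_sqr ler_sqrt ?mulr_ge0 ?ip_ge0//.
exact: ip_cauchy_schwarz.
Qed.

Lemma ip_cvgr (X_ : nat -> Omega -> R) X Y :
  (forall n, sqint (X_ n)) -> sqint X -> sqint Y ->
  (\int[P]_w ((X_ n w - X w) ^+ 2)%:E)%E @[n --> \oo] --> 0%E ->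
  ip Y (X_ n) @[n --> \oo] --> ip Y X.
Proof.
move=> sX_ sX sY XX.
have sD n := sqintB (sX_ n) sX.
have dd : ip (fun w => X_ n w - X w) (fun w => X_ n w - X w) @[n --> \oo] --> 0.
  apply/fine_cvg; move: XX; apply: cvg_trans; apply: near_eq_cvg; apply: nearW => n.
  by apply: eq_integral => w _; rewrite expr2.
apply/cvgrPdist_le => e e0.
have Y1 : 0 < ip Y Y + 1 by rewrite ltr_wpDl// ip_ge0.
have c0 : 0 < e ^+ 2 / (ip Y Y + 1) by rewrite divr_gt0// exprn_gt0.
move/cvgrPdist_le : dd => /(_ _ c0); apply: filterS => n.
rewrite sub0r normrN ger0_norm ?ip_ge0// => Hn.
suff : ip Y (fun w => X_ n w - X w) ^+ 2 <= e ^+ 2.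
  by rewrite -real_normK ?num_real// ler_sqr ?nnegrE ?(ltW e0)// ipBr// distrC.
apply: (le_trans (ip_cauchy_schwarz sY (sD n))).
apply: (le_trans (ler_wpM2l (ip_ge0 Y) Hn)).
rewrite mulrCA ler_piMr ?sqr_ge0// ler_pdivrMr// mul1r.
by rewrite lerDl.
Qed.

Lemma ip_cvg (X_ : nat -> Omega -> R) X :
  (forall n, sqint (X_ n)) -> sqint X ->
  (\int[P]_w ((X_ n w - X w) ^+ 2)%:E)%E @[n --> \oo] --> 0%E ->
  ip (X_ n) (X_ n) @[n --> \oo] --> ip X X.
Proof.
move=> sX_ sX XX.
have sD n := sqintB (sX_ n) sX.
have dd : ip (fun w => X_ n w - X w) (fun w => X_ n w - X w) @[n --> \oo] --> 0.
  apply/fine_cvg; move: XX; apply: cvg_trans; apply: near_eq_cvg; apply: nearW => n.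
  by apply: eq_integral => w _; rewrite expr2.
have xd := ip_cvgr sX_ sX sX XX.
have E n : ip (X_ n) (X_ n) = ip (fun w => X_ n w - X w) (fun w => X_ n w - X w)
    + 2 * ip X (X_ n) - ip X X.
  by rewrite !ipBl// !ipBr// [ip (X_ n) X]ipC; ring.
rewrite (eq_cvg _ _ E).
suff L : ip (fun w => X_ n w - X w) (fun w => X_ n w - X w) + 2 * ip X (X_ n) - ip X X
    @[n --> \oo] --> 0 + 2 * ip X X - ip X X.
  by move: L; have -> : 0 + 2 * ip X X - ip X X = ip X X by ring.
by apply: cvgB; [apply: cvgD => //; apply: cvgM => //; exact: cvg_cst|exact: cvg_cst].
Qed.

End square_integrable.

(** * Calculus of powers of the absolute value *)

Section right_slopes.
Context {R : realType}.
Notation mu := (@lebesgue_measure R).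

Lemma is_derive_right_slope (F : R -> R) (x l : R) : is_derive x 1 F l ->
  (F y - F x) / (y - x) @[y --> x^'+] --> l.
Proof.
move=> [df <-]; apply/cvgrPdist_le => e e0.
move/cvgrPdist_le : df => /(_ _ e0)[d /= d0 H].
exists d => //= y /= xyd xy.
have yx0 : 0 < y - x by rewrite subr_gt0.
have := H (y - x); rewrite /= sub0r normrN distrC => /(_ xyd).
rewrite gt_eqF// => /(_ isT).
rewrite /GRing.scale/= mulr1 subrK mulrC; exact.
Qed.

(** The slope condition at the left endpoint is dropped by letting x decrease to a: F is continuous
    there and the integral over [a, x] tends to 0. Powers of |x| with small exponent have no finite
    slope at 0. *)
Lemma FTC_right (f F : R -> R) (a b : R) : a < b ->
  mu.-integrable `[a, b] (EFin \o f) -> {within `[a, b], continuous F} ->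
  (forall x, a < x < b -> (F y - F x) / (y - x) @[y --> x^'+] --> f x) ->
  \int[mu]_(x in `[a, b]) f x = F b - F a.
Proof.
move=> ab intf cF dF.
have E x : a < x < b -> \int[mu]_(t in `[a, b]) f t =
    F b - F x + \int[mu]_(t in `[a, x]) f t.
  move=> /andP[ax xb].
  have sub : `[x, b]%classic `<=` `[a, b]%classic by apply: subset_itvr; rewrite bnd_simp ltW.
  have int1 : mu.-integrable `[x, b] (EFin \o f) by exact: integrableS intf.
  rewrite -(@FTC_everywhere_right_derivative _ f F x b)//.
  - rewrite -(@Rintegral_itv_obnd_cbnd _ x); last first.
      by apply: integrableS int1 => //; apply: subset_itv; rewrite bnd_simp.
    by rewrite -(Rintegral_itvB intf) ?bnd_simp ?ltW// subrK.
  - exact: continuous_subspaceW cF.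
  - by move=> y /andP[xy yb]; apply: dF; rewrite yb (lt_le_trans ax).
have c1 : F x @[x --> a^'+] --> F a by move: cF => /(continuous_within_itvP _ ab)[].
have c2 : (\int[mu]_(t in `[a, x]) f t) @[x --> a^'+] --> 0.
  apply: cvg_at_right_filter.
  exact: (parameterized_integral_cvg_left ab intf).
have : F b - F x + \int[mu]_(t in `[a, x]) f t @[x --> a^'+] --> F b - F a + 0.
  by apply: cvgD => //; apply: cvgB => //; exact: cvg_cst.
rewrite addr0 => h; apply/esym/(cvg_unique _ h) => //.
apply: cvg_near_cst; near=> x; apply/esym/E/andP; split.
  by near: x; exact: nbhs_right_gt.
by near: x; exact: nbhs_right_lt.
Unshelve. all: by end_near. Qed.

(** Cutting the interval at c turns the exceptional point into an endpoint. Here c is the point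
    where the argument of a power vanishes. *)
Lemma FTC_right_except (f F : R -> R) (a b c : R) : a <= b ->
  mu.-integrable `[a, b] (EFin \o f) -> {within `[a, b], continuous F} ->
  (forall x, a < x < b -> x != c -> (F y - F x) / (y - x) @[y --> x^'+] --> f x) ->
  \int[mu]_(x in `[a, b]) f x = F b - F a.
Proof.
rewrite le_eqVlt => /predU1P[<- _ _ _|ab intf cF dF].
  by rewrite set_itv1 Rintegral_set1 subrr.
have [/andP[ac cb]|acb] := boolP (a < c < b); last first.
  apply: FTC_right => // x axb; apply: dF => //.
  by apply: contra acb => /eqP <-.
have sub1 : `[a, c]%classic `<=` `[a, b]%classic by apply: subset_itvl; rewrite bnd_simp ltW.
have sub2 : `[c, b]%classic `<=` `[a, b]%classic by apply: subset_itvr; rewrite bnd_simp ltW.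
have i1 : mu.-integrable `[a, c] (EFin \o f) by exact: integrableS intf.
have i2 : mu.-integrable `[c, b] (EFin \o f) by exact: integrableS intf.
have := @Rintegral_itvB _ f (BLeft a) (BRight b) c intf.
rewrite !bnd_simp !ltW// => /(_ isT isT).
rewrite Rintegral_itv_obnd_cbnd; last first.
  by apply: integrableS i2 => //; apply: subset_itv; rewrite bnd_simp.
move/eqP; rewrite subr_eq => /eqP ->.
rewrite (@FTC_right f F a c)//; last 2 first.
- exact: continuous_subspaceW cF.
- move=> x /andP[ax xc]; apply: dF; last by rewrite lt_eqF.
  by rewrite ax (lt_trans xc).
rewrite (@FTC_right f F c b)//; first by ring.
- exact: continuous_subspaceW cF.
- move=> x /andP[cx xb]; apply: dF; last by rewrite gt_eqF.
  by rewrite xb (lt_trans ac).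
Qed.

End right_slopes.

Section powers.
Context {R : realType}.
Notation mu := (@lebesgue_measure R).
Implicit Types p x u v : R.

Lemma is_derive_norm_powR p x : x != 0 ->
  is_derive x 1 (fun y : R => `|y| `^ p) (p * Num.sg x * `|x| `^ (p - 1)).
Proof.
move=> x0; have [xp|xn|xe] := ltgtP 0 x; last by rewrite -xe eqxx in x0.
  rewrite gtr0_sg// mulr1 gtr0_norm//.
  apply: (@near_eq_is_derive _ _ _ (fun y => y `^ p)); last exact: is_derive1_powR.
  near=> y; rewrite gtr0_norm//; near: y; exact: lt_nbhsr.
rewrite ltr0_sg// mulrN1 mulNr ltr0_norm//.
apply: (@near_eq_is_derive _ _ _ (fun y => (- y) `^ p)).
  near=> y; rewrite ltr0_norm//; near: y; exact: lt_nbhsl.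
rewrite -mulrN1.
apply: (@is_derive1_comp _ (fun y => y `^ p) -%R).
by apply: is_derive1_powR; rewrite oppr_gt0.
Unshelve. all: by end_near. Qed.

Lemma is_derive_sg_norm_powR p x : x != 0 ->
  is_derive x 1 (fun y : R => Num.sg y * `|y| `^ p) (p * `|x| `^ (p - 1)).
Proof.
move=> x0; have := is_derive_norm_powR p x0.
have [xp|xn|xe] := ltgtP 0 x; last by rewrite -xe eqxx in x0.
  rewrite gtr0_sg// mulr1; apply: near_eq_is_derive.
  near=> y; rewrite gtr0_sg ?mul1r//; near: y; exact: lt_nbhsr.
rewrite ltr0_sg// mulrN1 mulNr => H.
apply: (@near_eq_is_derive _ _ _ (fun y => - (`|y| `^ p))).
  near=> y; rewrite ltr0_sg ?mulN1r//; near: y; exact: lt_nbhsl.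
have := is_deriveN H; rewrite opprK; exact.
Unshelve. all: by end_near. Qed.

Lemma continuous_norm_powR p : 0 < p -> continuous (fun y : R => `|y| `^ p).
Proof.
move=> p0 x; have [->|x0] := eqVneq x 0; last first.
  apply: differentiable_continuous; apply/derivable1_diffP.
  by have [] := is_derive_norm_powR p x0.
rewrite /continuous_at normr0 powR0 ?gt_eqF//.
apply/cvgrPdist_le => e e0; exists (e `^ p^-1); first exact: powR_gt0.
move=> y /=; rewrite !sub0r !normrN (ger0_norm (powR_ge0 _ _)) => ye.
have -> : e = (e `^ p^-1) `^ p by rewrite -powRrM mulVf ?gt_eqF// powRr1// ltW.
by rewrite ge0_ler_powR ?nnegrE ?powR_ge0 ?(ltW p0) ?(ltW ye).
Qed.

Lemma continuous_sg_norm_powR p : 0 < p -> continuous (fun y : R => Num.sg y * `|y| `^ p).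
Proof.
move=> p0 x; have [->|x0] := eqVneq x 0; last first.
  apply: differentiable_continuous; apply/derivable1_diffP.
  by have [] := is_derive_sg_norm_powR p x0.
have := @continuous_norm_powR p p0 0.
rewrite /continuous_at normr0 powR0 ?gt_eqF// mulr0 => /cvgrPdist_le H.
apply/cvgrPdist_le => e e0; have := H e e0; apply: filterS => y.
rewrite !sub0r !normrN normrM => h; apply: le_trans h.
by rewrite ler_piMl// normr_sg; case: (y != 0).
Qed.

Lemma measurable_norm_powR p : measurable_fun setT (fun x : R => `|x| `^ p).
Proof. by apply: (measurableT_comp (measurable_powR p)); exact: normr_measurable. Qed.

(** For p < 1 the singularity at 0 is approached by the intervals [M / (n + 2), M]. On each the
    integral is at most M^p / p by the explicit primitive, and monotone convergence concludes.
    Reflection handles the negative side. *)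
Lemma integrable_norm_powR p u v : 0 < p ->
  mu.-integrable `[u, v] (EFin \o (fun x : R => `|x| `^ (p - 1))).
Proof.
move=> p0.
pose f (x : R) := `|x| `^ (p - 1).
have f0 x : 0 <= f x by exact: powR_ge0.
have mf : measurable_fun setT (fun x => (f x)%:E).
  by apply/measurable_EFinP; exact: measurable_norm_powR.
have pos M : 0 < M -> (\int[mu]_(x in `[0%R, M]) (f x)%:E <= (M `^ p / p)%:E)%E.
  move=> M0.
  rewrite -integral_itv_obnd_cbnd; last exact: measurable_funTS.
  pose F (n : nat) : set R := `[M / n.+2%:R, M]%classic.
  have UF : `]0, M]%classic = \bigcup_n F n.
    apply/seteqP; split => x/=.
      rewrite in_itv/= => /andP[x0 xM].
      exists (Num.truncn (M / x)) => //; rewrite /F/= in_itv/= xM andbT.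
      rewrite ler_pdivrMr// mulrC -ler_pdivrMr//.
      by rewrite (le_trans (ltW (truncnS_gt _)))// ler_nat.
    move=> [n _]; rewrite /F/= !in_itv/= => /andP[+ ->]; rewrite andbT.
    by apply: lt_le_trans; rewrite divr_gt0.
  rewrite UF.
  have ndF : nondecreasing_seq F.
    move=> m n mn; rewrite /F subsetEset; apply: subset_itvr; rewrite bnd_simp.
    by rewrite ler_pM2l// lef_pV2 ?posrE// ler_nat ltnS.
  have cv : (\int[mu]_(x in F i) (f x)%:E)%E @[i --> \oo] -->
      (\int[mu]_(x in \bigcup_i F i) (f x)%:E)%E.
    apply: ge0_nondecreasing_set_cvg_integral => //.
    - by move=> i; exact: measurable_itv.
    - by move=> i; exact: measurable_funTS.
    - by move=> i x _; rewrite lee_fin.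
  rewrite -(cvg_lim _ cv)//; apply: lime_le; first by apply/cvg_ex; exists (\int[mu]_(x in \bigcup_i F i) (f x)%:E)%E.
  apply: nearW => n; rewrite /F.
  have n0 : 0 < M / n.+2%:R by rewrite divr_gt0.
  have nM : M / n.+2%:R <= M by rewrite ler_pdivrMr// ler_pMr// ler1n.
  have fE x : 0 < x -> is_derive x 1 f ((p - 1) * Num.sg x * `|x| `^ (p - 1 - 1)).
    by move=> x0; apply: is_derive_norm_powR; rewrite gt_eqF.
  have cf : {within `[M / n.+2%:R, M], continuous f}.
    apply: continuous_in_subspaceT => x; rewrite inE/= in_itv/= => /andP[x0 _].
    apply: differentiable_continuous; apply/derivable1_diffP.
    by have [] := fE x (lt_le_trans n0 x0).
  have int1 : mu.-integrable `[M / n.+2%:R, M] (EFin \o f).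
    by apply: continuous_compact_integrable => //; exact: segment_compact.
  rewrite -(fineK (integrable_fin_num _ int1))// lee_fin -/(Rintegral _ _ _).
  rewrite (@FTC_right_except _ f (fun x => p^-1 * (Num.sg x * `|x| `^ p)) _ _ 0)//.
  - rewrite !gtr0_sg// !gtr0_norm// !mul1r mulrC lerBlDr lerDl.
    by rewrite mulr_ge0 ?powR_ge0// invr_ge0 ltW.
  - apply: continuous_subspaceT => x; apply: cvgM; first exact: cvg_cst.
    exact: continuous_sg_norm_powR.
  - move=> x _ x0; apply: is_derive_right_slope.
    have := is_deriveZ p^-1 (is_derive_sg_norm_powR p x0).
    by rewrite /GRing.scale/= mulrA mulVf ?mul1r// gt_eqF.
have pos' M : 0 < M -> mu.-integrable `[0, M] (EFin \o f).
  move=> M0; apply/integrableP; split; first exact: measurable_funTS.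
  under eq_integral do rewrite /= ger0_norm//.
  by apply: le_lt_trans (pos M M0) _; exact: ltry.
have neg' M : 0 < M -> mu.-integrable `[- M, 0] (EFin \o f).
  move=> M0; apply/integrableP; split; first exact: measurable_funTS.
  under eq_integral do rewrite /= ger0_norm//.
  rewrite ge0_integral_opp//; last 2 first.
  - exact: measurable_funTS.
  - by move=> x _; rewrite lee_fin.
  have -> : -%R @^-1` `[- M, 0]%classic = `[0, M]%classic.
    by apply/seteqP; split => x /=; rewrite !in_itv/= lerN2 oppr_le0 andbC.
  rewrite (_ : (\int[mu]_(x in `[0%R, M]) (f (- x))%:E)%E = (\int[mu]_(x in `[0%R, M]) (f x)%:E)%E); last first.
    by apply: eq_integral => x _; rewrite /f normrN.
  by apply: le_lt_trans (pos M M0) _; exact: ltry.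
pose M : R := `|u| + `|v| + 1.
have M0 : 0 < M by rewrite /M ltr_wpDl// addr_ge0.
have sub : `[u, v]%classic `<=` `[- M, 0]%classic `|` `[0, M]%classic.
  move=> x /=; rewrite !in_itv/= => /andP[ux xv].
  have [x0|x0] := leP x 0; [left|right]; apply/andP; split => //.
  - apply: le_trans ux; rewrite lerNl (le_trans (ler_norm _))// normrN /M.
    by rewrite -addrA lerDl addr_ge0.
  - exact: ltW.
  - by rewrite (le_trans xv)// (le_trans (ler_norm _))// /M addrAC lerDr addr_ge0.
apply/integrableP; split; first exact: measurable_funTS.
under eq_integral do rewrite /= ger0_norm//.
have mU : measurable (`[- M, 0]%classic `|` `[0, M]%classic : set R) by exact: measurableU.
apply: (@le_lt_trans _ _ (\int[mu]_(x in (`[- M, 0]%classic `|` `[0, M]%classic)%R) (f x)%:E)%E).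
  by apply: ge0_subset_integral => //; exact: measurable_funTS.
rewrite (_ : _ `|` _ = `[- M, 0]%classic `|` `]0, M]%classic); last first.
  apply/seteqP; split => x /=; rewrite !in_itv/= => -[xM|/andP[x0 xM]]; [by left| |by left|right].
  - have [xl|xl] := leP x 0; [left|right] => //.
    by rewrite andbT (le_trans _ x0)// oppr_le0 ltW.
  - by rewrite (ltW x0).
rewrite ge0_integral_setU//; last 3 first.
- exact: measurable_funTS.
- by move=> x _; rewrite lee_fin.
- by apply: lt_disjoint => y z; rewrite !in_itv/= => /andP[_ y0] /andP[z0 _]; exact: le_lt_trans z0.
have fN : (\int[mu]_(x in `[(- M)%R, 0%R]) (f x)%:E < +oo)%E.
  have /integrableP[_] := neg' M M0.
  by under eq_integral do rewrite /= ger0_norm//.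
have fP : (\int[mu]_(x in `[0%R, M]) (f x)%:E < +oo)%E.
  by apply: le_lt_trans (pos M M0) _; exact: ltry.
rewrite integral_itv_obnd_cbnd; last exact: measurable_funTS.
exact: lte_add_pinfty.
Qed.

Lemma integral_norm_powR p u v : 0 < p -> u <= v ->
  \int[mu]_(x in `[u, v]) (`|x| `^ (p - 1)) =
  p^-1 * (Num.sg v * `|v| `^ p) - p^-1 * (Num.sg u * `|u| `^ p).
Proof.
move=> p0 uv.
rewrite (@FTC_right_except _ _ (fun x => p^-1 * (Num.sg x * `|x| `^ p)) _ _ 0)//.
- exact: integrable_norm_powR.
- apply: continuous_subspaceT => x; apply: cvgM; first exact: cvg_cst.
  exact: continuous_sg_norm_powR.
- move=> x _ x0; apply: is_derive_right_slope.
  have := is_deriveZ p^-1 (is_derive_sg_norm_powR p x0).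
  by rewrite /GRing.scale/= mulrA mulVf ?mul1r// gt_eqF.
Qed.

Lemma integrable_sg_norm_powR p u v : 0 < p ->
  mu.-integrable `[u, v] (EFin \o (fun x : R => Num.sg x * `|x| `^ (p - 1))).
Proof.
move=> p0; apply: le_integrable (integrable_norm_powR u v p0) => //.
  apply/measurable_EFinP/measurable_funTS; apply: measurable_funM; last exact: measurable_norm_powR.
  apply: nondecreasing_measurable => // x y xy.
  by have [x0|x0|x0] := sgrP x; have [y0|y0|y0] := sgrP y; lra.
move=> x _; rewrite /= lee_fin normrM ler_piMl//.
by rewrite normr_sg; case: (x != 0).
Qed.

End powers.

(** * The kernel equation *)

Section weak_convergence.
Context {R : realType} {d : measure_display} {T : measurableType d}.
Variable mu : {measure set T -> \bar R}.

Lemma L2_cvg_L1_cvg (D : set T) (f_ : nat -> T -> R) (f : T -> R) :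
  measurable D -> (mu D < +oo)%E ->
  (forall n, measurable_fun D (f_ n)) -> measurable_fun D f ->
  (\int[mu]_(x in D) ((f_ n x - f x) ^+ 2)%:E)%E @[n --> \oo] --> 0%E ->
  (\int[mu]_(x in D) (`|f_ n x - f x|)%:E)%E @[n --> \oo] --> 0%E.
Proof.
move=> mD Doo mf_ mf ff.
have mD1 n : measurable_fun D (fun w => `|f_ n w - f w|).
  by apply: measurableT_comp; [exact: normr_measurable|exact: measurable_funB].
have mD2 n : measurable_fun D (fun w => ((f_ n w - f w) ^+ 2)%:E).
  by apply/measurable_EFinP/measurable_funX; exact: measurable_funB.
pose M := fine (mu D).
have ME : mu D = M%:E by rewrite fineK// ge0_fin_numE.
have M0 : 0 <= M by rewrite fine_ge0.
suff H e : 0 < e -> \forall n \near \oo,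
    (\int[mu]_(x in D) (`|f_ n x - f x|)%:E <= e%:E)%E.
  apply/fine_cvgP; split.
    have := H 1 ltr01; apply: filterS => n Hn.
    rewrite ge0_fin_numE; last by apply: integral_ge0 => x _; rewrite lee_fin.
    by apply: le_lt_trans Hn _; exact: ltry.
  apply/cvgrPdist_le => e e0; have := H e e0; apply: filterS => n Hn.
  have I0 : (0 <= \int[mu]_(x in D) (`|f_ n x - f x|)%:E)%E.
    by apply: integral_ge0 => x _; rewrite lee_fin.
  rewrite sub0r normrN ger0_norm ?fine_ge0//= -lee_fin fineK//.
  by rewrite ge0_fin_numE// (le_lt_trans Hn)// ltry.
move=> e0.
(* |y| <= e / (2 (M + 1)) + y^2 (M + 1) / (2 e) *)
pose c := e / (M + 1).
have M1 : 0 < M + 1 by rewrite ltr_wpDl.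
have c0 : 0 < c by rewrite divr_gt0.
have ce0 : 0 < e * c by rewrite mulr_gt0.
move/fine_cvgP : ff => [ffin /cvgrPdist_le/(_ _ ce0)].
move: ffin; apply: filterS2 => n /= ffin.
rewrite sub0r normrN ger0_norm; last by rewrite fine_ge0// integral_ge0// => w _; rewrite lee_fin sqr_ge0.
move=> Hn.
apply: (@le_trans _ _ (\int[mu]_(w in D) ((cst (c / 2)%:E) w + (2 * c)^-1%:E * ((f_ n w - f w) ^+ 2)%:E))%E).
  apply: ge0_le_integral => //.
  - exact/measurable_EFinP.
  - by apply: emeasurable_funD => //; exact: measurable_funeM.
  move=> w _; rewrite -EFinM -EFinD lee_fin.
  rewrite -[(f_ n w - f w) ^+ 2]real_normK ?num_real//.
  move: (`|f_ n w - f w|) => z.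
  rewrite -subr_ge0 (_ : _ - _ = (c - z) ^+ 2 / (2 * c)); last first.
    by field; rewrite gt_eqF.
  by rewrite divr_ge0 ?sqr_ge0// mulr_ge0// ltW.
rewrite ge0_integralD//; last 3 first.
- by move=> w _; rewrite lee_fin divr_ge0// ltW.
- by move=> w _; rewrite mule_ge0// lee_fin ?sqr_ge0// invr_ge0 mulr_ge0// ltW.
- exact: measurable_funeM.
rewrite integral_cst//= ge0_integralZl_EFin//; last 2 first.
- by move=> w _; rewrite lee_fin sqr_ge0.
- by rewrite invr_ge0 mulr_ge0// ltW.
rewrite ME -(fineK ffin) -!EFinM -EFinD lee_fin.
apply: (@le_trans _ _ (c / 2 * (M + 1) + (2 * c)^-1 * (e * c))).
  apply: lerD; first by rewrite ler_pM2l ?lerDl// divr_gt0.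
  by rewrite ler_pM2l// invr_gt0 mulr_gt0.
rewrite le_eqVlt; apply/orP; left; apply/eqP.
by rewrite /c; field; rewrite !gt_eqF.
Qed.

Lemma L1_cvg_integralM (D : set T) (f_ : nat -> T -> R) (f q : T -> R) (Q : R) :
  measurable D ->
  (forall n, mu.-integrable D (EFin \o f_ n)) -> mu.-integrable D (EFin \o f) ->
  (\int[mu]_(x in D) (`|f_ n x - f x|)%:E)%E @[n --> \oo] --> 0%E ->
  measurable_fun D q -> (forall x, D x -> `|q x| <= Q) ->
  \int[mu]_(x in D) (f_ n x * q x) @[n --> \oo] --> \int[mu]_(x in D) (f x * q x).
Proof.
move=> mD if_ iff cv mq qQ.
have int_q h : mu.-integrable D (EFin \o h) -> mu.-integrable D (EFin \o (fun x => h x * q x)).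
  move=> ih; apply: (@le_integrable _ _ _ mu D mD _ (fun x => (Q%:E * (h x)%:E)%E)).
  - apply/measurable_EFinP; apply: measurable_funM => //.
    by apply/measurable_EFinP; exact: measurable_int ih.
  - move=> x Dx; rewrite /= lee_fin normrM mulrC [leRHS]normrM ler_wpM2r//.
    by rewrite (le_trans (qQ _ Dx))// ler_norm.
  - exact: integrableZl.
have ib n : mu.-integrable D (EFin \o (fun x => f_ n x - f x)).
  have := integrableB mD (if_ n) iff.
  by apply: eq_integrable => // x _; rewrite /= EFinB.
have [Qn|Q0] := ltP Q 0.
  have -> : D = set0.
    apply/seteqP; split => // x /qQ; rewrite leNgt (lt_le_trans Qn)//.
  rewrite Rintegral_set0; under eq_fun do rewrite Rintegral_set0.
  exact: cvg_cst.
apply/cvgrPdist_le => e e0.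
have e1 : 0 < e / (Q + 1) by rewrite divr_gt0// ltr_wpDl.
move/fine_cvgP : cv => [cfin /cvgrPdist_le/(_ _ e1)].
move: cfin; apply: filterS2 => n /= cfin.
rewrite sub0r normrN => Hn.
rewrite distrC -RintegralB//; [|exact: int_q|exact: int_q].
have -> : \int[mu]_(x in D) (f_ n x * q x - f x * q x) =
    \int[mu]_(x in D) ((f_ n x - f x) * q x).
  by apply: eq_Rintegral => x _; rewrite mulrBl.
apply: (le_trans (le_normr_Rintegral mD (int_q _ (ib n)))).
apply: (@le_trans _ _ (\int[mu]_(x in D) (Q * `|f_ n x - f x|))).
  apply: le_Rintegral => //.
  - by have := integrable_norm (int_q _ (ib n)).
  - by have := integrableZl mD Q (integrable_norm (ib n)).
  - by move=> x Dx; rewrite normrM mulrC ler_wpM2r// qQ.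
rewrite RintegralZl//; last by have := integrable_norm (ib n).
apply: (@le_trans _ _ ((Q + 1) * (e / (Q + 1)))); last first.
  by rewrite mulrC divfK// gt_eqF// ltr_wpDl.
apply: ler_pM => //; first by apply: Rintegral_ge0.
  by rewrite lerDl.
exact: le_trans (ler_norm _) Hn.
Qed.

End weak_convergence.

(** * Half the variogram of fractional Brownian motion and its derivative *)

Section variogram.
Context {R : realType}.
Notation mu := (@lebesgue_measure R).
Variable H : R.
Hypothesis H0 : 0 < H.

(** Half the variance of an increment of length x. For s, t >= 0 the covariance is R(s, t) = fbm_var
    t + fbm_var s - fbm_var (t - s), so covariances of increments are second differences of
    [fbm_var]. *)
Definition fbm_var (x : R) : R := 2^-1 * `|x| `^ (2 * H).
Definition fbm_dvar (x : R) : R := H * (Num.sg x * `|x| `^ (2 * H - 1)).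

Let H2 : 0 < 2 * H. Proof. by rewrite mulr_gt0. Qed.
Let H21 : 0 < 2 * H + 1. Proof. by rewrite addr_gt0. Qed.

Lemma is_derive_addl (c x : R) : is_derive x 1 (fun y => c + y) 1.
Proof. by have := is_deriveD (is_derive_cst c x 1) (is_derive_id x 1); rewrite add0r. Qed.

Lemma is_derive_subl (c x : R) : is_derive x 1 (fun y => c - y) (-1).
Proof. by have := is_deriveB (is_derive_cst c x 1) (is_derive_id x 1); rewrite add0r. Qed.

Lemma continuous_fbm_var : continuous fbm_var.
Proof. by move=> x; apply: cvgM; [exact: cvg_cst|exact: continuous_norm_powR]. Qed.

Lemma measurable_fbm_var : measurable_fun setT fbm_var.
Proof. by apply: measurable_funM => //; exact: measurable_norm_powR. Qed.

Lemma fbm_var0 : fbm_var 0 = 0.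
Proof. by rewrite /fbm_var normr0 powR0 ?mulr0// gt_eqF. Qed.

Lemma fbm_varN x : fbm_var (- x) = fbm_var x.
Proof. by rewrite /fbm_var normrN. Qed.

Lemma fbm_var_ge0 x : 0 <= fbm_var x.
Proof. by rewrite mulr_ge0// powR_ge0. Qed.

Lemma fbm_var_le x y : `|x| <= y -> fbm_var x <= fbm_var y.
Proof.
move=> xy; rewrite ler_pM2l ?invr_gt0// ge0_ler_powR ?nnegrE// ?(ltW H2)//.
by apply: le_trans xy _; exact: ler_norm.
Qed.

Lemma is_derive_fbm_var (x : R) : x != 0 -> is_derive x 1 fbm_var (fbm_dvar x).
Proof.
move=> x0; have := is_deriveZ 2^-1 (is_derive_norm_powR (2 * H) x0).
rewrite /GRing.scale/= (_ : 2^-1 * _ = fbm_dvar x)//.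
by rewrite /fbm_dvar; field.
Qed.

Lemma measurable_fbm_dvar : measurable_fun setT fbm_dvar.
Proof.
apply: measurable_funM => //; apply: measurable_funM; last exact: measurable_norm_powR.
apply: nondecreasing_measurable => // x y xy.
by have [x0|x0|x0] := sgrP x; have [y0|y0|y0] := sgrP y; lra.
Qed.

Lemma integrable_fbm_dvar u v : mu.-integrable `[u, v] (EFin \o fbm_dvar).
Proof.
have := @integrableZl _ _ _ mu `[u, v]%classic (measurable_itv _) H _ (integrable_sg_norm_powR u v H2).
by [].
Qed.

(** A bound that is uniform in the shift c: it dominates the Fubini exchange below even for H < 1/2,
    where [fbm_dvar] is unbounded near 0. *)
Lemma integral_shift_abs_fbm_dvar (c h K : R) : 0 <= h -> `|c| + h <= K ->
  (\int[mu]_(x in `[0%R, h]) `|fbm_dvar (c + x)|%:E <=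
   \int[mu]_(x in `[(- K)%R, K]) `|fbm_dvar x|%:E)%E.
Proof.
move=> h0 cK.
have mf : measurable_fun setT (fun x => `|fbm_dvar x|%:E).
  apply/measurable_EFinP; apply: measurableT_comp; first exact: normr_measurable.
  exact: measurable_fbm_dvar.
apply: (@le_trans _ _ (\int[mu]_(x in `[c, (c + h)%R]) `|fbm_dvar x|%:E)%E).
  rewrite (@ge0_integral_affine _ 1 c `[c, (c + h)%R]%classic)//; last first.
  - exact: measurable_funTS.
  rewrite mul1e le_eqVlt; apply/orP; left; apply/eqP.
  rewrite (_ : _ @^-1` _ = `[0, h]%classic).
    by apply: eq_integral => x _; rewrite mul1r addrC.
  by apply/seteqP; split => x /=; rewrite !in_itv/= mul1r lerDr (addrC c) lerD2r.
apply: ge0_subset_integral => //; first exact: measurable_funTS.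
apply: subset_itv; rewrite bnd_simp.
  by rewrite lerNl (le_trans (ler_norm _))// normrN (le_trans _ cK)// lerDl.
by rewrite (le_trans _ cK)// lerD2r ler_norm.
Qed.

Lemma integrable_shift_fbm_dvar (c h : R) :
  mu.-integrable `[0, h] (EFin \o (fun x => fbm_dvar (c + x))).
Proof.
have mf : measurable_fun setT (fun x => fbm_dvar (c + x)).
  apply: measurableT_comp; first exact: measurable_fbm_dvar.
  exact: measurable_funD.
have [h0|h0] := leP 0 h; last first.
  by rewrite set_itv_ge ?bnd_simp -?ltNge//; exact: integrable_set0.
apply/integrableP; split; first by apply/measurable_EFinP; exact: measurable_funTS.
apply: (le_lt_trans (integral_shift_abs_fbm_dvar h0 (lexx (`|c| + h)))).
by have /integrableP[] := integrable_fbm_dvar (- (`|c| + h)) (`|c| + h).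
Qed.

Lemma integral_shift_fbm_dvar (c h : R) : 0 <= h ->
  \int[mu]_(x in `[0, h]) fbm_dvar (c + x) = fbm_var (c + h) - fbm_var c.
Proof.
move=> h0.
rewrite (@FTC_right_except _ _ (fun x => fbm_var (c + x)) 0 h (- c))//.
- by rewrite addr0.
- exact: integrable_shift_fbm_dvar.
- apply: continuous_subspaceT => x; apply: continuous_comp; last exact: continuous_fbm_var.
  by apply: cvgD; [exact: cvg_cst|exact: cvg_id].
- move=> x _ xc; apply: is_derive_right_slope.
  have cx : c + x != 0 by rewrite addrC -[c]opprK subr_eq0.
  rewrite -[fbm_dvar _]mulr1.
  apply: (@is_derive1_comp _ fbm_var (fun x => c + x)); first exact: is_derive_fbm_var.
  exact: is_derive_addl.
Qed.

(** The odd primitive of [fbm_var]. *)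
Let M (x : R) : R := (2 * (2 * H + 1))^-1 * (Num.sg x * `|x| `^ (2 * H + 1)).

Let cM : continuous M.
Proof. by move=> x; apply: cvgM; [exact: cvg_cst|exact: continuous_sg_norm_powR]. Qed.

Let dM (x : R) : x != 0 -> is_derive x 1 M (fbm_var x).
Proof.
move=> x0; have := is_deriveZ (2 * (2 * H + 1))^-1 (is_derive_sg_norm_powR (2 * H + 1) x0).
rewrite /GRing.scale/= addrK (_ : (2 * (2 * H + 1))^-1 * _ = fbm_var x)//.
by rewrite /fbm_var; field; rewrite gt_eqF.
Qed.

Let cshift (f : R -> R) (c : R) : continuous f -> continuous (fun x => f (c + x)).
Proof.
move=> cf x; apply: continuous_comp; last exact: cf.
by apply: cvgD; [exact: cvg_cst|exact: cvg_id].
Qed.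

Let cshiftN (f : R -> R) (c : R) : continuous f -> continuous (fun x => f (c - x)).
Proof.
move=> cf x; apply: continuous_comp; last exact: cf.
by apply: cvgB; [exact: cvg_cst|exact: cvg_id].
Qed.

Let cint (f : R -> R) u v : continuous f -> mu.-integrable `[u, v] (EFin \o f).
Proof.
move=> cf; apply: continuous_compact_integrable; first exact: segment_compact.
exact: continuous_subspaceT.
Qed.

Let int1 (c h : R) : 0 <= h ->
  \int[mu]_(x in `[0, h]) fbm_var (c + x) = M (c + h) - M c.
Proof.
move=> h0.
rewrite (@FTC_right_except _ _ (fun x => M (c + x)) 0 h (- c))//.
- by rewrite addr0.
- by apply: cint; apply: cshift; exact: continuous_fbm_var.
- by apply: continuous_subspaceT; exact: cshift.
- move=> x _ xc; apply: is_derive_right_slope.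
  have cx : c + x != 0 by rewrite addrC -[c]opprK subr_eq0.
  rewrite -[fbm_var _]mulr1.
  apply: (@is_derive1_comp _ M (fun x => c + x)); first exact: dM.
  exact: is_derive_addl.
Qed.

Let int2 (v c d : R) : c <= d ->
  \int[mu]_(r in `[c, d]) fbm_var (v - r) = M (v - c) - M (v - d).
Proof.
move=> cd.
rewrite (@FTC_right_except _ _ (fun x => - M (v - x)) c d v)//.
- by ring.
- by apply: cint; apply: cshiftN; exact: continuous_fbm_var.
- by apply: continuous_subspaceT => x; apply: cvgN; exact: (@cshiftN M v cM x).
- move=> x _ xv; apply: is_derive_right_slope.
  have vx : v - x != 0 by rewrite subr_eq0 eq_sym.
  have D : is_derive x 1 (fun x => v - x) (-1).
    exact: is_derive_subl.
  have := is_deriveN (@is_derive1_comp _ M (fun x => v - x) _ _ _ (dM vx) D).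
  by rewrite mulrN1 opprK.
Qed.

(** Both sides are the same second difference of the primitive [M]. This is the exchange of
    integrals for [fbm_dvar] over a rectangle, obtained without a singular double integral. *)
Lemma integral_fbm_var_exchange (u h c d : R) : 0 <= h -> c <= d ->
  \int[mu]_(x in `[0, h]) (fbm_var (u + x - c) - fbm_var (u + x - d)) =
  \int[mu]_(r in `[c, d]) (fbm_var (u + h - r) - fbm_var (u - r)).
Proof.
move=> h0 cd.
have E e : (fun x => fbm_var (u + x - e)) = (fun x => fbm_var (u - e + x)).
  by apply/funext => x; rewrite addrAC.
have ic e : mu.-integrable `[0, h] (EFin \o (fun x => fbm_var (u + x - e))).
  by rewrite E; apply: cint; apply: cshift; exact: continuous_fbm_var.
have id v : mu.-integrable `[c, d] (EFin \o (fun r => fbm_var (v - r))).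
  by apply: cint; apply: cshiftN; exact: continuous_fbm_var.
transitivity (\int[mu]_(x in `[0, h]) fbm_var (u + x - c) -
              \int[mu]_(x in `[0, h]) fbm_var (u + x - d)).
  by rewrite RintegralB; [|exact: measurable_itv|exact: ic|exact: ic].
transitivity (\int[mu]_(r in `[c, d]) fbm_var (u + h - r) -
              \int[mu]_(r in `[c, d]) fbm_var (u - r)); last first.
  by rewrite RintegralB; [|exact: measurable_itv|exact: id|exact: id].
rewrite !E !int1// !int2//.
have -> : u - c + h = u + h - c by ring.
have -> : u - d + h = u + h - d by ring.
ring.
Qed.

(** The first term does not depend on s. In differences between two values of s only [fbm_dvar]
    survives. *)
Lemma derive1_fbm_cov (s r : R) : 0 < r -> r != s ->
  derive1 (fun r' => fbm_cov H r' s) r = H * r `^ (2 * H - 1) + fbm_dvar (s - r).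
Proof.
move=> r0 rs; rewrite derive1E.
have sr : s - r != 0 by rewrite subr_eq0 eq_sym.
have D : is_derive r 1 (fun x => s - x) (-1).
  exact: is_derive_subl.
have D1 := is_deriveZ 2^-1 (is_derive1_powR (2 * H) r0).
have D2 := @is_derive1_comp _ fbm_var (fun x => s - x) _ _ _ (is_derive_fbm_var sr) D.
have D3 := is_deriveB (is_deriveD (is_derive_cst (2^-1 * s `^ (2 * H)) r 1) D1) D2.
rewrite (_ : (fun r' => fbm_cov H r' s) = (cst (2^-1 * s `^ (2 * H)) +
   (2^-1 \*: (fun x => x `^ (2 * H))) - (fbm_var \o (fun x => s - x)))%R).
  rewrite (@derive_val _ _ _ _ _ _ _ D3) add0r mulrN1 opprK /GRing.scale/=.
  by rewrite !mulrA mulVf ?mul1r.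
apply/funext => x; rewrite /fbm_cov /fbm_var /=.
by rewrite -!mulrDr -mulrBr.
Qed.

End variogram.

Section integrals.
Context {R : realType} {d : measure_display} {T : measurableType d}.
Variable mu : {measure set T -> \bar R}.

Lemma Rintegral_eq_off_null (D N : set T) (f g : T -> R) :
  measurable D -> measurable N -> mu N = 0%E -> measurable_fun D g ->
  mu.-integrable D (EFin \o f) -> (forall x, D x -> ~ N x -> f x = g x) ->
  mu.-integrable D (EFin \o g) /\ \int[mu]_(x in D) f x = \int[mu]_(x in D) g x.
Proof.
move=> mD mN N0 mg intf fg.
have mf := measurable_int _ intf.
have mEg : measurable_fun D (EFin \o g) by exact/measurable_EFinP.
have intg : mu.-integrable D (EFin \o g).
  apply/(negligible_integrable mN mD mEg N0).
  have /(negligible_integrable mN mD mf N0) := intf.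
  apply: eq_integrable; first exact: measurableD.
  by move=> x; rewrite inE => -[Dx Nx]; rewrite /= fg.
split=> //; rewrite /Rintegral (negligible_integral mN mD intf N0).
rewrite (negligible_integral mN mD intg N0); congr fine.
by apply: eq_integral => x; rewrite inE => -[Dx Nx]; rewrite /= fg.
Qed.

Lemma Rintegral_bounded_cvg (D : set T) (f_ : nat -> T -> R) (f : T -> R) (C : R) :
  measurable D -> (mu D < +oo)%E -> (forall n, measurable_fun D (f_ n)) ->
  mu.-integrable D (EFin \o f) ->
  (forall n x, D x -> `|f_ n x| <= C) ->
  (forall x, D x -> f_ n x @[n --> \oo] --> f x) ->
  \int[mu]_(x in D) f_ n x @[n --> \oo] --> \int[mu]_(x in D) f x.
Proof.
move=> mD Doo mf_ intf fC ff.
apply: fine_cvg; rewrite fineK; last exact: integrable_fin_num intf.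
refine (@dominated_cvg _ T R mu D _ (fun N x => (f_ N x)%:E) (fun x => (f x)%:E) (cst C%:E) _ _ _ _ _) => //.
- by move=> n; apply/measurable_EFinP; exact: mf_.
- by move=> x Dx; apply: cvg_EFin; [exact: nearW|exact: ff].
- by apply/integrableP; split => //; rewrite integral_cst// lte_mul_pinfty.
Qed.

Lemma EFin_Rintegral (D : set T) (f : T -> R) : mu.-integrable D (EFin \o f) -> measurable D ->
  (\int[mu]_(x in D) f x)%:E = (\int[mu]_(x in D) (f x)%:E)%E.
Proof. by move=> i mD; rewrite /Rintegral fineK//; exact: (integrable_fin_num mD i). Qed.

Lemma integral_patchM (D : set T) (f k : T -> R) :
  (\int[mu]_x ((f \_ D) x * k x)%:E = \int[mu]_(x in D) (f x * k x)%:E)%E.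
Proof.
rewrite [RHS]integral_mkcond; apply: eq_integral => x _; rewrite !patchE.
by case: ifPn => // _; rewrite mul0r.
Qed.

Lemma integrable_indicM (D A : set T) (q : T -> R) : measurable D -> measurable A ->
  mu.-integrable D (EFin \o q) ->
  mu.-integrable D (EFin \o (fun x => \1_A x * q x)).
Proof.
move=> mD mA iq; apply: (le_integrable mD _ _ iq).
- apply/measurable_EFinP; apply: measurable_funM.
    by apply: measurable_funTS; exact: measurable_indic.
  by apply/measurable_EFinP; exact: measurable_int iq.
- move=> x _; rewrite /= lee_fin normrM indicE.
  by case: (x \in A); rewrite ?normr1 ?mul1r// normr0 mul0r.
Qed.

Lemma Rintegral_indicM (D A : set T) (q : T -> R) : A `<=` D ->
  \int[mu]_(x in D) (\1_A x * q x) = \int[mu]_(x in A) q x.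
Proof.
move=> AD; rewrite Rintegral_mkcond [RHS]Rintegral_mkcond.
apply: eq_Rintegral => x _; rewrite !patchE indicE.
have [xA|xA] := boolP (x \in A).
  by rewrite (mem_set (AD _ (set_mem xA))) mul1r.
by rewrite mul0r if_same.
Qed.

Lemma integrable_of_sqr (D : set T) (f : T -> R) : measurable D -> (mu D < +oo)%E ->
  measurable_fun D f -> (\int[mu]_(x in D) (f x ^+ 2)%:E < +oo)%E ->
  mu.-integrable D (EFin \o f).
Proof.
move=> mD Doo mf f2.
have i2 : mu.-integrable D (fun x => (f x ^+ 2)%:E).
  apply/integrableP; split; first exact/measurable_EFinP/measurable_funX.
  by under eq_integral do rewrite /= ger0_norm ?sqr_ge0//.
have i1 : mu.-integrable D (cst 1%E).
  by apply/integrableP; split => //; rewrite integral_cst// lte_mul_pinfty//= normr1.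
apply: (le_integrable mD _ _ (integrableD mD i1 i2)); first exact/measurable_EFinP.
move=> x _; rewrite /= lee_fin [leRHS]ger0_norm ?addr_ge0 ?sqr_ge0//.
rewrite -[f x ^+ 2]real_normK ?num_real//.
have := sqr_ge0 (`|f x| - 1); have := normr_ge0 (f x); nra.
Qed.

End integrals.

Section fubini.
Context {R : realType} {d1 d2 : measure_display}.
Context {T1 : measurableType d1} {T2 : measurableType d2}.
Variable m1 : {sigma_finite_measure set T1 -> \bar R}.
Variable m2 : {sigma_finite_measure set T2 -> \bar R}.

Lemma Rintegral_fubini (f : T1 * T2 -> R) (b : T2 -> R) (F1 : T1 -> R) (F2 : T2 -> R) :
  measurable_fun setT f -> m2.-integrable setT (EFin \o b) ->
  (forall y, (\int[m1]_x (`|f (x, y)|)%:E <= (b y)%:E)%E) ->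
  (forall x, (\int[m2]_y (f (x, y))%:E = (F1 x)%:E)%E) ->
  (forall y, (\int[m1]_x (f (x, y))%:E = (F2 y)%:E)%E) ->
  \int[m1]_x F1 x = \int[m2]_y F2 y.
Proof.
move=> mf ib fb f1 f2.
have mEf : measurable_fun setT (EFin \o f) by exact/measurable_EFinP.
have fint : (m1 \x m2)%E.-integrable setT (EFin \o f).
  apply/integrable21ltyP => //.
  have /integrableP[mb] := ib; apply: le_lt_trans; apply: ge0_le_integral => //.
  - by move=> y _; apply: integral_ge0 => x _; exact: abse_ge0.
  - apply: (measurable_fun_fubini_tonelli_G (abse \o (EFin \o f))) => //=.
    exact: measurableT_comp.
  - exact: measurableT_comp.
  - by move=> y _; apply: (le_trans (fb y)); rewrite lee_fin ler_norm.
rewrite /Rintegral; congr fine.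
transitivity (\int[m1]_x \int[m2]_y (f (x, y))%:E)%E.
  by apply: eq_integral => x _; rewrite f1.
by rewrite (Fubini fint); apply: eq_integral => y _; rewrite /= f2.
Qed.

End fubini.

(** * Step functions and covariances of their integrals *)

Section step_integrals.
Context {R : realType}.
Notation mu := (@lebesgue_measure R).

Lemma lebesgue_measure_itvcc_fin (a b : R) : (mu `[a, b]%classic < +oo)%E.
Proof. by rewrite lebesgue_measure_itv/=; case: ifP; rewrite -?EFinD ltry. Qed.

(** The covariance of the increments over [a, b] and [c, d] of a process for which m is half the
    variogram; see [ip_incr]. Likewise [step_cov] is the covariance of an increment with the
    integral of a step function. *)
Definition incr_cov (m : R -> R) (a b c d : R) : R :=
  m (b - c) + m (a - d) - m (b - d) - m (a - c).

Definition step_cov (m : R -> R) (a b : R) (p : seq (R * (R * R))) : R :=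
  \sum_(q <- p) q.1 * incr_cov m a b q.2.1 q.2.2.

Definition steps_in (T : R) (p : seq (R * (R * R))) : Prop :=
  forall q, q \in p -> [/\ 0 <= q.2.1, q.2.1 <= q.2.2 & q.2.2 <= T].

Lemma steps_in_cons T q p : steps_in T (q :: p) ->
  [/\ 0 <= q.2.1, q.2.1 <= q.2.2 & q.2.2 <= T] /\ steps_in T p.
Proof.
move=> h; split; first by apply: h; rewrite mem_head.
by move=> r rp; apply: h; rewrite in_cons rp orbT.
Qed.

Lemma measurable_step_fun (p : seq (R * (R * R))) : measurable_fun setT (step_fun p).
Proof.
apply: measurable_sum => q; apply: measurable_funM => //.
Qed.

Lemma integrable_step_funM (T : R) (p : seq (R * (R * R))) (q : R -> R) :
  mu.-integrable `[0, T] (EFin \o q) ->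
  mu.-integrable `[0, T] (EFin \o (fun x => step_fun p x * q x)).
Proof.
move=> iq; elim: p => [|c p IH].
  rewrite (_ : _ \o _ = cst 0%E); first exact: integrable0.
  by apply/funext => x; rewrite /= /step_fun big_nil mul0r.
have i1 := @integrable_indicM _ _ _ mu _ _ _ (measurable_itv `[0, T]) (measurable_itv `]c.2.1, c.2.2]) iq.
have i2 := @integrableZl _ _ _ mu _ (measurable_itv _) c.1 _ i1.
have := @integrableD _ _ _ mu _ (measurable_itv _) _ _ i2 IH.
apply: eq_integrable => // x _.
by rewrite /= /step_fun big_cons mulrDl EFinD -mulrA EFinM.
Qed.

Lemma integral_step_funM (T : R) (p : seq (R * (R * R))) (q : R -> R) :
  steps_in T p -> mu.-integrable `[0, T] (EFin \o q) ->
  \int[mu]_(x in `[0, T]) (step_fun p x * q x) =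
  \sum_(r <- p) r.1 * \int[mu]_(x in `[r.2.1, r.2.2]) q x.
Proof.
move=> + iq; elim: p => [_|c p IH].
  rewrite big_nil (_ : (fun _ => _) = cst 0); first by rewrite Rintegral_cst// mul0r.
  by apply/funext => x; rewrite /step_fun big_nil mul0r.
move=> /steps_in_cons[[c1 c12 c2] pT]; rewrite big_cons -(IH pT).
have sub : `]c.2.1, c.2.2] `<=` `[0, T].
  move=> x /=; rewrite !in_itv/= => /andP[c1x xc2].
  by rewrite (le_trans xc2 c2) (le_trans c1 (ltW c1x)).
have i1 := @integrable_indicM _ _ _ mu _ _ _ (measurable_itv `[0, T]) (measurable_itv `]c.2.1, c.2.2]) iq.
transitivity (\int[mu]_(x in `[0, T]) (c.1 * (\1_(`]c.2.1, c.2.2] : set R) x * q x)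
   + step_fun p x * q x)).
  by apply: eq_Rintegral => x _; rewrite /step_fun big_cons mulrDl mulrA.
rewrite RintegralD; [|exact: measurable_itv| |exact: integrable_step_funM]; last first.
  by have := @integrableZl _ _ _ mu _ (measurable_itv _) c.1 _ i1.
rewrite RintegralZl; [|exact: measurable_itv|exact: i1].
rewrite Rintegral_indicM// Rintegral_itv_obnd_cbnd//.
by apply: integrableS iq => //.
Qed.

End step_integrals.

(** * Averages over short windows *)

Section windows.
Context {R : realType}.
Notation mu := (@lebesgue_measure R).

Lemma Rintegral_cst_itv (a b c : R) : a <= b ->
  \int[mu]_(x in `[a, b]) (cst c x) = c * (b - a).
Proof.
rewrite le_eqVlt => /predU1P[->|ab].
  by rewrite set_itv1 Rintegral_set1 subrr mulr0.
by rewrite Rintegral_cst//= lebesgue_measure_itv/= lte_fin ab.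
Qed.

Lemma within_continuous_shift (A B : set R) (f : R -> R) (c : R) :
  {within A, continuous f} -> (forall x, B x -> A (c + x)) ->
  {within B, continuous (fun x => f (c + x))}.
Proof.
move=> /subspace_continuousP cf BA; apply/subspace_continuousP => x Bx.
apply/cvgrPdist_le => e e0.
move/cvgrPdist_le : (cf _ (BA _ Bx)) => /(_ e e0) H.
have {}H : nbhs (c + x) (fun y => A y -> `|f (c + x) - f y| <= e) := H.
have cs : (c + y) @[y --> x] --> c + x by apply: cvgD; [exact: cvg_cst|exact: cvg_id].
apply: (@filterS _ _ (nbhs_filter x)) (cs _ H) => y h By.
exact: h (BA _ By).
Qed.

(** On windows of small length w ending at b and at a, continuity keeps the integrand within half of
    |K b - K a| of K b - K a, so its integral could vanish only if K b = K a. Windows to the left of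
    the points stay inside ]0, T]. *)
Lemma eq_of_window_integrals (K : R -> R) (T a b : R) :
  {within `]0, T], continuous K} -> 0 < a <= T -> 0 < b <= T ->
  (forall w, 0 < w -> w < a -> w < b ->
    \int[mu]_(x in `[0, w]) (K (b - w + x) - K (a - w + x)) = 0) ->
  K b = K a.
Proof.
move=> cK aT bT K0; apply/eqP; rewrite -subr_eq0; apply/negPn/negP => ne.
pose D := K b - K a.
have D0 : 0 < `|D| by rewrite normr_gt0.
have e0 : 0 < `|D| / 4 by rewrite divr_gt0.
have Aa : `]0, T]%classic a by rewrite /= in_itv.
have Ab : `]0, T]%classic b by rewrite /= in_itv.
have [d1 d10 h1] := within_continuous_eps cK Ab e0.
have [d2 d20 h2] := within_continuous_eps cK Aa e0.
have [w [w0 wa wb w1 w2]] : exists w, [/\ 0 < w, w < a, w < b, w < d1 & w < d2].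
  pose w := Num.min (Num.min a b) (Num.min d1 d2).
  have w0 : 0 < w by rewrite !lt_min d10 d20 (andP aT).1 (andP bT).1.
  have w2 : w / 2 < w by rewrite ltr_pdivrMr// ltr_pMr// ltr1n.
  exists (w / 2); split; first by rewrite divr_gt0.
  - by apply: (lt_le_trans w2); rewrite !ge_min lexx.
  - by apply: (lt_le_trans w2); rewrite !ge_min lexx !orbT.
  - by apply: (lt_le_trans w2); rewrite !ge_min lexx !orbT.
  - by apply: (lt_le_trans w2); rewrite !ge_min lexx !orbT.
pose k x := K (b - w + x) - K (a - w + x).
have ik1 c : w < c <= T -> mu.-integrable `[0, w] (EFin \o (fun x => K (c - w + x))).
  move=> cT; apply: continuous_compact_integrable; first exact: segment_compact.
  by apply: (within_continuous_shift cK) => x; rewrite /= !in_itv/=; lra.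
have ik : mu.-integrable `[0, w] (EFin \o k).
  have wbT : w < b <= T by lra.
  have waT : w < a <= T by lra.
  have := @integrableB _ _ _ mu _ (measurable_itv _) _ _ (ik1 _ wbT) (ik1 _ waT).
  by apply: eq_integrable => // x _; rewrite /= EFinB.
have ic (c : R) : mu.-integrable `[0, w] (EFin \o (fun=> c)) by exact: integrable_cst_itv.
have iDk : mu.-integrable `[0, w] (EFin \o (fun x => D - k x)).
  have := @integrableB _ _ _ mu _ (measurable_itv _) _ _ (ic D) ik.
  by apply: eq_integrable => // x _; rewrite /= EFinB.
have E1 : \int[mu]_(x in `[0, w]) (D - k x) = D * w.
  rewrite RintegralB; [|exact: measurable_itv|exact: ic|exact: ik].
  by rewrite K0// subr0 Rintegral_cst_itv ?(ltW w0)// subr0.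
have : `|D * w| <= `|D| / 2 * w.
  rewrite -E1; apply: (le_trans (le_normr_Rintegral _ iDk)); first exact: measurable_itv.
  have -> : `|D| / 2 * w = \int[mu]_(x in `[0, w]) (cst (`|D| / 2) x).
    by rewrite Rintegral_cst_itv ?(ltW w0)// subr0.
  apply: le_Rintegral => //.
  - by have := integrable_norm iDk.
  - exact: ic.
  move=> x; rewrite /= in_itv/= => /andP[x0 xw].
  have X1 : `|K (b - w + x) - K b| < `|D| / 4.
    by apply: h1; [rewrite /= in_itv/=; lra|rewrite ltr_norml; lra].
  have X2 : `|K (a - w + x) - K a| < `|D| / 4.
    by apply: h2; [rewrite /= in_itv/=; lra|rewrite ltr_norml; lra].
  rewrite /k /D; move: X1 X2; rewrite !ltr_norml => /andP[? ?] /andP[? ?].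
  rewrite ler_norml; lra.
rewrite normrM (gtr0_norm w0) ler_pM2r//; lra.
Qed.

Lemma continuous_step_cov (m : R -> R) (a : R) (p : seq (R * (R * R))) :
  continuous m -> continuous (fun b => step_cov m a b p).
Proof.
move=> cm; elim: p => [|q p IH] x.
  rewrite (_ : (fun b => _) = cst 0); first exact: cvg_cst.
  by apply/funext => b; rewrite /step_cov big_nil.
rewrite (_ : (fun b => _) =
    (fun b => q.1 * incr_cov m a b q.2.1 q.2.2 + step_cov m a b p)); last first.
  by apply/funext => b; rewrite /step_cov big_cons.
have mc c : m (b - c) @[b --> x] --> m (x - c).
  apply: (@cvg_comp _ _ _ (fun b => b - c) m); last exact: cm.
  by apply: cvgB; [exact: cvg_id|exact: cvg_cst].
apply: cvgD; last exact: IH.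
apply: cvgM; first exact: cvg_cst.
apply: cvgB; last exact: cvg_cst.
apply: cvgB; last exact: mc.
by apply: cvgD; [exact: mc|exact: cvg_cst].
Qed.

End windows.

(** * The kernel equation in weak form *)

Section kernel.
Context {R : realType}.
Notation mu := (@lebesgue_measure R).
Variables (H T : R) (g : R -> R).
Hypotheses (H0 : 0 < H) (T0 : 0 < T) (gK : mle_kernel H T g).

Let h s r := g r * derive1 (fun r' => fbm_cov H r' s) r.
Let F s := \int[mu]_(r in `[0, T]) h s r.
Let fm := @fbm_var R H.
Let fdm := @fbm_dvar R H.

Lemma mle_kernel_measurable : measurable_fun `[0, T] g.
Proof. by case: gK. Qed.

Lemma mle_kernel_integrable : mu.-integrable `[0, T] (EFin \o g).
Proof.
case: gK => mg g2 _; apply: integrable_of_sqr => //.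
exact: lebesgue_measure_itvcc_fin.
Qed.

Let mfdm (c : R) : measurable_fun setT (fun r : R => fdm (c - r)).
Proof. by apply: measurableT_comp; [exact: measurable_fbm_dvar|exact: measurable_funB]. Qed.

(** By [derive1_fbm_cov] the term in r^(2H - 1) cancels in the difference. The points 0, a, b, where
    that formula may fail, form a null set. *)
Let kernel_incr (a b : R) : 0 < a <= T -> 0 < b <= T ->
  mu.-integrable `[0, T] (EFin \o (fun r => g r * (fdm (b - r) - fdm (a - r)))) /\
  F b - F a = \int[mu]_(r in `[0, T]) (g r * (fdm (b - r) - fdm (a - r))).
Proof.
move=> aT bT; have [mg _ gs] := gK.
have [ia _] := gs _ aT; have [ib _] := gs _ bT.
have iab : mu.-integrable `[0, T] (EFin \o (fun r => h b r - h a r)).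
  have := @integrableB _ _ _ mu _ (measurable_itv _) _ _ ib ia.
  by apply: eq_integrable => // x _; rewrite /= EFinB.
have -> : F b - F a = \int[mu]_(r in `[0, T]) (h b r - h a r).
  by rewrite RintegralB; [|exact: measurable_itv|exact: ib|exact: ia].
have cN : countable [set 0; a; b].
  by apply: finite_set_countable; rewrite !finite_setU.
apply: (@Rintegral_eq_off_null _ _ _ mu _ [set 0; a; b]) => //; last 1 first.
- move=> x; rewrite /= in_itv/= => /andP[x0 xT] /not_orP[/not_orP[x0' xa] xb].
  have {}x0 : 0 < x by rewrite lt_neqAle x0 andbT eq_sym; exact/eqP.
  rewrite /h !derive1_fbm_cov//; [|exact/eqP|exact/eqP].
  by rewrite /fdm; ring.
- by apply: measurableU => //; exact: measurableU.
- exact: countable_lebesgue_measure0.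
- apply: measurable_funM => //; apply: measurable_funTS.
  by apply: measurable_funB; exact: mfdm.
Qed.

(** The kernel of [kernel_incr] integrated over the windows of length w ending at b and at a:
    bounded and continuous in r, whatever H. *)
Let q b a w r := fm (b - r) - fm (b - w - r) - (fm (a - r) - fm (a - w - r)).

Let integral_window b a w r : 0 <= w ->
  \int[mu]_(x in `[0, w]) (fdm (b - w + x - r) - fdm (a - w + x - r)) = q b a w r.
Proof.
move=> w0.
have E c : (fun x => fdm (c - w + x - r)) = (fun x => fdm (c - w - r + x)).
  by apply/funext => x; rewrite addrAC.
rewrite RintegralB; [|exact: measurable_itv| |].
- by rewrite !E !integral_shift_fbm_dvar// /q /fm; congr (fbm_var _ _ - _ - (fbm_var _ _ - _)); ring.
- by rewrite E; exact: integrable_shift_fbm_dvar.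
- by rewrite E; exact: integrable_shift_fbm_dvar.
Qed.

Let mfdm2 (c : R) : measurable_fun setT (fun z : R * R => fdm (c + z.1 - z.2)).
Proof.
apply: (measurableT_comp (measurable_fbm_dvar H)); apply: measurable_funB => //.
exact: measurable_funD.
Qed.

Let fubini_window a b w : 0 < w -> w < a <= T -> w < b <= T ->
  \int[mu]_(x in `[0, w]) (F (b - w + x) - F (a - w + x)) =
  \int[mu]_(r in `[0, T]) (g r * q b a w r).
Proof.
move=> w0 aT bT.
pose f (z : R * R) := \1_(`[0, w] : set R) z.1 *
  ((g \_ `[0, T]) z.2 * (fdm (b - w + z.1 - z.2) - fdm (a - w + z.1 - z.2))).
have mG : measurable_fun setT (g \_ `[0, T]).
  by apply/(measurable_restrictT _ (measurable_itv _)); exact: mle_kernel_measurable.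
have mf : measurable_fun setT f.
  apply: measurable_funM; first by apply: measurableT_comp.
  apply: measurable_funM; first by apply: measurableT_comp.
  by apply: measurable_funB; exact: mfdm2.
(* For w < c <= T and y in [0, T], the argument c - w + x - y with x in [0, w] stays in [-2T, 2T],
   so K bounds the integral over x for every y. *)
pose K := (\int[mu]_(x in `[(- (2 * T))%R, (2 * T)%R]) `|fdm x|%:E)%E.
have Kfin : K \is a fin_num.
  have /integrableP[_ h1] := integrable_fbm_dvar H0 (- (2 * T)) (2 * T).
  by rewrite ge0_fin_numE// integral_ge0// => x _; rewrite lee_fin.
have E c y : (fun x => fdm (c - w + x - y)) = (fun x => fdm (c - w - y + x)).
  by apply/funext => x; rewrite addrAC.
have ishift c y : mu.-integrable `[0, w] (EFin \o (fun x => fdm (c - w + x - y))).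
  by rewrite E; exact: integrable_shift_fbm_dvar.
have bnd (c y : R) : w < c <= T -> 0 <= y <= T ->
    (\int[mu]_(x in `[0%R, w]) `|fdm (c - w + x - y)|%:E <= K)%E.
  move=> cT yT.
  have -> : (\int[mu]_(x in `[0%R, w]) `|fdm (c - w + x - y)|%:E =
             \int[mu]_(x in `[0%R, w]) `|fdm (c - w - y + x)|%:E)%E.
    by apply: eq_integral => x _; rewrite addrAC.
  apply: integral_shift_abs_fbm_dvar; first exact: ltW.
  rewrite -lerBrDr ler_norml; lra.
pose F1 (x : R) := \1_(`[0, w] : set R) x * (F (b - w + x) - F (a - w + x)).
pose F2 (y : R) := (g \_ `[0, T]) y * q b a w y.
have -> : \int[mu]_(x in `[0, w]) (F (b - w + x) - F (a - w + x)) = \int[mu]_x F1 x.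
  by rewrite /F1 Rintegral_indicM.
have -> : \int[mu]_(r in `[0, T]) (g r * q b a w r) = \int[mu]_y F2 y.
  by rewrite /Rintegral -integral_patchM.
apply: (@Rintegral_fubini _ _ _ _ _ mu mu f
  (fun y => `|(g \_ `[0, T]) y| * (2 * fine K)) F1 F2 mf).
- have iG : mu.-integrable setT (EFin \o (g \_ `[0, T])).
    have /integrable_mkcond := mle_kernel_integrable.
    by rewrite restrict_EFin; apply.
  have := @integrableZr _ _ _ mu _ measurableT (2 * fine K) _ (integrable_norm iG).
  by apply: eq_integrable.
- move=> y.
  have [yT|yT] := boolP (y \in `[0, T]%classic); last first.
    rewrite integral0_eq//; first by rewrite patchE (negbTE yT) normr0 mul0r.
    by move=> x _; rewrite /f/= patchE (negbTE yT) mul0r mulr0 normr0.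
  have y0T : 0 <= y <= T by move: yT; rewrite inE/= in_itv.
  have mk c : measurable_fun `[0, w] (fun x => `|fdm (c - w + x - y)|%:E).
    apply/measurable_EFinP; apply: measurableT_comp; first exact: normr_measurable.
    by apply/measurable_EFinP; exact: measurable_int (ishift c y).
  apply: (@le_trans _ _ (\int[mu]_(x in `[0%R, w]) (`|(g \_ `[0, T]) y|%:E *
     (`|fdm (b - w + x - y)|%:E + `|fdm (a - w + x - y)|%:E)))%E).
    rewrite [leRHS]integral_mkcond; apply: ge0_le_integral => //.
    + apply/measurable_EFinP; apply: measurableT_comp; first exact: normr_measurable.
      by apply: (measurableT_comp mf).
    + apply/(measurable_restrictT _ (measurable_itv _)).
      by apply: emeasurable_funM => //; exact: emeasurable_funD.
    + move=> x _; rewrite /f/= (patchE _ `[0, w]) indicE; case: ifP => xw.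
        rewrite mul1r -EFinD -EFinM lee_fin normrM ler_wpM2l//.
        exact: ler_normB.
      by rewrite mul0r normr0.
  rewrite ge0_integralZl//; [|by apply: emeasurable_funD; exact: mk|by move=> x _; rewrite adde_ge0].
  rewrite ge0_integralD//; [|exact: mk|exact: mk].
  rewrite EFinM lee_wpmul2l ?lee_fin//.
  have -> : (2 * fine K)%:E = (K + K)%E by rewrite -{2 3}(fineK Kfin) -EFinD -mulr2n mulr_natl.
  exact: (leeD (bnd _ _ bT y0T) (bnd _ _ aT y0T)).
- move=> x; rewrite /F1 indicE /f/=.
  have [xw|xw] := boolP (x \in `[0, w]%classic); last first.
    by rewrite mul0r integral0_eq// => y _; rewrite indicE (negbTE xw) mul0r.
  rewrite mul1r; have {}xw' : 0 <= x <= w by move: xw; rewrite inE/= in_itv.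
  have bx : 0 < b - w + x <= T by lra.
  have ax : 0 < a - w + x <= T by lra.
  have [i1 ->] := kernel_incr ax bx.
  rewrite EFin_Rintegral// -[RHS]integral_patchM.
  by apply: eq_integral => y _; rewrite indicE xw mul1r.
- move=> y; rewrite /F2 -integral_window ?ltW// EFinM.
  have idiff : mu.-integrable `[0, w] (EFin \o (fun x => fdm (b - w + x - y) - fdm (a - w + x - y))).
    have := @integrableB _ _ _ mu _ (measurable_itv _) _ _ (ishift b y) (ishift a y).
    by apply: eq_integrable => // x _; rewrite /= EFinB.
  rewrite EFin_Rintegral// -integralZl//.
  rewrite [RHS]integral_mkcond; apply: eq_integral => x _.
  by rewrite /f/= (patchE _ `[0, w]) indicE; case: ifP => _; rewrite ?mul1r ?mul0r// EFinM.
Qed.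

Let F_continuous : {within `]0, T], continuous F}.
Proof.
apply/subspace_continuousP => y yT.
have y0T : 0 < y <= T by move: yT; rewrite /= in_itv.
have [_ _ /(_ _ y0T)[_ dF]] := gK.
have FF : Filter (within `]0, T] y^') by exact: within_filter.
have cF : F x @[x --> within `]0, T] y^'] --> F y.
  have lim0 : x - y @[x --> within `]0, T] y^'] --> (0 : R).
    rewrite -(subrr y); apply: cvgB; last exact: cvg_cst.
    by apply: cvg_trans (@nbhs_dnbhs R y); exact: cvg_within.
  have c1 : (F x - F y) / (x - y) * (x - y) + F y @[x --> within `]0, T] y^'] --> (1 - g y) * 0 + F y.
    by apply: cvgD; [exact: cvgM|exact: cvg_cst].
  rewrite mulr0 add0r in c1; apply: cvg_trans c1; apply: near_eq_cvg.
  apply: (@filterS _ _ (nbhs_filter y) [set: R]); last exact: filterT.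
  by move=> x _ /= xy _; rewrite divfK ?subrK// subr_eq0.
apply/cvgrPdist_le => e e0.
move/cvgrPdist_le : cF => /(_ e e0) Hn.
have {}Hn : nbhs y (fun x => x != y -> `]0, T]%classic x -> `|F y - F x| <= e) := Hn.
apply: (@filterS _ _ (nbhs_filter y)) Hn => x Hx Ax.
have [->|xy] := eqVneq x y; first by rewrite subrr normr0 ltW.
exact: Hx.
Qed.

Let F_right_slope x : 0 < x < T -> (F y - F x) / (y - x) @[y --> x^'+] --> 1 - g x.
Proof.
move=> /andP[x0 xT].
have x0T : 0 < x <= T by rewrite x0 ltW.
have [_ _ /(_ _ x0T)[_ dF]] := gK.
apply/cvgrPdist_le => e e0.
move/cvgrPdist_le : dF => /(_ e e0) Hn.
have {}Hn : nbhs x (fun y => y != x -> `]0, T]%classic y ->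
  `|1 - g x - (F y - F x) / (y - x)| <= e) := Hn.
apply: (@filterS2 _ _ (nbhs_filter x)) (lt_nbhsl xT) Hn => y yT Hy xy; apply: Hy.
  by rewrite gt_eqF.
by rewrite /= in_itv/= (lt_trans x0 xy) ltW.
Qed.

(** The counterpart of [fubini_window] for step functions: against [q] they yield window averages of
    covariances. *)
Let integral_step_window (p : seq (R * (R * R))) a b w : 0 <= w -> steps_in T p ->
  \sum_(r <- p) r.1 * \int[mu]_(x in `[r.2.1, r.2.2]) q b a w x =
  \int[mu]_(x in `[0, w]) (step_cov fm 0 (b - w + x) p - step_cov fm 0 (a - w + x) p).
Proof.
move=> w0; have cfm : continuous fm by exact: continuous_fbm_var.
have isc (c : R) p' : mu.-integrable `[0, w] (EFin \o (fun x => step_cov fm 0 (c - w + x) p')).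
  apply: continuous_compact_integrable; first exact: segment_compact.
  apply: continuous_subspaceT => x.
  apply: (@cvg_comp _ _ _ (fun x => c - w + x) (fun y => step_cov fm 0 y p')).
    by apply: cvgD; [exact: cvg_cst|exact: cvg_id].
  exact: continuous_step_cov.
have isd p' : mu.-integrable `[0, w]
    (EFin \o (fun x => step_cov fm 0 (b - w + x) p' - step_cov fm 0 (a - w + x) p')).
  have := @integrableB _ _ _ mu _ (measurable_itv _) _ _ (isc b p') (isc a p').
  by apply: eq_integrable => // x _; rewrite /= EFinB.
elim: p => [_|r p IH].
  rewrite big_nil (_ : (fun _ => _) = cst 0); first by rewrite Rintegral_cst_itv// mul0r.
  by apply/funext => x; rewrite /step_cov !big_nil subrr.
move=> /steps_in_cons[[r1 r12 r2] pT]; rewrite big_cons (IH pT).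
have cshift (c d : R) : mu.-integrable `[0, w] (EFin \o (fun x => fm (c + x - d))).
  apply: continuous_compact_integrable; first exact: segment_compact.
  apply: continuous_subspaceT => x.
  apply: (@cvg_comp _ _ _ (fun x => c + x - d) fm); last exact: cfm.
  apply: cvgB; last exact: cvg_cst.
  by apply: cvgD; [exact: cvg_cst|exact: cvg_id].
have cpt (c : R) : mu.-integrable `[r.2.1, r.2.2] (EFin \o (fun x => fm (c - x))).
  apply: continuous_compact_integrable; first exact: segment_compact.
  apply: continuous_subspaceT => x.
  apply: (@cvg_comp _ _ _ (fun x => c - x) fm); last exact: cfm.
  by apply: cvgB; [exact: cvg_cst|exact: cvg_id].
have cpt2 (c : R) : mu.-integrable `[r.2.1, r.2.2] (EFin \o (fun x => fm (c - x) - fm (c - w - x))).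
  have := @integrableB _ _ _ mu _ (measurable_itv _) _ _ (cpt c) (cpt (c - w)).
  by apply: eq_integrable => // x _; rewrite /= EFinB.
pose D c (x : R) := fm (c - w + x - r.2.1) - fm (c - w + x - r.2.2).
have iD c : mu.-integrable `[0, w] (EFin \o D c).
  have := @integrableB _ _ _ mu _ (measurable_itv _) _ _ (cshift (c - w) r.2.1) (cshift (c - w) r.2.2).
  by apply: eq_integrable => // x _; rewrite /= EFinB.
have ex c : \int[mu]_(x in `[r.2.1, r.2.2]) (fm (c - x) - fm (c - w - x)) =
    \int[mu]_(x in `[0, w]) D c x.
  transitivity (\int[mu]_(x in `[r.2.1, r.2.2]) (fm (c - w + w - x) - fm (c - w - x))).
    by apply: eq_Rintegral => x _; rewrite subrK.
  by symmetry; apply: integral_fbm_var_exchange.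
have -> : \int[mu]_(x in `[r.2.1, r.2.2]) q b a w x = \int[mu]_(x in `[0, w]) (D b x - D a x).
  transitivity (\int[mu]_(x in `[r.2.1, r.2.2]) (fm (b - x) - fm (b - w - x)) -
      \int[mu]_(x in `[r.2.1, r.2.2]) (fm (a - x) - fm (a - w - x))).
    by rewrite -RintegralB; [|exact: measurable_itv|exact: cpt2|exact: cpt2].
  by rewrite !ex RintegralB; [|exact: measurable_itv|exact: iD|exact: iD].
have iDD : mu.-integrable `[0, w] (EFin \o (fun x => D b x - D a x)).
  have := @integrableB _ _ _ mu _ (measurable_itv _) _ _ (iD b) (iD a).
  by apply: eq_integrable => // x _; rewrite /= EFinB.
have iDDr : mu.-integrable `[0, w] (EFin \o (fun x => r.1 * (D b x - D a x))).
  by have := @integrableZl _ _ _ mu _ (measurable_itv _) r.1 _ iDD.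
rewrite -RintegralZl; [|exact: measurable_itv|exact: iDD].
rewrite -RintegralD; [|exact: measurable_itv|exact: iDDr|exact: isd].
apply: eq_Rintegral => x _; rewrite /step_cov !big_cons /incr_cov /D; ring.
Qed.

(* The kernel of the covariance is singular on the diagonal, so the passage from
   step functions to g is made for averages over windows of length w. *)
Lemma kernel_weak_equation (s : nat -> seq (R * (R * R))) (E : R -> R) (C : R) :
  (forall n, steps_in T (s n)) ->
  (\int[mu]_(x in `[0%R, T]) ((step_fun (s n) x - g x) ^+ 2)%:E)%E @[n --> \oo] --> 0%E ->
  (forall y, 0 <= y <= T -> step_cov fm 0 y (s n) @[n --> \oo] --> E y) ->
  (forall n y, 0 <= y <= T -> `|step_cov fm 0 y (s n)| <= C) ->
  {within `[0, T], continuous E} ->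
  forall y, 0 <= y <= T -> E y = y - \int[mu]_(x in `[0, y]) g x.
Proof.
move=> sT sg sE sC cE.
have ig := mle_kernel_integrable.
have cfm : continuous fm by exact: continuous_fbm_var.
have mq a b w : measurable_fun `[0, T] (q b a w).
  have mc (c : R) : measurable_fun `[0, T] (fun r => fm (c - r)).
    apply: measurable_funTS; apply: measurableT_comp; first exact: measurable_fbm_var.
    exact: measurable_funB.
  by apply: measurable_funB; exact: measurable_funB.
have qB a b w x : 0 < w -> w < a <= T -> w < b <= T -> `[0, T]%classic x ->
    `|q b a w x| <= 4 * fm (2 * T).
  rewrite /= in_itv/= => w0 aT bT xT.
  have fB c : - T <= c <= T -> 0 <= fm (c - x) <= fm (2 * T).
    move=> cT; rewrite fbm_var_ge0/= fbm_var_le// ler_norml; lra.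
  have := fB b; have := fB a; have := fB (a - w); have := fB (b - w).
  rewrite /q ler_norml; lra.
have isf n : mu.-integrable `[0, T] (EFin \o step_fun (s n)).
  have := @integrable_step_funM _ T (s n) (cst 1) (integrable_cst_itv 0 T 1).
  by apply: eq_integrable => // x _; rewrite /= mulr1.
have iq a b w : mu.-integrable `[0, T] (EFin \o q b a w).
  have ic (c : R) : mu.-integrable `[0, T] (EFin \o (fun x => fm (c - x))).
    apply: continuous_compact_integrable; first exact: segment_compact.
    apply: continuous_subspaceT => x.
    apply: (@cvg_comp _ _ _ (fun x => c - x) fm); last exact: cfm.
    by apply: cvgB; [exact: cvg_cst|exact: cvg_id].
  have ic2 (c : R) : mu.-integrable `[0, T] (EFin \o (fun x => fm (c - x) - fm (c - w - x))).
    have := @integrableB _ _ _ mu _ (measurable_itv _) _ _ (ic c) (ic (c - w)).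
    by apply: eq_integrable => // x _; rewrite /= EFinB.
  have := @integrableB _ _ _ mu _ (measurable_itv _) _ _ (ic2 b) (ic2 a).
  by apply: eq_integrable => // x _; rewrite /= EFinB.
have L1 : (\int[mu]_(x in `[0%R, T]) (`|step_fun (s n) x - g x|)%:E)%E @[n --> \oo] --> 0%E.
  apply: L2_cvg_L1_cvg => //.
  - exact: lebesgue_measure_itvcc_fin.
  - by move=> n; apply: measurable_funTS; exact: measurable_step_fun.
  - exact: mle_kernel_measurable.
have E_itv c w : 0 < w -> w < c <= T ->
    mu.-integrable `[0, w] (EFin \o (fun x => E (c - w + x))).
  move=> w0 cT; apply: continuous_compact_integrable; first exact: segment_compact.
  by apply: (within_continuous_shift cE) => x; rewrite /= !in_itv/=; lra.
have F_itv c w : 0 < w -> w < c <= T ->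
    mu.-integrable `[0, w] (EFin \o (fun x => F (c - w + x))).
  move=> w0 cT; apply: continuous_compact_integrable; first exact: segment_compact.
  by apply: (within_continuous_shift F_continuous) => x; rewrite /= !in_itv/=; lra.
(* The window averages of the step covariances have two limits. The pointwise limit [E] gives one by
   bounded convergence; L^1 convergence of the steps to [g], tested against the bounded [q], gives
   the other. *)
have window a b w : 0 < w -> w < a <= T -> w < b <= T ->
    \int[mu]_(x in `[0, w]) (E (b - w + x) - E (a - w + x)) =
    \int[mu]_(x in `[0, w]) (F (b - w + x) - F (a - w + x)).
  move=> w0 aT bT; rewrite fubini_window//.
  have cv1 := @L1_cvg_integralM _ _ _ mu _ _ _ _ _ (measurable_itv _) isf ig L1 (mq a b w)
    (fun x xT => qB a b w x w0 aT bT xT).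
  have cv2 : \int[mu]_(x in `[0, w]) (step_cov fm 0 (b - w + x) (s n) -
      step_cov fm 0 (a - w + x) (s n)) @[n --> \oo] -->
      \int[mu]_(x in `[0, w]) (E (b - w + x) - E (a - w + x)).
    apply: (@Rintegral_bounded_cvg _ _ _ mu _ _ _ (2 * C)) => //.
    - exact: lebesgue_measure_itvcc_fin.
    - move=> n; apply: measurable_funTS; apply: continuous_measurable_fun => x.
      have cs c : (fun x => step_cov fm 0 (c - w + x) (s n)) @ x --> step_cov fm 0 (c - w + x) (s n).
        apply: (@cvg_comp _ _ _ (fun x => c - w + x) (fun y => step_cov fm 0 y (s n))).
          by apply: cvgD; [exact: cvg_cst|exact: cvg_id].
        exact: continuous_step_cov.
      by apply: cvgB; exact: cs.
    - have := @integrableB _ _ _ mu _ (measurable_itv _) _ _ (E_itv b w w0 bT) (E_itv a w w0 aT).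
      by apply: eq_integrable => // x _; rewrite /= EFinB.
    - move=> n x; rewrite /= in_itv/= => xw.
      have h1 : `|step_cov fm 0 (b - w + x) (s n)| <= C by apply: sC; lra.
      have h2 : `|step_cov fm 0 (a - w + x) (s n)| <= C by apply: sC; lra.
      by apply: (le_trans (ler_normB _ _)); lra.
    - move=> x; rewrite /= in_itv/= => xw.
      by apply: cvgB; apply: sE; lra.
  have cv3 : \int[mu]_(x in `[0, w]) (step_cov fm 0 (b - w + x) (s n) -
      step_cov fm 0 (a - w + x) (s n)) @[n --> \oo] -->
      \int[mu]_(r in `[0, T]) (g r * q b a w r).
    apply: cvg_trans cv1; apply: near_eq_cvg; apply: nearW => n.
    rewrite (@integral_step_funM _ T (s n) (q b a w) (sT n) (iq a b w)).
    by rewrite integral_step_window// ltW.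
  by apply: (cvg_unique _ cv2 cv3); exact: norm_hausdorff.
have EF a b : 0 < a <= T -> 0 < b <= T -> E b - E a = F b - F a.
  move=> aT bT.
  suff : F b - E b = F a - E a.
    by move: (F b) (F a) (E b) (E a) => ? ? ? ? ?; lra.
  pose K x := F x - E x; change (K b = K a).
  apply: (@eq_of_window_integrals _ K T) => //.
    have cE' : {within `]0, T], continuous E}.
      by apply: continuous_subspaceW cE; exact: subset_itv_oc_cc.
    by move=> x; apply: cvgB; [exact: F_continuous|exact: cE'].
  move=> w w0 wa wb.
  have aT' : w < a <= T by rewrite wa; case/andP: aT.
  have bT' : w < b <= T by rewrite wb; case/andP: bT.
  have iB f : mu.-integrable `[0, w] (EFin \o (fun x => f (b - w + x))) ->
      mu.-integrable `[0, w] (EFin \o (fun x => f (a - w + x))) ->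
      mu.-integrable `[0, w] (EFin \o (fun x : R => f (b - w + x) - f (a - w + x) : R)).
    move=> i1 i2; have := @integrableB _ _ _ mu _ (measurable_itv _) _ _ i1 i2.
    by apply: eq_integrable => // x _; rewrite /= EFinB.
  transitivity (\int[mu]_(x in `[0, w]) (F (b - w + x) - F (a - w + x)) -
      \int[mu]_(x in `[0, w]) (E (b - w + x) - E (a - w + x))).
    rewrite -RintegralB; last 3 first.
    - exact: measurable_itv.
    - by apply: iB; exact: F_itv.
    - by apply: iB; exact: E_itv.
    apply: eq_Rintegral => x _; rewrite /K.
    by move: (F _) (F _) (E _) (E _) => ? ? ? ?; ring.
  by rewrite window// subrr.
(* Here the pointwise equation is integrated: [F] has right slope 1 - g at every point of [a, b[,
   where g is only known to be integrable. *)
have Eab a b : 0 < a -> a < b <= T -> E b - E a = (b - a) - \int[mu]_(x in `[a, b]) g x.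
  move=> a0 /andP[ab bT].
  rewrite EF; [|lra|lra].
  have iab : mu.-integrable `[a, b] (EFin \o g).
    apply: integrableS ig => //; apply: subset_itv; rewrite bnd_simp//; exact: ltW.
  have i1 : mu.-integrable `[a, b] (EFin \o (fun x => 1 - g x)).
    have := @integrableB _ _ _ mu _ (measurable_itv _) _ _ (integrable_cst_itv a b 1) iab.
    by apply: eq_integrable => // x _; rewrite /= EFinB.
  rewrite -(FTC_everywhere_right_derivative ab i1); last 2 first.
  - apply: continuous_subspaceW F_continuous; apply: subset_itv; rewrite bnd_simp//.
  - by move=> x xab; apply: F_right_slope; lra.
  rewrite RintegralB; [|exact: measurable_itv|exact: integrable_cst_itv|exact: iab].
  by rewrite Rintegral_cst_itv ?(ltW ab)// mul1r.
(* The kernel equation says nothing at s = 0. The constant of integration comes from the vanishing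
   of step covariances there, after which a tends to 0 in [Eab]. *)
have E0 : E 0 = 0.
  have T00 : 0 <= (0 : R) <= T by rewrite lexx ltW.
  apply: (cvg_unique _ (sE 0 T00)); first exact: norm_hausdorff.
  apply: cvg_near_cst; apply: nearW => n; rewrite /step_cov big1// => r _.
  by rewrite /incr_cov addrK subrr mulr0.
move=> y /andP[]; rewrite le_eqVlt => /predU1P[<- _|y0 yT].
  by rewrite E0 set_itv1 Rintegral_set1 subrr.
have iy : mu.-integrable `[0, y] (EFin \o g).
  by apply: integrableS ig => //; apply: subset_itv; rewrite bnd_simp.
have cL : E a @[a --> 0^'+] --> (0 : R).
  by have /(continuous_within_itvP _ T0)[_ hr _] := cE; rewrite E0 in hr.
have cR : E y - (y - a) + \int[mu]_(x in `[0, y]) g x - \int[mu]_(x in `[0, a]) g x @[a --> 0^'+] -->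
    E y - (y - 0) + \int[mu]_(x in `[0, y]) g x - 0.
  apply: cvgB.
    apply: cvgD; last exact: cvg_cst.
    apply: cvgB; first exact: cvg_cst.
    apply: cvgB; first exact: cvg_cst.
    by apply: cvg_at_right_filter; exact: cvg_id.
  apply: cvg_at_right_filter.
  exact: (parameterized_integral_cvg_left y0 iy).
have : 0 = E y - (y - 0) + \int[mu]_(x in `[0, y]) g x - 0.
  apply: (cvg_unique _ cL); first exact: norm_hausdorff.
  apply: cvg_trans cR; apply: near_eq_cvg; near=> a.
  have a0 : 0 < a by near: a; exact: nbhs_right_gt.
  have ay : a < y by near: a; exact: nbhs_right_lt.
  have ayT : a < y <= T by rewrite ay.
  have := Eab a y a0 ayT.
  have <- : \int[mu]_(x in `[0, y]) g x - \int[mu]_(x in `[0, a]) g x = \int[mu]_(x in `[a, y]) g x.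
    rewrite (Rintegral_itvB iy) ?bnd_simp ?(ltW ay) ?(ltW a0)//.
    rewrite Rintegral_itv_obnd_cbnd//; apply: integrableS iy => //.
    by move=> z; rewrite /= !in_itv/= => /andP[az ->]; rewrite andbT (ltW (lt_trans a0 az)).
  lra.
lra.
Unshelve. all: by end_near. Qed.

End kernel.

(** * Beta integrals and the Riesz potential *)

Section tonelli_on_sets.
Local Open Scope ereal_scope.
Context {R : realType} {d1 d2 : measure_display}.
Context {T1 : measurableType d1} {T2 : measurableType d2}.
Variable m1 : {sigma_finite_measure set T1 -> \bar R}.
Variable m2 : {sigma_finite_measure set T2 -> \bar R}.

Lemma fubini_tonelli_on (D1 : set T1) (D2 : set T2) (f : T1 * T2 -> \bar R) :
  measurable D1 -> measurable D2 -> measurable_fun setT f -> (forall z, 0 <= f z) ->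
  \int[m1]_(x in D1) \int[m2]_(y in D2) f (x, y) =
  \int[m2]_(y in D2) \int[m1]_(x in D1) f (x, y).
Proof.
move=> mD1 mD2 mf f0; pose D := D1 `*` D2; pose g := f \_ D.
have mD : measurable D by exact: measurableX.
have mg : measurable_fun setT g.
  by apply/(measurable_restrictT _ mD); exact: measurable_funTS.
have g0 z : 0 <= g z.
  by rewrite /g patchE; case: ifPn.
have gE x y : g (x, y) = if x \in D1 then (if y \in D2 then f (x, y) else 0) else 0.
  rewrite /g patchE in_setX.
  by case: (x \in D1); case: (y \in D2).
transitivity (\int[m1]_x \int[m2]_y g (x, y)).
  rewrite integral_mkcond; apply: eq_integral => x _; rewrite patchE.
  under [RHS]eq_integral do rewrite gE.
  case: ifPn => xD; last by rewrite integral0_eq.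
  by rewrite [LHS]integral_mkcond; apply: eq_integral => y _; rewrite patchE.
rewrite (fubini_tonelli _ mg g0).
rewrite [RHS]integral_mkcond; apply: eq_integral => y _; rewrite patchE.
under eq_integral do rewrite gE.
case: ifPn => yD; last first.
  by rewrite integral0_eq// => x _; rewrite if_same.
rewrite [RHS]integral_mkcond; apply: eq_integral => x _; rewrite patchE.
by case: ifP.
Qed.

End tonelli_on_sets.

(** * Scaling and inversion on the half line *)

Section half_line.
Local Open Scope ereal_scope.
Context {R : realType}.
Notation mu := (@lebesgue_measure R).
Notation Rp := (`]0%R, +oo[%classic : set R).

Lemma lebesgue_tonelli (D1 D2 : set R) (f : R -> R -> \bar R) :
  measurable D1 -> measurable D2 ->
  measurable_fun setT (fun z : R * R => f z.1 z.2) -> (forall x y, 0 <= f x y) ->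
  \int[mu]_(x in D1) \int[mu]_(y in D2) f x y =
  \int[mu]_(y in D2) \int[mu]_(x in D1) f x y.
Proof.
move=> mD1 mD2 mf f0.
exact: (@fubini_tonelli_on _ _ _ _ _ mu mu D1 D2 (fun z : R * R => f z.1 z.2)).
Qed.

Lemma ge0_integral_scale (c : R) (f : R -> \bar R) : (0 < c)%R ->
  measurable_fun setT f -> (forall x, 0 <= f x) ->
  \int[mu]_(x in Rp) f x = c%:E * \int[mu]_(x in Rp) f (c * x)%R.
Proof.
move=> c0 mf f0; rewrite (@ge0_integral_affine _ c 0%R)//; last exact: measurable_funTS.
congr (_ * _); rewrite (_ : _ @^-1` _ = Rp).
  by apply: eq_integral => x _; rewrite addr0.
by apply/seteqP; split => x; rewrite /= !in_itv/= !andbT addr0 pmulr_rgt0.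
Qed.

(* The measure dx / x is invariant under scalings of the half line, hence, by
   the uniqueness of Haar measure (the two exchanges below), under x |-> 1/x. *)
Lemma ge0_integral_inv (f : R -> \bar R) :
  measurable_fun setT f -> (forall x, 0 <= f x) ->
  \int[mu]_(x in Rp) f x = \int[mu]_(x in Rp) (f (x `^ (-1))%R * (x `^ (-2))%:E).
Proof.
move=> mf f0.
have mRp : measurable Rp by [].
pose I (x : R) : \bar R := (\1_(`[1%R, 2%R]%classic : set R) x)%:E.
have mI : measurable_fun setT I by apply/measurable_EFinP; exact: measurable_indic.
have I0 x : 0 <= I x by rewrite lee_fin.
have mu12 : mu (`[1%R, 2%R]%classic : set R) = 1.
  by rewrite lebesgue_measure_itv/= lte_fin ltr1n -EFinB; congr (_%:E); ring.
have intI : \int[mu]_(w in Rp) I w = 1.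
  rewrite integral_indic// setIidl//.
  by move=> x; rewrite /= !in_itv/= => /andP[x1 _]; rewrite andbT (lt_le_trans _ x1).
pose p (r x : R) : \bar R := (x `^ r)%:E.
have mp r : measurable_fun setT (p r) by apply/measurable_EFinP; exact: measurable_powR.
have p0 r x : 0 <= p r x by rewrite lee_fin powR_ge0.
have inRp x : x \in Rp -> (0 < x)%R by rewrite inE/= in_itv/= andbT.
(* The inserted factor v times the integral over u of I (u v) equals 1, since [I] has integral 1.
   After the exchange, the substitutions v = w / u and then u = w t move the inversion onto f. *)
transitivity (\int[mu]_(v in Rp) \int[mu]_(u in Rp) (f v * p 1%R v * I (u * v)%R)).
  apply: eq_integral => v /inRp v0.
  rewrite ge0_integralZl//; last first.
  - by rewrite mule_ge0.
  - apply: measurable_funTS; apply: (measurableT_comp mI); exact: measurable_funM.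
  rewrite -muleA; under eq_integral do rewrite mulrC.
  by rewrite /p powRr1 ?(ltW v0)// -(ge0_integral_scale v0 mI I0) intI mule1.
rewrite (@lebesgue_tonelli _ _ (fun v u => f v * p 1%R v * I (u * v)%R))//; last 2 first.
- apply: emeasurable_funM; first by apply: emeasurable_funM; apply: measurableT_comp.
  by apply: (measurableT_comp mI); exact: measurable_funM.
- by move=> ? ?; rewrite !mule_ge0.
transitivity (\int[mu]_(u in Rp) \int[mu]_(w in Rp)
   (f (w * u `^ (-1))%R * (p 1%R w * I w * p (-2)%R u))).
  apply: eq_integral => u /inRp u0.
  rewrite /= (@ge0_integral_scale u^-1); last 3 first.
  - by rewrite invr_gt0.
  - apply: emeasurable_funM; first exact: emeasurable_funM.
    by apply: (measurableT_comp mI); exact: measurable_funM.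
  - by move=> x; rewrite !mule_ge0.
  rewrite -ge0_integralZl//; last 3 first.
  - apply: measurable_funTS; apply: emeasurable_funM; last first.
      by apply: (measurableT_comp mI); do 2 apply: measurable_funM => //.
    by apply: emeasurable_funM; [apply: (measurableT_comp mf)|apply: (measurableT_comp (mp _))]; exact: measurable_funM.
  - by move=> x _; rewrite !mule_ge0.
  - by rewrite lee_fin invr_ge0 ltW.
  apply: eq_integral => w /inRp w0.
  rewrite mulVKf ?gt_eqF// powR_inv1 ?(ltW u0)// (mulrC u^-1%R w).
  rewrite /p !powRr1 ?(ltW w0)// ?mulr_ge0 ?invr_ge0 ?(ltW u0) ?(ltW w0)//.
  move: (f _) => F; rewrite /I -!muleA (muleCA _ F) -!EFinM; congr (_ * _%:E).
  rewrite (_ : (-2)%R = (-1) + (-1))%R; last by ring.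
  rewrite powRD; last by rewrite (gt_eqF u0) implybT.
  by rewrite powR_inv1 ?(ltW u0)//; ring.
rewrite (@lebesgue_tonelli _ _ (fun u w => f (w * u `^ (-1))%R * (p 1%R w * I w * p (-2)%R u)))//; last 2 first.
- apply: emeasurable_funM.
    apply: (measurableT_comp mf); apply: measurable_funM => //.
    by apply: (measurableT_comp (measurable_powR _)).
  apply: emeasurable_funM; last exact: (measurableT_comp (mp _)).
  by apply: emeasurable_funM; apply: measurableT_comp.
- by move=> ? ?; rewrite !mule_ge0.
pose J := \int[mu]_(x in Rp) (f (x `^ (-1))%R * p (-2)%R x).
have mJ : measurable_fun setT (fun x => f (x `^ (-1))%R * p (-2)%R x).
  by apply: emeasurable_funM => //; apply: (measurableT_comp mf); exact: measurable_powR.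
transitivity (\int[mu]_(w in Rp) (I w * J)).
  apply: eq_integral => w /inRp w0 /=.
  rewrite (@ge0_integral_scale w)//; last 2 first.
  - apply: emeasurable_funM; last exact: emeasurable_funM.
    by apply: (measurableT_comp mf); apply: measurable_funM => //; exact: measurable_powR.
  - by move=> x; rewrite !mule_ge0.
  rewrite -ge0_integralZl//; last 3 first.
  - apply: measurable_funTS; apply: emeasurable_funM.
      apply: (measurableT_comp mf); apply: measurable_funM => //.
      by apply: (measurableT_comp (measurable_powR _)); exact: measurable_funM.
    apply: emeasurable_funM => //.
    by apply: (measurableT_comp (mp _)); exact: measurable_funM.
  - by move=> x _; rewrite !mule_ge0.
  - by rewrite lee_fin ltW.
  rewrite /J -ge0_integralZl//; [|exact: measurable_funTS|by move=> ? _; rewrite mule_ge0].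
  apply: eq_integral => t /inRp t0.
  rewrite /p !powRM ?(ltW w0) ?(ltW t0)// powRr1 ?(ltW w0)//.
  rewrite mulrA powR_inv1 ?(ltW w0)// divff ?gt_eqF// mul1r.
  move: (f _) => F; rewrite /I -!muleA (muleCA _ F) (muleCA _ F) -!EFinM; congr (_ * _%:E).
  rewrite (_ : (-2)%R = (-1) + (-1))%R; last by ring.
  rewrite powRD; last by rewrite (gt_eqF w0) implybT.
  by rewrite powR_inv1 ?(ltW w0)//; field; rewrite gt_eqF.
rewrite ge0_integralZr//; [by rewrite intI mul1e|exact: measurable_funTS|].
by apply: integral_ge0 => x _; rewrite mule_ge0.
Qed.

End half_line.

(** * Beta and Gamma integrals *)

Section beta_gamma.
Local Open Scope ereal_scope.
Context {R : realType}.
Notation mu := (@lebesgue_measure R).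
Notation Rp := (`]0%R, +oo[%classic : set R).

Lemma powR_expR (x p : R) : (0 < x)%R -> (x `^ p = expR (p * ln x))%R.
Proof. by move=> x0; rewrite /powR gt_eqF. Qed.

(** Extended values allow the Tonelli identities to be stated before any finiteness is known;
    finiteness is then deduced from them. *)
Definition betaE (x y : R) : \bar R :=
  \int[mu]_(t in `]0%R, 1%R[) (t `^ (x - 1) * (1 - t) `^ (y - 1))%:E.

Definition gammaE (x : R) : \bar R :=
  \int[mu]_(t in Rp) (t `^ (x - 1) * expR (- t))%:E.

Let mpw (p : R) : measurable_fun setT (fun x : R => (x `^ p)%R).
Proof. exact: measurable_powR. Qed.

Let intZl (D : set R) (k : \bar R) (f : R -> \bar R) : measurable D ->
  measurable_fun setT f -> (forall x, 0 <= f x) -> 0 <= k ->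
  \int[mu]_(x in D) (k * f x) = k * \int[mu]_(x in D) f x.
Proof. by move=> mD mf f0 k0; rewrite ge0_integralZl//; exact: measurable_funTS. Qed.

Let intZr (D : set R) (k : \bar R) (f : R -> \bar R) : measurable D ->
  measurable_fun setT f -> (forall x, 0 <= f x) -> 0 <= k ->
  \int[mu]_(x in D) (f x * k) = (\int[mu]_(x in D) f x) * k.
Proof. by move=> mD mf f0 k0; rewrite ge0_integralZr//; exact: measurable_funTS. Qed.

Let int_affine (c d : R) (D : set R) (f : R -> \bar R) : (0 < c)%R -> measurable D ->
  measurable_fun setT f -> (forall x, 0 <= f x) ->
  \int[mu]_(x in D) f x =
  c%:E * \int[mu]_(x in (fun x => c * x + d)%R @^-1` D) f (c * x + d)%R.
Proof. by move=> c0 mD mf f0; apply: ge0_integral_affine => //; exact: measurable_funTS. Qed.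

Let le_int (D1 D2 : set R) (f g : R -> \bar R) : measurable D1 -> measurable D2 ->
  measurable_fun setT f -> measurable_fun setT g ->
  (forall x, 0 <= f x) -> (forall x, 0 <= g x) -> D1 `<=` D2 ->
  (forall x, D1 x -> f x <= g x) ->
  \int[mu]_(x in D1) f x <= \int[mu]_(x in D2) g x.
Proof.
move=> mD1 mD2 mf mg f0 g0 D12 fg; apply: (@le_trans _ _ (\int[mu]_(x in D1) g x)).
  by apply: ge0_le_integral => //; exact: measurable_funTS.
by apply: ge0_subset_integral => //; exact: measurable_funTS.
Qed.

Let int_indic (D A : set R) (k : R -> R) :
  \int[mu]_(x in D) (\1_A x * k x)%:E = \int[mu]_(x in D `&` A) (k x)%:E.
Proof.
rewrite [LHS]integral_mkcond [RHS]integral_mkcond; apply: eq_integral => x _.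
rewrite !patchE in_setI indicE; case: (x \in D); case: (x \in A) => //=.
  by rewrite mul1r.
by rewrite mul0r.
Qed.

Lemma betaE_ge0 x y : 0 <= betaE x y.
Proof. by apply: integral_ge0 => t _; rewrite lee_fin mulr_ge0// powR_ge0. Qed.

Lemma gammaE_ge0 x : 0 <= gammaE x.
Proof. by apply: integral_ge0 => t _; rewrite lee_fin mulr_ge0// ?powR_ge0 ?expR_ge0. Qed.

Lemma betaE_segment (x y v w : R) : (v < w)%R ->
  \int[mu]_(s in `]v, w[) ((s - v) `^ (x - 1) * (w - s) `^ (y - 1))%:E =
  ((w - v) `^ (x + y - 1))%:E * betaE x y.
Proof.
move=> vw; have c0 : (0 < w - v)%R by rewrite subr_gt0.
have mF (q r : R) : measurable_fun setT
    (fun s : R => ((s - q) `^ (x - 1) * (r - s) `^ (y - 1))%:E : \bar R).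
  apply/measurable_EFinP; apply: measurable_funM.
    by apply: (measurableT_comp (mpw _)); exact: measurable_funB.
  by apply: (measurableT_comp (mpw _)); exact: measurable_funB.
have F0 (q r s : R) : 0 <= ((s - q) `^ (x - 1) * (r - s) `^ (y - 1))%:E :> \bar R.
  by rewrite lee_fin mulr_ge0// powR_ge0.
rewrite (int_affine v c0 (measurable_itv _) (mF v w) (F0 v w)).
have maff : measurable_fun setT (fun t : R => ((w - v) * t + v)%R).
  by apply: measurable_funD => //; exact: measurable_funM.
have mpre : measurable ((fun t : R => ((w - v) * t + v)%R) @^-1` `]v, w[).
  by rewrite -[X in measurable X]setTI; apply: maff => //; exact: measurable_itv.
have c0' : 0 <= (w - v)%:E by rewrite lee_fin ltW.
rewrite -(intZl mpre (measurableT_comp (mF v w) maff) (fun t => F0 v w _) c0').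
have bE : betaE x y = \int[mu]_(t in `]0%R, 1%R[) ((t - 0) `^ (x - 1) * (1 - t) `^ (y - 1))%:E.
  by apply: eq_integral => t _; rewrite subr0.
have k0 : 0 <= ((w - v) `^ (x + y - 1))%:E by rewrite lee_fin powR_ge0.
rewrite bE -(intZl (measurable_itv _) (mF 0%R 1%R) (F0 0%R 1%R) k0) {mF F0 bE k0}.
rewrite (_ : _ @^-1` _ = `]0%R, 1%R[%classic); last first.
  apply/seteqP; split => t; rewrite /= !in_itv/= ltrDr pmulr_rgt0// -ltrBrDr.
    by rewrite gtr_pMr.
  by rewrite gtr_pMr.
apply: eq_integral => t; rewrite inE/= in_itv/= => /andP[t0 t1].
have t1' : (0 < 1 - t)%R by rewrite subr_gt0.
rewrite -!EFinM; congr (_%:E).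
rewrite addrK subr0 (_ : w - ((w - v) * t + v) = (w - v) * (1 - t))%R; last by ring.
rewrite !powR_expR ?mulr_gt0// !lnM ?posrE//.
rewrite -[X in (X * _ = _)%R]lnK ?posrE// -!expRD; congr expR.
by ring.
Qed.

Let ind (x : R) : R := \1_(Rp) x.

Let mind : measurable_fun setT ind.
Proof. exact: measurable_indic. Qed.

Let ind0 x : (0 <= ind x)%R. Proof. by []. Qed.

Let indE x : (ind x = (0 < x)%R%:R)%R.
Proof. by rewrite /ind indicE/= mem_setE in_itv/= andbT. Qed.

(** With w = s + t the exponentials combine to exp (- w), and the remaining integral over s in ]0,
    w[ is a Beta integral on a segment. *)
Lemma gammaE_mul x y : gammaE x * gammaE y = gammaE (x + y) * betaE x y.
Proof.
have mexp : measurable_fun setT (fun t : R => expR (- t)).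
  by apply: measurableT_comp => //; exact: measurable_expR.
have mg p : measurable_fun setT (fun t : R => (t `^ (p - 1) * expR (- t))%:E).
  by apply/measurable_EFinP; apply: measurable_funM.
have g0 (p t : R) : 0 <= (t `^ (p - 1) * expR (- t))%:E.
  by rewrite lee_fin mulr_ge0// ?powR_ge0 ?expR_ge0.
have inRp t : t \in Rp -> (0 < t)%R by rewrite inE/= in_itv/= andbT.
pose F (s w : R) : \bar R :=
  (s `^ (x - 1) * (ind (w - s) * ((w - s) `^ (y - 1) * expR (- w))))%:E.
have mF : measurable_fun setT (fun z : R * R => F z.1 z.2).
  apply/measurable_EFinP; apply: measurable_funM.
    exact: (measurableT_comp (mpw _)).
  have mB : measurable_fun setT (fun z : R * R => z.2 - z.1)%R.
    exact: measurable_funB.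
  apply: measurable_funM; first exact: (measurableT_comp mind).
  apply: measurable_funM; first exact: (measurableT_comp (mpw _)).
  exact: (measurableT_comp mexp).
have F0 s w : 0 <= F s w.
  by rewrite lee_fin !mulr_ge0// ?powR_ge0 ?expR_ge0.
transitivity (\int[mu]_(s in Rp) \int[mu]_(w in Rp) F s w).
  rewrite {1}/gammaE -intZr//; last exact: gammaE_ge0.
  apply: eq_integral => s /inRp s0.
  rewrite /gammaE -intZl// (@int_affine 1%R (- s)%R)//; last 2 first.
  - exact: emeasurable_funM.
  - by move=> t; rewrite mule_ge0.
  rewrite (_ : _ @^-1` _ = `]s, +oo[%classic); last first.
    by apply/seteqP; split => w; rewrite /= !in_itv/= !andbT mul1r subr_gt0.
  rewrite mul1e [LHS]integral_mkcond [RHS]integral_mkcond.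
  apply: eq_integral => w _; rewrite !patchE !mem_setE !in_itv/= !andbT mul1r.
  rewrite /F indE subr_gt0.
  have [sw|ws] := ltP s w; last by rewrite mul0r mulr0 if_same.
  rewrite (lt_trans s0 sw) mul1r -EFinM; congr (_%:E).
  rewrite opprB expRD expRN; field.
  by rewrite gt_eqF// expR_gt0.
rewrite lebesgue_tonelli//.
rewrite {1}/gammaE -intZr//; last exact: betaE_ge0.
apply: eq_integral => w /inRp w0.
rewrite EFinM -muleA (muleC (expR _)%:E) muleA.
have := betaE_segment x y w0; rewrite subr0 => <-.
rewrite -intZr//; last 2 first.
- apply/measurable_EFinP; apply: measurable_funM.
    by apply: (measurableT_comp (mpw _)); exact: measurable_funB.
  by apply: (measurableT_comp (mpw _)); exact: measurable_funB.
- by move=> s; rewrite lee_fin mulr_ge0// powR_ge0.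
rewrite [LHS]integral_mkcond [RHS]integral_mkcond; apply: eq_integral => s _.
rewrite !patchE !mem_setE /= !in_itv/= andbT /F indE subr_gt0 subr0.
case: (ltP 0%R s) => //= s0; case: (ltP s w) => sw.
  by rewrite mul1r mulrA EFinM.
by rewrite mul0r mulr0.
Qed.

Lemma integral_expRN : \int[mu]_(t in Rp) (expR (- t))%:E = 1.
Proof.
have := @integral_exponential_pdf R 1 ltr01.
rewrite (_ : (fun x => _) = (EFin \o (fun t => expR (- t))) \_ `[0%R, +oo[); last first.
  apply/funext => t; rewrite patchE /exponential_pdf patchE.
  by case: ifP => // _; rewrite mul1r mulN1r.
rewrite -integral_mkcond -[RHS]/(1) => <-.
rewrite integral_itv_obnd_cbnd//.
apply: measurable_funTS; apply/measurable_EFinP.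
by apply: measurableT_comp => //; exact: measurable_expR.
Qed.

(** The integrand is at most t^(x - 1) on ]0, 1], and beyond 1 at most t exp (- t) <= 2 exp (- t /
    2). All arguments of [Gamma] below lie in ]0, 2]. *)
Lemma gammaE_lty x : (0 < x <= 2)%R -> gammaE x < +oo.
Proof.
move=> /andP[x0 x2].
have mexp : measurable_fun setT (fun t : R => expR (- t)).
  by apply: measurableT_comp => //; exact: measurable_expR.
pose f (t : R) : \bar R := (\1_(`]0%R, 1%R]%classic : set R) t * `|t| `^ (x - 1))%:E.
pose h (t : R) : \bar R := (2 * expR (- (2^-1 * t)))%:E.
have mf : measurable_fun setT f.
  apply/measurable_EFinP; apply: measurable_funM; first exact: measurable_indic.
  exact: measurable_norm_powR.
have mh : measurable_fun setT h.
  apply/measurable_EFinP; apply: measurable_funM => //.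
  by apply: (measurableT_comp mexp); exact: measurable_funM.
have f0 t : 0 <= f t by rewrite lee_fin mulr_ge0// powR_ge0.
have h0 t : 0 <= h t by rewrite lee_fin mulr_ge0// expR_ge0.
apply: (@le_lt_trans _ _ (\int[mu]_(t in Rp) (f t + h t))).
  apply: ge0_le_integral => //.
  - by move=> t _; rewrite lee_fin mulr_ge0// ?powR_ge0 ?expR_ge0.
  - by apply: measurable_funTS; apply/measurable_EFinP; exact: measurable_funM.
  - by apply: measurable_funTS; exact: emeasurable_funD.
  move=> t; rewrite /= in_itv/= andbT => t0; rewrite /f /h indicE mem_setE in_itv/= t0 (gtr0_norm t0)/=.
  have [t1|t1] := leP t 1%R.
    rewrite mul1r -EFinD lee_fin ler_wpDr// ?mulr_ge0 ?expR_ge0//.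
    rewrite ler_piMr ?powR_ge0// -expR0 ler_expR lerNl oppr0; exact: ltW.
  rewrite mul0r add0e lee_fin.
  have E : expR (- t) = (expR (- (2^-1 * t)) * expR (- (2^-1 * t)))%R.
    by rewrite -expRD; congr expR; field.
  rewrite E mulrA ler_wpM2r ?expR_ge0//.
  apply: (@le_trans _ _ (t * expR (- (2^-1 * t)))%R).
    rewrite ler_wpM2r ?expR_ge0// -[leRHS]powRr1 ?(ltW t0)//.
    rewrite ler_powR ?(ltW t1)//; lra.
  rewrite expRN ler_pdivrMr ?expR_gt0//.
  have := expR_ge1Dx (2^-1 * t)%R; lra.
rewrite ge0_integralD//; [|exact: measurable_funTS|exact: measurable_funTS].
apply: lte_add_pinfty.
  have /integrableP[_] := integrable_norm_powR 0 1 x0; apply: le_lt_trans.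
  rewrite /f int_indic; apply: le_int => //.
  - exact: measurableI.
  - by apply/measurable_EFinP; exact: measurable_norm_powR.
  - apply/measurable_EFinP; apply: measurableT_comp; first exact: normr_measurable.
    exact: measurable_norm_powR.
  - by move=> t [_]/=; rewrite !in_itv/= => /andP[/ltW -> ->].
  - by move=> t _; rewrite lee_fin ler_norm.
rewrite /h; under eq_integral do rewrite EFinM.
rewrite intZl//; last first.
  by apply/measurable_EFinP; apply: (measurableT_comp mexp); exact: measurable_funM.
have := @ge0_integral_scale _ 2^-1 (fun t : R => (expR (- t))%:E).
rewrite integral_expRN => H.
have {}H : 1 = (2^-1)%:E * \int[mu]_(t in Rp) (expR (- (2^-1 * t)))%:E.
  by apply: H => //; exact/measurable_EFinP.
have -> : \int[mu]_(t in Rp) (expR (- (2^-1 * t)))%:E = 2%:E.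
  transitivity (2%:E * ((2^-1)%:E * \int[mu]_(t in Rp) (expR (- (2^-1 * t)))%:E)).
    by rewrite muleA -EFinM divff ?mul1e.
  by rewrite -H mule1.
by rewrite -EFinM ltry.
Qed.

Lemma gammaE_gt0 x : (0 < x <= 2)%R -> 0 < gammaE x.
Proof.
move=> /andP[x0 x2].
have c0 : 0 < (2^-1 * expR (-1) * 2^-1 : R)%:E.
  by rewrite lte_fin !mulr_gt0// expR_gt0.
apply: (lt_le_trans c0).
have -> : (2^-1 * expR (-1) * 2^-1 : R)%:E =
    \int[mu]_(t in `]2^-1%R, 1%R[) (cst (2^-1 * expR (-1))%:E) t.
  rewrite integral_cst//= lebesgue_measure_itv/= lte_fin invf_lt1// ltr1n.
  by rewrite -EFinB -EFinM; congr (_%:E); field.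
apply: le_int => //.
- apply/measurable_EFinP; apply: measurable_funM => //.
  by apply: measurableT_comp => //; exact: measurable_expR.
- by move=> t; rewrite lee_fin mulr_ge0// expR_ge0.
- by move=> t; rewrite lee_fin mulr_ge0// ?powR_ge0 ?expR_ge0.
- by move=> t; rewrite /= !in_itv/= => /andP[t2 _]; rewrite andbT (lt_trans _ t2)// invr_gt0.
move=> t; rewrite /= in_itv/= => /andP[t2 t1].
have t0 : (0 < t)%R by rewrite (lt_trans _ t2)// invr_gt0.
rewrite lee_fin ler_pM ?expR_ge0 ?invr_ge0//.
  apply: (le_trans (ltW t2)); rewrite -[leLHS]powRr1 ?(ltW t0)//.
  rewrite ger_powR ?t0 ?(ltW t1)//; lra.
by rewrite ler_expR lerN2 ltW.
Qed.

Let inRp t : t \in Rp -> (0 < t)%R.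
Proof. by rewrite inE/= in_itv/= andbT. Qed.

(** The substitution v = 1 / (y + 1/r), which carries ]0, +oo[ onto ]0, r[. *)
Lemma ge0_integral_inv_shift (r : R) (F : R -> \bar R) : (0 < r)%R ->
  measurable_fun setT F -> (forall x, 0 <= F x) ->
  \int[mu]_(v in `]0%R, r[) F v =
  \int[mu]_(y in Rp) (F ((y + r^-1) `^ (-1))%R * ((y + r^-1) `^ (-2))%:E).
Proof.
move=> r0 mF F0; pose G v : \bar R := (ind (r - v))%:E * F v.
have mG : measurable_fun setT G.
  apply: emeasurable_funM => //; apply/measurable_EFinP.
  by apply: (measurableT_comp mind); exact: measurable_funB.
have G0 v : 0 <= G v by rewrite mule_ge0// lee_fin ind0.
transitivity (\int[mu]_(v in Rp) G v).
  rewrite [LHS]integral_mkcond [RHS]integral_mkcond; apply: eq_integral => v _.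
  rewrite !patchE !mem_setE !in_itv/= andbT /G indE subr_gt0.
  by case: (ltP 0%R v) => //= v0; case: ifP; rewrite ?mul1e ?mul0e.
rewrite (ge0_integral_inv mG G0).
have mH : measurable_fun setT (fun x : R => F (x `^ (-1))%R * (x `^ (-2))%:E).
  apply: emeasurable_funM; last by apply/measurable_EFinP; exact: mpw.
  exact: (measurableT_comp mF (mpw _)).
have H0 (x : R) : 0 <= F (x `^ (-1))%R * (x `^ (-2))%:E.
  by rewrite mule_ge0// lee_fin powR_ge0.
have vr (v : R) : (0 < v)%R -> (v `^ (-1) < r)%R = (r^-1 < v)%R.
  move=> v0; rewrite powR_inv1 ?(ltW v0)// -[in LHS](invrK r).
  by rewrite ltf_pV2 ?posrE ?invr_gt0.
transitivity (\int[mu]_(x in `]r^-1%R, +oo[) (F (x `^ (-1))%R * (x `^ (-2))%:E)).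
  rewrite [LHS]integral_mkcond [RHS]integral_mkcond; apply: eq_integral => v _.
  rewrite !patchE !mem_setE !in_itv/= !andbT /G indE subr_gt0.
  have [v0|v0] := ltP 0%R v; last first.
    have ri0 : (0 <= r^-1)%R by rewrite invr_ge0 ltW.
    by rewrite ltNge (le_trans v0 ri0).
  by rewrite (vr _ v0); case: ifP; rewrite ?mul1e ?mul0e.
have E := @int_affine 1%R r^-1%R _ _ ltr01 (measurable_itv `]r^-1%R, +oo[) mH H0.
rewrite mul1e in E.
rewrite E (_ : _ @^-1` _ = Rp); first by apply: eq_integral => x _; rewrite mul1r.
by apply/seteqP; split => x; rewrite /= !in_itv/= !andbT mul1r ltrDr.
Qed.

Lemma betaE_half_line (x y : R) :
  betaE x y = \int[mu]_(t in Rp) (t `^ (y - 1) * (t + 1) `^ (- (x + y)))%:E.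
Proof.
have mB : measurable_fun setT (fun t : R => (t `^ (x - 1) * (1 - t) `^ (y - 1))%:E).
  apply/measurable_EFinP; apply: measurable_funM => //.
  by apply: (measurableT_comp (mpw _)); exact: measurable_funB.
have B0 (t : R) : 0 <= (t `^ (x - 1) * (1 - t) `^ (y - 1))%:E.
  by rewrite lee_fin mulr_ge0// powR_ge0.
rewrite /betaE (ge0_integral_inv_shift ltr01 mB B0).
apply: eq_integral => t /inRp t0; rewrite invr1 -EFinM; congr (_%:E).
have t10 : (0 < t + 1)%R by rewrite addr_gt0.
have i0 : (0 < (t + 1)^-1)%R by rewrite invr_gt0.
rewrite powR_inv1 ?(ltW t10)// (_ : 1 - (t + 1)^-1 = t * (t + 1)^-1)%R; last first.
  by field; rewrite gt_eqF.
rewrite !powR_expR ?mulr_gt0// lnM ?posrE// lnV ?posrE// -!expRD; congr expR.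
ring.
Qed.

(** * The Riesz potential of a Beta density is constant *)

Section riesz.
Variable a : R.
Hypothesis a01 : (0 < a < 2^-1)%R.

Let K := betaE (1 - 2 * a) a.

Let gamma_bnd (x : R) : (0 < x <= 2)%R -> (0 < gammaE x) /\ (gammaE x \is a fin_num).
Proof. by move=> x02; rewrite ge0_fin_numE ?gammaE_ge0// gammaE_gt0// gammaE_lty. Qed.

(** K is a quotient of finite positive Gamma values by [gammaE_mul]. This allows K to be cancelled
    at the end of [riesz_potential]. *)
Let K_bnd : (0 < K) /\ K \is a fin_num.
Proof.
have /andP[a0 a1] := a01.
have g1 : (0 < 1 - 2 * a <= 2)%R by lra.
have g2 : (0 < a <= 2)%R by lra.
have g3 : (0 < 1 - a <= 2)%R by lra.
have := gammaE_mul (1 - 2 * a) a.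
have -> : (1 - 2 * a + a = 1 - a)%R by ring.
have [p1 f1] := gamma_bnd g1; have [p2 f2] := gamma_bnd g2; have [p3 f3] := gamma_bnd g3.
rewrite -/K => E.
have K0 : 0 < K.
  rewrite lt_neqAle betaE_ge0 andbT; apply/eqP => K0.
  by have := mule_gt0 p1 p2; rewrite E -K0 mule0 ltxx.
split=> //; rewrite fin_numE; apply/andP; split.
  by apply/eqP => KN; move: K0; rewrite KN.
apply/eqP => KP; move: E; rewrite KP gt0_muley// => E.
by have := fin_numM f1 f2; rewrite E.
Qed.

(* Factorizing |s - r|^(2a - 1) as a product of fractional kernels makes the
   double integral of riesz_potential separate. *)
Lemma riesz_kernel_factor (r s : R) : (0 < r)%R -> (r < s)%R ->
  \int[mu]_(v in `]0%R, r[)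
    (v `^ (- (2 * a)) * ((r - v) `^ (a - 1) * (s - v) `^ (a - 1)))%:E =
  ((r * s) `^ (- a) * (s - r) `^ (2 * a - 1))%:E * K.
Proof.
move=> r0 rs; have s0 := lt_trans r0 rs.
(* This is 1/r - 1/s. Under v = 1 / x with x = y + 1/r, the factors r - v and s - v become r y / x
   and s (y + dl) / x, and the weight v^(- 2a) makes all powers of x cancel. *)
have [dl dlE] : exists dl : R, dl = ((s - r) / (r * s))%R by eexists.
have sr0 : (0 < s - r)%R by rewrite subr_gt0.
have dl0 : (0 < dl)%R by rewrite dlE divr_gt0// mulr_gt0.
rewrite ge0_integral_inv_shift//; last 2 first.
- apply/measurable_EFinP; apply: measurable_funM => //.
  by apply: measurable_funM; apply: (measurableT_comp (mpw _)); exact: measurable_funB.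
- by move=> v; rewrite lee_fin !mulr_ge0// powR_ge0.
pose f (y : R) : \bar R := (y `^ (a - 1) * (y + dl) `^ (a - 1))%:E.
have mf : measurable_fun setT f.
  apply/measurable_EFinP; apply: measurable_funM => //.
  by apply: (measurableT_comp (mpw _)); exact: measurable_funD.
have f0 y : 0 <= f y by rewrite lee_fin !mulr_ge0// powR_ge0.
have k0 : 0 <= ((r * s) `^ (a - 1))%:E by rewrite lee_fin powR_ge0.
transitivity (\int[mu]_(y in Rp) (((r * s) `^ (a - 1))%:E * f y)).
  apply: eq_integral => y /inRp y0; rewrite -!EFinM; congr (_%:E).
  pose x := (y + r^-1)%R.
  have x0 : (0 < x)%R by rewrite addr_gt0// invr_gt0.
  have i0 : (0 < x^-1)%R by rewrite invr_gt0.
  have yd0 : (0 < y + dl)%R by rewrite addr_gt0.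
  rewrite -/x powR_inv1 ?(ltW x0)//.
  have -> : (r - x^-1 = r * y * x^-1)%R by rewrite /x; field; rewrite !gt_eqF//=; rewrite addr_gt0// mulr_gt0.
  have -> : (s - x^-1 = s * (y + dl) * x^-1)%R.
    by rewrite /x dlE; field; rewrite !gt_eqF//=; rewrite addr_gt0// mulr_gt0.
  rewrite !powR_expR ?mulr_gt0// !lnM ?posrE ?mulr_gt0// lnV ?posrE// -!expRD; congr expR.
  ring.
rewrite (intZl (measurable_itv _) mf f0 k0).
rewrite (ge0_integral_scale dl0 mf f0).
have e0 : 0 <= (dl `^ (2 * a - 2))%:E by rewrite lee_fin powR_ge0.
pose h (t : R) : \bar R := (t `^ (a - 1) * (t + 1) `^ (- ((1 - 2 * a) + a)))%:E.
have mh : measurable_fun setT h.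
  apply/measurable_EFinP; apply: measurable_funM => //.
  by apply: (measurableT_comp (mpw _)); exact: measurable_funD.
have h0 y : 0 <= h y by rewrite lee_fin !mulr_ge0// powR_ge0.
(* Setting y = dl t takes dl out and leaves the Beta integral in its half-line form. *)
transitivity (((r * s) `^ (a - 1))%:E * (dl%:E * \int[mu]_(t in Rp) ((dl `^ (2 * a - 2))%:E * h t))).
  congr (_ * (_ * _)); apply: eq_integral => t /inRp t0; rewrite /f /h -EFinM; congr (_%:E).
  have t10 : (0 < t + 1)%R by rewrite addr_gt0.
  rewrite (_ : dl * t + dl = dl * (t + 1))%R; last by ring.
  rewrite !powR_expR ?mulr_gt0// !lnM ?posrE// -!expRD; congr expR.
  ring.
rewrite (intZl (measurable_itv _) mh h0 e0) -betaE_half_line -/K !muleA -!EFinM.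
congr (_%:E * _).
have rs0 : (0 < r * s)%R by rewrite mulr_gt0.
have lndl : (ln dl = ln (s - r) - ln (r * s))%R by rewrite dlE ln_div ?posrE.
rewrite -{1}[dl]lnK ?posrE// !powR_expR// lndl -!expRD; congr expR.
ring.
Qed.

(** Multiply by K, replace the Riesz kernel by its factorization and integrate first in r: the
    integral of (r - v)^(a - 1) (1 - r)^(- a) over ]v, 1[ is B(a, 1 - a) whatever v. What is left in
    v is s^(- a) K, and the prefactor s^a makes the result independent of s. *)
Lemma riesz_potential (s : R) : (0 < s < 1)%R ->
  \int[mu]_(r in `]0%R, 1%R[) (r `^ (- a) * (1 - r) `^ (- a) * `|s - r| `^ (2 * a - 1))%:E =
  betaE a (1 - a).
Proof.
move=> /andP[s0 s1].
have [K0 Kfin] := K_bnd.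
pose D : set R := `]0%R, 1%R[%classic `\ s.
have mD : measurable D by apply: measurableD.
have D01 r : r \in D -> (0 < r < 1)%R /\ r != s.
  by rewrite inE => -[/= + /eqP]; rewrite in_itv.
have toD (f : R -> \bar R) : measurable_fun setT f -> (forall x, 0 <= f x) ->
    \int[mu]_(r in `]0%R, 1%R[) f r = \int[mu]_(r in D) f r.
  move=> mf f0; apply: ge0_negligible_integral => //; first exact: measurable_funTS.
  exact: lebesgue_measure_set1.
pose L (r : R) : \bar R := (r `^ (- a) * (1 - r) `^ (- a) * `|s - r| `^ (2 * a - 1))%:E.
have mpB (c p : R) : measurable_fun setT (fun r : R => ((c - r) `^ p)%R).
  by apply: (measurableT_comp (mpw _)); exact: measurable_funB.
have mL : measurable_fun setT L.
  apply/measurable_EFinP; apply: measurable_funM; first exact: measurable_funM.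
  apply: (measurableT_comp (mpw _)); apply: measurableT_comp; first exact: normr_measurable.
  exact: measurable_funB.
have L0 r : 0 <= L r by rewrite lee_fin !mulr_ge0// powR_ge0.
suff : (\int[mu]_(r in `]0%R, 1%R[) L r) * K = betaE a (1 - a) * K.
  have iK : K * ((fine K)^-1)%:E = 1.
    rewrite -{1}(fineK Kfin) -EFinM divff// gt_eqF//.
    by apply: fine_gt0; rewrite K0 ltey_eq Kfin.
  by move=> E; rewrite -[LHS]mule1 -iK muleA E -muleA iK mule1.
pose q (v : R) : R := (ind (s - v) * (v `^ (- (2 * a)) * (s - v) `^ (a - 1)))%R.
have mq : measurable_fun setT q.
  apply: measurable_funM; last exact: measurable_funM.
  by apply: (measurableT_comp mind); exact: measurable_funB.
have q0 v : (0 <= q v)%R by rewrite !mulr_ge0// powR_ge0.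
pose k (v r : R) : R := (ind (r - v) * ((r - v) `^ (a - 1) * (1 - r) `^ ((1 - a) - 1)))%R.
have mk : measurable_fun setT (fun z : R * R => k z.2 z.1).
  have mB : measurable_fun setT (fun z : R * R => z.1 - z.2)%R by exact: measurable_funB.
  apply: measurable_funM; first exact: (measurableT_comp mind).
  apply: measurable_funM; first exact: (measurableT_comp (mpw _)).
  exact: (measurableT_comp (mpB _ _)).
have k0 v r : (0 <= k v r)%R by rewrite !mulr_ge0// powR_ge0.
have mkv v : measurable_fun setT (fun r => (k v r)%:E : \bar R).
  apply/measurable_EFinP; apply: measurable_funM.
    by apply: (measurableT_comp mind); exact: measurable_funB.
  apply: measurable_funM => //.
  by apply: (measurableT_comp (mpw _)); exact: measurable_funB.
rewrite (toD _ mL L0) -(intZr mD mL L0 (ltW K0)).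
pose F (r v : R) : \bar R := (s `^ a * (q v * k v r))%:E.
have mF : measurable_fun setT (fun z : R * R => F z.1 z.2).
  apply/measurable_EFinP; apply: measurable_funM => //; apply: measurable_funM => //.
  exact: (measurableT_comp mq).
have F0 r v : 0 <= F r v by rewrite lee_fin !mulr_ge0// powR_ge0.
transitivity (\int[mu]_(r in D) \int[mu]_(v in `]0%R, 1%R[) F r v).
  apply: eq_integral => r /D01[/andP[r0 r1] rs].
  have r1' : (0 < 1 - r)%R by rewrite subr_gt0.
  pose G (c d : R) (v : R) : \bar R :=
    (v `^ (- (2 * a)) * ((c - v) `^ (a - 1) * (d - v) `^ (a - 1)))%:E.
  have mG c d : measurable_fun setT (G c d).
    by apply/measurable_EFinP; apply: measurable_funM => //; exact: measurable_funM.
  have G0 c d v : 0 <= G c d v by rewrite lee_fin !mulr_ge0// powR_ge0.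
  have c0 : 0 <= (s `^ a * (1 - r) `^ (- a))%:E by rewrite lee_fin mulr_ge0// powR_ge0.
  (* The factorization is proved for ordered arguments, so m and M are the minimum and the maximum
     of r and s. They are distinct because [D] omits the point s. *)
  have [m [M [m0 m1 mM [mME MmE mlt GE]]]] : exists m M : R,
      [/\ (0 < m)%R, (m < 1)%R, (m < M)%R &
      [/\ (m * M = r * s)%R, (M - m = `|s - r|)%R,
       forall v, (v < m)%R = (v < s)%R && (v < r)%R &
       forall v, G m M v = G r s v]].
    move: rs; rewrite neq_lt => /orP[rs|sr].
      exists r, s; split=> //; split=> //; first by rewrite gtr0_norm// subr_gt0.
      by move=> v; case: (ltP v r) => vr; rewrite ?andbF// (lt_trans vr rs).
    exists s, r; split=> //; split=> //; first exact: mulrC.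
    - by rewrite ltr0_norm ?subr_lt0// opprB.
    - by move=> v; case: (ltP v s) => //= vs; rewrite (lt_trans vs sr).
    - by move=> v; rewrite /G; congr (_%:E); ring.
  transitivity (\int[mu]_(v in `]0%R, m[) ((s `^ a * (1 - r) `^ (- a))%:E * G m M v)); last first.
    rewrite [LHS]integral_mkcond [RHS]integral_mkcond; apply: eq_integral => v _.
    rewrite !patchE !mem_setE !in_itv/= /F /q /k !indE !subr_gt0.
    case: (ltP 0%R v) => //= v0.
    rewrite mlt; case: (ltP v s) => vs; last by rewrite !mul0r mulr0 if_same.
    case: (ltP v r) => vr /=; last by rewrite mul0r !mulr0 if_same.
    rewrite (lt_trans vs s1) !mul1r GE -EFinM; congr (_%:E).
    by rewrite (_ : 1 - a - 1 = - a)%R; [ring|ring].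
  rewrite (intZl (measurable_itv _) (mG m M) (G0 m M) c0).
  rewrite (riesz_kernel_factor m0 mM) muleA -EFinM; congr (_%:E * _); rewrite mME MmE.
  have -> : ((r * s) `^ (- a) = r `^ (- a) * s `^ (- a))%R by rewrite powRM ?ltW.
  have : (s `^ a * s `^ (- a) = 1)%R.
    by rewrite -powRD ?subrr ?powRr0// (gt_eqF s0) implybT.
  by move: (s `^ a)%R (s `^ (- a))%R => x y xy; rewrite -[LHS]mul1r -xy; ring.
rewrite lebesgue_tonelli//.
have bfin : 0 <= betaE a (1 - a) by exact: betaE_ge0.
have sa0 : 0 <= (s `^ a)%:E by rewrite lee_fin powR_ge0.
transitivity (\int[mu]_(v in `]0%R, 1%R[) ((s `^ a)%:E * ((q v)%:E * betaE a (1 - a)))).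
  apply: eq_integral => v; rewrite inE/= in_itv/= => /andP[v0 v1].
  have qv0 : 0 <= (s `^ a * q v)%:E by rewrite lee_fin mulr_ge0// powR_ge0.
  transitivity (\int[mu]_(r in D) ((s `^ a * q v)%:E * (k v r)%:E)).
    by apply: eq_integral => r _; rewrite /F -EFinM mulrA.
  have k0' r : 0 <= (k v r)%:E by rewrite lee_fin.
  rewrite (intZl mD (mkv v) k0' qv0) EFinM -muleA; congr (_ * (_ * _)).
  rewrite -(toD _ (mkv v) k0').
  have := betaE_segment a (1 - a) v1.
  have -> : (a + (1 - a) - 1 = 0)%R by ring.
  rewrite powRr0 mul1e => <-.
  rewrite [LHS]integral_mkcond [RHS]integral_mkcond; apply: eq_integral => r _.
  rewrite !patchE !mem_setE !in_itv/= /k indE subr_gt0.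
  case: (ltP v r) => vr; last by rewrite mul0r if_same.
  by rewrite (lt_trans v0 vr) mul1r.
have mqE : measurable_fun setT (fun v => (q v)%:E : \bar R) by exact/measurable_EFinP.
have q0E v : 0 <= (q v)%:E by rewrite lee_fin.
rewrite (intZl _ _ _ sa0)//; last 2 first.
- by apply: emeasurable_funM.
- by move=> v; rewrite mule_ge0.
rewrite (intZr _ mqE q0E bfin)//.
have -> : \int[mu]_(v in `]0%R, 1%R[) (q v)%:E = (s `^ (- a))%:E * K.
  have := betaE_segment (1 - 2 * a) a s0.
  have -> : (1 - 2 * a + a - 1 = - a)%R by ring.
  rewrite subr0 -/K => <-.
  rewrite [LHS]integral_mkcond [RHS]integral_mkcond; apply: eq_integral => v _.
  rewrite !patchE !mem_setE !in_itv/= /q indE subr_gt0 subr0.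
  have -> : (1 - 2 * a - 1 = - (2 * a))%R by ring.
  case: (ltP v s) => vs; last by rewrite mul0r !andbF if_same.
  by rewrite (lt_trans vs s1) mul1r.
rewrite !muleA -EFinM -powRD; last by rewrite (gt_eqF s0) implybT.
by rewrite subrr powRr0 mul1e muleC.
Qed.

End riesz.

End beta_gamma.

(** * The equilibrium density *)

Section gamma_values.
Context {R : realType}.
Notation mu := (@lebesgue_measure R).

Lemma Gamma_gammaE (x : R) : 0 < x <= 2 -> (Gamma x)%:E = gammaE x.
Proof.
move=> x02; rewrite /Gamma /Rintegral fineK//.
by rewrite ge0_fin_numE ?gammaE_lty ?gammaE_ge0.
Qed.

Lemma Gamma_gt0 (x : R) : 0 < x <= 2 -> 0 < Gamma x.
Proof. by move=> x02; rewrite -lte_fin Gamma_gammaE// gammaE_gt0. Qed.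

Lemma Gamma1 : Gamma (1 : R) = 1.
Proof.
rewrite /Gamma /Rintegral.
have -> : (\int[mu]_(x in `]0%R, +oo[) (x `^ (1 - 1) * expR (- x))%:E)%E = 1%E :> \bar R.
  by rewrite -integral_expRN; apply: eq_integral => t _; rewrite subrr powRr0 mul1r.
by [].
Qed.

Lemma betaE_Gamma (x y : R) : 0 < x <= 2 -> 0 < y <= 2 -> 0 < x + y <= 2 ->
  betaE x y = (Gamma x * Gamma y / Gamma (x + y))%:E.
Proof.
move=> x02 y02 xy02; have := gammaE_mul x y.
rewrite -!Gamma_gammaE// -EFinM => E.
have g0 := Gamma_gt0 xy02.
have : ((Gamma (x + y))^-1%:E * ((Gamma (x + y))%:E * betaE x y) = betaE x y)%E.
  by rewrite muleA -EFinM mulVf ?mul1e// gt_eqF.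
by rewrite -E -EFinM mulrC => <-.
Qed.

(** Read off B(a, 1) = 1 / a, which is an elementary power integral. *)
Lemma Gamma_add1 (a : R) : 0 < a <= 1 -> Gamma (a + 1) = a * Gamma a.
Proof.
move=> a01; have a02 : 0 < a <= 2 by lra.
have o02 : 0 < (1 : R) <= 2 by lra.
have a12 : 0 < a + 1 <= 2 by lra.
have a0 : 0 < a by lra.
have := betaE_Gamma a02 o02 a12.
have -> : betaE a 1 = (a^-1)%:E.
  have := @integral_norm_powR _ a 0 1 a0 ler01.
  rewrite normr1 powR1 normr0 powR0 ?gt_eqF// mulr0 mulr0 subr0 sgr1 !mulr1 => <-.
  rewrite EFin_Rintegral//; last exact: integrable_norm_powR.
  rewrite /betaE integral_itv_obnd_cbnd; last first.
    apply: measurable_funTS; apply/measurable_EFinP; apply: measurable_funM.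
      exact: measurable_powR.
    apply: (measurableT_comp (measurable_powR _)); exact: measurable_funB.
  rewrite integral_itv_bndo_bndc; last first.
    apply: measurable_funTS; apply/measurable_EFinP; apply: measurable_funM.
      exact: measurable_powR.
    apply: (measurableT_comp (measurable_powR _)); exact: measurable_funB.
  apply: eq_integral => t; rewrite inE/= in_itv/= => /andP[t0 _].
  by rewrite subrr powRr0 mulr1 ger0_norm.
have ga0 := Gamma_gt0 a02; have ga1 := Gamma_gt0 a12.
rewrite Gamma1 mulr1 => -[] E.
have : a^-1 * Gamma (a + 1) = Gamma a by rewrite E divfK// gt_eqF.
by move=> <-; rewrite mulrA divff ?mul1r// gt_eqF.
Qed.

End gamma_values.

Section parameter_integral.
Context {R : realType}.
Notation mu := (@lebesgue_measure R).

Lemma measurable_parameter_integral (D : set R) (f : R -> R -> \bar R) :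
  measurable D -> measurable_fun setT (fun z : R * R => f z.1 z.2) ->
  (forall x y, (0 <= f x y)%E) ->
  measurable_fun setT (fun y => \int[mu]_(x in D) f x y)%E.
Proof.
move=> mD mf f0.
pose g (z : R * R) : \bar R := ((\1_D z.1)%:E * f z.1 z.2)%E.
have mg : measurable_fun setT g.
  apply: emeasurable_funM => //; apply/measurable_EFinP.
  by apply: measurableT_comp.
have g0 z : (0 <= g z)%E by rewrite mule_ge0// lee_fin.
have := @measurable_fun_fubini_tonelli_G _ _ _ _ R mu g mg g0.
apply: eq_measurable_fun => y _; rewrite /fubini_G [RHS]integral_mkcond.
apply: eq_integral => x _; rewrite /g patchE indicE.
by case: ifP; rewrite ?mul1e ?mul0e.
Qed.

End parameter_integral.

Section equilibrium.
Context {R : realType}.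
Notation mu := (@lebesgue_measure R).
Variable H : R.
Hypothesis H12 : 2^-1 < H < 1.

Let a := H - 2^-1.
Let a0 : 0 < a. Proof. by rewrite /a; case/andP: H12 => *; lra. Qed.
Let a12 : a < 2^-1. Proof. by rewrite /a; case/andP: H12 => *; lra. Qed.
Let H0 : 0 < H. Proof. by case/andP: H12 => *; lra. Qed.

(* The density on [0, 1] whose potential for the kernel of the fractional Brownian
   motion is constant. *)
Definition equilibrium (r : R) : R := r `^ (2^-1 - H) * (1 - r) `^ (2^-1 - H).

(** The constant potential for the kernel H (2H - 1) |s - r|^(2H - 2). With a = H - 1/2 it arises as
    2 a H B(a, 1 - a), where a Gamma(a) is absorbed into Gamma(a + 1). *)
Definition equilibrium_const : R := 2 * H * Gamma (H + 2^-1) * Gamma (3 / 2 - H).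

(** The Beta value B(3/2 - H, 3/2 - H). The quotient [equilibrium_const / equilibrium_mass] is the
    limiting variance before the factor of the delta method. *)
Definition equilibrium_mass : R := Gamma (3 / 2 - H) ^+ 2 / Gamma (3 - 2 * H).

Lemma equilibrium_const_gt0 : 0 < equilibrium_const.
Proof.
rewrite /equilibrium_const !mulr_gt0// Gamma_gt0//; move: H12; lra.
Qed.

Lemma equilibrium_ge0 r : 0 <= equilibrium r.
Proof. by rewrite mulr_ge0// powR_ge0. Qed.

Lemma measurable_equilibrium : measurable_fun setT equilibrium.
Proof.
apply: measurable_funM; first exact: measurable_powR.
by apply: (measurableT_comp (measurable_powR _)); exact: measurable_funB.
Qed.

Lemma integral_equilibrium :
  (\int[mu]_(r in `]0%R, 1%R[) (equilibrium r)%:E)%E = equilibrium_mass%:E.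
Proof.
have h1 : 0 < 3 / 2 - H <= 2 by move: H12; lra.
have h2 : 0 < 3 / 2 - H + (3 / 2 - H) <= 2 by move: H12; lra.
have := betaE_Gamma h1 h1 h2.
rewrite (_ : 3 / 2 - H + (3 / 2 - H) = 3 - 2 * H); last by field.
rewrite -expr2 -/equilibrium_mass => <-.
apply: eq_integral => r _; rewrite /equilibrium (_ : 3 / 2 - H - 1 = 2^-1 - H)//.
by field.
Qed.

Lemma fbm_dvar_incrE (b1 b2 r : R) : b1 <= b2 ->
  ((fbm_dvar H (b2 - r) - fbm_dvar H (b1 - r))%:E =
   \int[mu]_(s in `[b1, b2]) (2 * a * H * `|s - r| `^ (2 * a - 1))%:E)%E.
Proof.
move=> b12; have p0 : 0 < 2 * a by rewrite mulr_gt0.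
have b12' : b1 - r <= b2 - r by rewrite lerD2r.
have k0 : 0 <= 2 * a * H by rewrite !mulr_ge0// ltW.
have mf : measurable_fun setT (fun s : R => (2 * a * H * `|s - r| `^ (2 * a - 1))%:E).
  apply/measurable_EFinP; apply: measurable_funM => //.
  apply: (measurableT_comp (measurable_powR _)); apply: measurableT_comp; first exact: normr_measurable.
  exact: measurable_funB.
have f0 (s : R) : (0 <= (2 * a * H * `|s - r| `^ (2 * a - 1))%:E)%E.
  by rewrite lee_fin mulr_ge0// powR_ge0.
rewrite (@ge0_integral_affine _ 1 r _ _ ltr01 (measurable_itv `[b1, b2]) (measurable_funTS mf))//.
rewrite mul1e (_ : _ @^-1` _ = `[b1 - r, b2 - r]%classic); last first.
  by apply/seteqP; split => s; rewrite /= !in_itv/= mul1r lerBlDr lerBrDr.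
transitivity ((2 * a * H)%:E * \int[mu]_(s in `[(b1 - r)%R, (b2 - r)%R]) (`|s| `^ (2 * a - 1))%:E)%E.
  rewrite -(EFin_Rintegral (integrable_norm_powR _ _ p0) (measurable_itv _)).
  rewrite (integral_norm_powR p0 b12') -EFinM; congr (_%:E).
  rewrite /fbm_dvar (_ : 2 * H - 1 = 2 * a); last by rewrite /a; field.
  by field; rewrite gt_eqF.
have mn : measurable_fun `[b1 - r, b2 - r] (fun s : R => (`|s| `^ (2 * a - 1))%:E).
  by apply: measurable_funTS; apply/measurable_EFinP; exact: measurable_norm_powR.
have n0 (s : R) : `[b1 - r, b2 - r]%classic s -> (0 <= (`|s| `^ (2 * a - 1))%:E)%E.
  by move=> _; rewrite lee_fin powR_ge0.
have k0E : (0 <= (2 * a * H)%:E)%E by rewrite lee_fin.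
rewrite -ge0_integralZl; [|exact: measurable_itv|exact: mn|exact: n0|exact: k0E].
by apply: eq_integral => s _; rewrite mul1r addrK EFinM.
Qed.

Lemma fbm_dvar_incr_ge0 (b1 b2 r : R) : b1 <= b2 ->
  0 <= fbm_dvar H (b2 - r) - fbm_dvar H (b1 - r).
Proof.
move=> b12; rewrite -lee_fin fbm_dvar_incrE//; apply: integral_ge0 => s _.
by rewrite lee_fin mulr_ge0 ?powR_ge0// !mulr_ge0// ltW.
Qed.

Lemma equilibrium_identity01 (b1 b2 : R) : 0 <= b1 -> b1 <= b2 -> b2 <= 1 ->
  (\int[mu]_(r in `]0%R, 1%R[)
    (equilibrium r * (fbm_dvar H (b2 - r) - fbm_dvar H (b1 - r)))%:E =
  (equilibrium_const * (b2 - b1))%:E)%E.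
Proof.
move=> b10 b12 b21.
pose F (r s : R) : \bar R := (equilibrium r * (2 * a * H * `|s - r| `^ (2 * a - 1)))%:E.
have k0 : 0 <= 2 * a * H by rewrite !mulr_ge0// ltW.
have mF : measurable_fun setT (fun z : R * R => F z.1 z.2).
  apply/measurable_EFinP; apply: measurable_funM.
    exact: (measurableT_comp measurable_equilibrium).
  apply: measurable_funM => //.
  apply: (measurableT_comp (measurable_norm_powR _)); exact: measurable_funB.
have F0 r s : (0 <= F r s)%E.
  by rewrite lee_fin mulr_ge0 ?equilibrium_ge0// mulr_ge0// powR_ge0.
transitivity (\int[mu]_(r in `]0%R, 1%R[) \int[mu]_(s in `[b1, b2]) F r s)%E.
  apply: eq_integral => r _; rewrite EFinM fbm_dvar_incrE//.
  rewrite -ge0_integralZl//; last 3 first.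
  - apply: measurable_funTS; apply/measurable_EFinP; apply: measurable_funM => //.
    apply: (measurableT_comp (measurable_norm_powR _)); exact: measurable_funB.
  - by move=> s _; rewrite lee_fin mulr_ge0// powR_ge0.
  - by rewrite lee_fin equilibrium_ge0.
rewrite lebesgue_tonelli//.
have mI : measurable_fun setT (fun s : R => \int[mu]_(r in `]0%R, 1%R[) F r s)%E.
  exact: measurable_parameter_integral.
rewrite -integral_itv_obnd_cbnd; last exact: measurable_funTS.
rewrite -integral_itv_bndo_bndc; last exact: measurable_funTS.
transitivity (\int[mu]_(s in `]b1, b2[) (cst equilibrium_const%:E s))%E.
  apply: eq_integral => s; rewrite inE/= in_itv/= => /andP[b1s sb2].
  have s01 : 0 < s < 1 by rewrite (le_lt_trans b10 b1s) (lt_le_trans sb2 b21).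
  have a012 : 0 < a < 2^-1 by rewrite a0 a12.
  have := riesz_potential a012 s01.
  have x1 : 0 < a <= 2 by move: a012; lra.
  have x2 : 0 < 1 - a <= 2 by move: a012; lra.
  have x3 : 0 < a + (1 - a) <= 2 by lra.
  rewrite (betaE_Gamma x1 x2 x3) (_ : a + (1 - a) = 1); last by ring.
  rewrite Gamma1 divr1 => E.
  transitivity ((2 * a * H)%:E * \int[mu]_(r in `]0%R, 1%R[)
    (r `^ (- a) * (1 - r) `^ (- a) * `|s - r| `^ (2 * a - 1))%:E)%E.
    rewrite -ge0_integralZl//; last 2 first.
    - apply: measurable_funTS; apply/measurable_EFinP; apply: measurable_funM.
        apply: measurable_funM; first exact: measurable_powR.
        by apply: (measurableT_comp (measurable_powR _)); exact: measurable_funB.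
      by apply: (measurableT_comp (measurable_norm_powR _)); exact: measurable_funB.
    - by move=> r _; rewrite lee_fin !mulr_ge0// powR_ge0.
    apply: eq_integral => r _; rewrite /F /equilibrium -EFinM.
    by rewrite (_ : 2^-1 - H = - a) ?opprB//; congr (_%:E); ring.
  rewrite E /= -EFinM; congr (_%:E).
  rewrite /equilibrium_const (_ : H + 2^-1 = a + 1); last by rewrite /a; field.
  rewrite (_ : 3 / 2 - H = 1 - a); last by rewrite /a; field.
  rewrite Gamma_add1; last by move: a012; lra.
  by ring.
rewrite integral_cst//= lebesgue_measure_itv/=.
move: b12; rewrite le_eqVlt lte_fin => /predU1P[->|b12].
  by rewrite ltxx mule0 subrr mulr0.
by rewrite b12 -EFinB -EFinM.
Qed.

Lemma fbm_dvar_scale (T x : R) : 0 < T -> fbm_dvar H (T * x) = T `^ (2 * H - 1) * fbm_dvar H x.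
Proof.
move=> T0; rewrite /fbm_dvar sgrM gtr0_sg// mul1r normrM gtr0_norm// powRM ?(ltW T0)//.
by ring.
Qed.

(** The density is rescaled to [0, T]. Homogeneity of [fbm_dvar] of degree 2H - 1 produces the power
    of T; the factors T from dx and 1/T from the length b2 - b1 cancel. *)
Lemma equilibrium_identity (T b1 b2 : R) : 0 < T -> 0 <= b1 -> b1 <= b2 -> b2 <= T ->
  (\int[mu]_(x in `]0%R, T[)
    (equilibrium (T^-1 * x) * (fbm_dvar H (b2 - x) - fbm_dvar H (b1 - x)))%:E =
  (equilibrium_const * T `^ (2 * H - 1) * (b2 - b1))%:E)%E.
Proof.
move=> T0 b10 b12 b2T.
have mk (c : R) : measurable_fun setT (fun x : R => fbm_dvar H (c - x)).
  by apply: (measurableT_comp (measurable_fbm_dvar H)); exact: measurable_funB.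
have mf : measurable_fun setT (fun x : R =>
    (equilibrium (T^-1 * x) * (fbm_dvar H (b2 - x) - fbm_dvar H (b1 - x)))%:E).
  apply/measurable_EFinP; apply: measurable_funM; last exact: measurable_funB.
  by apply: (measurableT_comp measurable_equilibrium); exact: measurable_funM.
have f0 (x : R) : (0 <= (equilibrium (T^-1 * x) *
    (fbm_dvar H (b2 - x) - fbm_dvar H (b1 - x)))%:E)%E.
  by rewrite lee_fin mulr_ge0 ?equilibrium_ge0// fbm_dvar_incr_ge0.
rewrite (@ge0_integral_affine _ T 0 _ _ T0 (measurable_itv `]0, T[) (measurable_funTS mf))//.
rewrite (_ : _ @^-1` _ = `]0, 1[%classic); last first.
  apply/seteqP; split => x; rewrite /= !in_itv/= addr0 pmulr_rgt0//.
    by rewrite gtr_pMr.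
  by rewrite gtr_pMr.
have c10 : 0 <= b1 / T by rewrite divr_ge0// ltW.
have c12 : b1 / T <= b2 / T by rewrite ler_pM2r ?invr_gt0.
have c21 : b2 / T <= 1 by rewrite ler_pdivrMr// mul1r.
transitivity (T%:E * \int[mu]_(r in `]0%R, 1%R[) ((T `^ (2 * H - 1))%:E *
   (equilibrium r * (fbm_dvar H (b2 / T - r) - fbm_dvar H (b1 / T - r)))%:E))%E.
  congr (_ * _)%E; apply: eq_integral => r _; rewrite addr0 mulKf ?gt_eqF// -EFinM.
  have E c : c - T * r = T * (c / T - r) by field; rewrite gt_eqF.
  by rewrite !E !fbm_dvar_scale//; congr (_%:E); ring.
rewrite ge0_integralZl//; last 3 first.
- apply: measurable_funTS; apply/measurable_EFinP; apply: measurable_funM.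
    exact: measurable_equilibrium.
  by apply: measurable_funB; exact: mk.
- by move=> r _; rewrite lee_fin mulr_ge0 ?equilibrium_ge0// fbm_dvar_incr_ge0.
- by rewrite lee_fin powR_ge0.
rewrite equilibrium_identity01// -!EFinM; congr (_%:E).
by field; rewrite gt_eqF.
Qed.

Lemma integral_equilibrium_scale (T : R) : 0 < T ->
  (\int[mu]_(x in `]0%R, T[) (equilibrium (T^-1 * x))%:E = (T * equilibrium_mass)%:E)%E.
Proof.
move=> T0.
have mf : measurable_fun setT (fun x : R => (equilibrium (T^-1 * x))%:E).
  by apply/measurable_EFinP; apply: (measurableT_comp measurable_equilibrium); exact: measurable_funM.
have f0 (x : R) : (0 <= (equilibrium (T^-1 * x))%:E)%E by rewrite lee_fin equilibrium_ge0.
rewrite (@ge0_integral_affine _ T 0 _ _ T0 (measurable_itv `]0, T[) (measurable_funTS mf))//.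
rewrite (_ : _ @^-1` _ = `]0, 1[%classic); last first.
  by apply/seteqP; split => x; rewrite /= !in_itv/= addr0 pmulr_rgt0// gtr_pMr.
rewrite EFinM -integral_equilibrium; congr (_ * _)%E.
by apply: eq_integral => r _; rewrite addr0 mulKf ?gt_eqF.
Qed.

(** A lower bound of [equilibrium] on the cell ]i/(m+1), (i+1)/(m+1)]: each factor is taken at the
    end of the cell where it is smallest, so the singularities at 0 and 1 are never evaluated. *)
Definition equilibrium_low (m i : nat) : R :=
  (i.+1%:R / m.+1%:R) `^ (2^-1 - H) * (1 - i%:R / m.+1%:R) `^ (2^-1 - H).

Definition equilibrium_steps (T : R) (m : nat) : seq (R * (R * R)) :=
  [seq (equilibrium_low m i, (T * (i%:R / m.+1%:R), T * (i.+1%:R / m.+1%:R))) | i <- iota 0 m.+1].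

Lemma equilibrium_steps_in T m : 0 < T -> steps_in T (equilibrium_steps T m).
Proof.
move=> T0 q /mapP[i]; rewrite mem_iota add0n => /andP[_ im] ->; split => /=.
- by rewrite mulr_ge0 ?(ltW T0)// divr_ge0.
- by rewrite ler_pM2l// ler_pM2r ?invr_gt0// ler_nat.
- by rewrite -[leRHS]mulr1 ler_pM2l// ler_pdivrMr// mul1r ler_nat.
Qed.

Lemma equilibrium_low_ge0 m i : 0 <= equilibrium_low m i.
Proof. by rewrite mulr_ge0// powR_ge0. Qed.

Lemma equilibrium_steps_coef_ge0 T m q : q \in equilibrium_steps T m -> 0 <= q.1.
Proof. by move=> /mapP[i _ ->]; exact: equilibrium_low_ge0. Qed.

(* The value at T r of the m-th step function, for r in ]i/(m+1), (i+1)/(m+1)]. *)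
Lemma step_fun_equilibrium_steps T m (r : R) (i : nat) : 0 < T -> (i < m.+1)%N ->
  i%:R < r * m.+1%:R <= i.+1%:R ->
  step_fun (equilibrium_steps T m) (T * r) = equilibrium_low m i.
Proof.
move=> T0 im ri; rewrite /step_fun big_map.
have -> : \sum_(j <- iota 0 m.+1) equilibrium_low m j *
    \1_(`]T * (j%:R / m.+1%:R), T * (j.+1%:R / m.+1%:R)] : set R) (T * r) =
    \sum_(j <- iota 0 m.+1) if j == i then equilibrium_low m i else 0.
  apply: eq_bigr => j _; rewrite indicE mem_setE in_itv/= ltr_pM2l// ler_pM2l//.
  rewrite ltr_pdivrMr// ler_pdivlMr//.
  case: eqVneq => [->|ji]; first by rewrite ri mulr1.
  suff -> : (j%:R < r * m.+1%:R <= j.+1%:R) = false by rewrite mulr0.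
  apply/negP => rj; move/andP: ri => [ri1 ri2]; move/andP: rj => [rj1 rj2].
  have : (i%:R : R) < j.+1%:R by exact: lt_le_trans ri1 rj2.
  have : (j%:R : R) < i.+1%:R by exact: lt_le_trans rj1 ri2.
  rewrite !ltr_nat !ltnS => h1 h2; move: ji; rewrite eqn_leq h1 h2 //.
rewrite (big_rem i) ?mem_iota// eqxx big1_seq; first exact: addr0.
by move=> j /andP[_]; rewrite mem_rem_uniq ?iota_uniq// inE => /andP[/negbTE ->].
Qed.

Lemma equilibrium_low_le (m i : nat) (r : R) : (i < m.+1)%N -> 0 < r < 1 ->
  i%:R < r * m.+1%:R <= i.+1%:R -> equilibrium_low m i <= equilibrium r.
Proof.
move=> im /andP[r0 r1] /andP[h1 h2].
have P (x y : R) : 0 < x -> x <= y -> y `^ (2^-1 - H) <= x `^ (2^-1 - H).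
  move=> x0 xy; have y0 := lt_le_trans x0 xy.
  rewrite !powR_expR// ler_expR ler_wnM2l ?ler_ln ?posrE//.
  by move: a0; rewrite /a; lra.
rewrite /equilibrium_low /equilibrium ler_pM ?powR_ge0//; apply: P => //.
- by rewrite ler_pdivlMr.
- by rewrite subr_gt0.
- by rewrite lerB// ler_pdivrMr// ltW.
Qed.

Let index_cell (m : nat) (r : R) : 0 < r < 1 ->
  exists2 i : nat, (i < m.+1)%N & i%:R < r * m.+1%:R <= i.+1%:R.
Proof.
move=> /andP[r0 r1].
have rm0 : 0 < r * m.+1%:R by rewrite mulr_gt0.
have ex : exists n : nat, r * m.+1%:R <= n%:R by exists m.+1; rewrite ger_pMl// ltW.
have [n rn nmin] := ex_minnP ex.
have n0 : (0 < n)%N.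
  by rewrite lt0n; apply/eqP => n0; move: rn; rewrite n0 leNgt rm0.
exists n.-1; first by rewrite prednK// nmin// ger_pMl// ltW.
rewrite prednK// rn andbT ltNge; apply/negP => /nmin.
by rewrite leqNgt prednK// leqnn.
Qed.

Lemma equilibrium_steps_ge0 T m x : 0 < T -> 0 < x < T -> 0 <= step_fun (equilibrium_steps T m) x.
Proof.
move=> T0 _; rewrite /step_fun big_map sumr_ge0// => i _.
by rewrite mulr_ge0// equilibrium_low_ge0.
Qed.

Let scale01 (T x : R) : 0 < T -> 0 < x < T -> 0 < T^-1 * x < 1.
Proof.
by move=> T0 /andP[x0 xT]; rewrite mulr_gt0 ?invr_gt0//= mulrC ltr_pdivrMr// mul1r.
Qed.

Lemma equilibrium_steps_le T m x : 0 < T -> 0 < x < T ->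
  step_fun (equilibrium_steps T m) x <= equilibrium (T^-1 * x).
Proof.
move=> T0 xT; have r01 := scale01 T0 xT.
have [i im ri] := index_cell m r01.
rewrite -{1}[x](mulVKf (lt0r_neq0 T0)) (step_fun_equilibrium_steps T0 im ri).
exact: equilibrium_low_le.
Qed.

Lemma equilibrium_steps_cvg T x : 0 < T -> 0 < x < T ->
  step_fun (equilibrium_steps T m) x @[m --> \oo] --> equilibrium (T^-1 * x).
Proof.
move=> T0 xT; have r01 := scale01 T0 xT; set r := T^-1 * x in r01 *.
have [r0 r1] := andP r01.
pose i m := projT1 (cid2 (index_cell m r01)).
have im m : (i m < m.+1)%N by rewrite /i; case: cid2.
have ri m : (i m)%:R < r * m.+1%:R <= (i m).+1%:R by rewrite /i; case: cid2.
have -> : (fun m => step_fun (equilibrium_steps T m) x) = (fun m => equilibrium_low m (i m)).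
  apply/funext => m; rewrite -{1}[x](mulVKf (lt0r_neq0 T0)).
  exact: step_fun_equilibrium_steps.
have cvgn : m.+1%:R^-1 @[m --> \oo] --> (0 : R) by exact: cvg_harmonic.
have c1 : (i m)%:R / m.+1%:R @[m --> \oo] --> r.
  apply: (@squeeze_cvgr _ _ _ _ (fun m : nat => r - m.+1%:R^-1) (cst r)).
  - apply: nearW => m /=; have /andP[h1 h2] := ri m.
    have m0 : 0 < (m.+1%:R : R) by [].
    rewrite ler_pdivrMr// ler_pdivlMr// (ltW h1) andbT.
    by rewrite mulrBl mulVf ?gt_eqF// lerBlDr natr1.
  - by rewrite -[X in _ --> X]subr0; apply: cvgB => //; exact: cvg_cst.
  - exact: cvg_cst.
have c2 : (i m).+1%:R / m.+1%:R @[m --> \oo] --> r.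
  rewrite -[X in _ --> X]addr0.
  rewrite (_ : (fun m => _) = (fun m => (i m)%:R / m.+1%:R + m.+1%:R^-1)); first exact: cvgD.
  by apply/funext => m; rewrite -natr1 mulrDl mul1r.
have P (u : nat -> R) (l : R) : 0 < l -> u m @[m --> \oo] --> l ->
    u m `^ (2^-1 - H) @[m --> \oo] --> l `^ (2^-1 - H).
  move=> l0 ul; apply: (@cvg_comp _ _ _ u (fun y : R => y `^ (2^-1 - H)) _ _ _ ul).
  have [dv _] := is_derive1_powR (2^-1 - H) l0.
  by have /derivable1_diffP/differentiable_continuous := dv.
apply: cvgM; first exact: P.
apply: (P (fun m => 1 - (i m)%:R / m.+1%:R)); first by rewrite subr_gt0.
by apply: cvgB => //; exact: cvg_cst.
Qed.

End equilibrium.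

Section step_mass.
Context {R : realType}.
Notation mu := (@lebesgue_measure R).

Definition step_mass (p : seq (R * (R * R))) : R := \sum_(q <- p) q.1 * (q.2.2 - q.2.1).

Lemma integral_step_fun (T : R) (p : seq (R * (R * R))) : steps_in T p ->
  \int[mu]_(x in `[0, T]) step_fun p x = step_mass p.
Proof.
move=> pT; transitivity (\int[mu]_(x in `[0, T]) (step_fun p x * (cst 1 x))).
  by apply: eq_Rintegral => x _; rewrite mulr1.
rewrite (integral_step_funM pT); last exact: integrable_cst_itv.
rewrite /step_mass !big_seq; apply: eq_bigr => q /pT[_ q12 _].
by rewrite Rintegral_cst_itv// mul1r.
Qed.

Lemma integrable_step_fun (T : R) (p : seq (R * (R * R))) :
  mu.-integrable `[0, T] (EFin \o step_fun p).
Proof.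
have := @integrable_step_funM _ T p (cst 1) (integrable_cst_itv 0 T 1).
by apply: eq_integrable => // x _; rewrite /= mulr1.
Qed.

End step_mass.

(** * Step functions below the equilibrium density *)

Section equilibrium_steps_energy.
Context {R : realType}.
Notation mu := (@lebesgue_measure R).
Variable H : R.
Hypothesis H12 : 2^-1 < H < 1.

Let H0 : 0 < H. Proof. by case/andP: H12 => *; lra. Qed.
Let H21 : 0 < 2 * H - 1. Proof. by case/andP: H12 => *; lra. Qed.

Lemma continuous_fbm_dvar : continuous (@fbm_dvar R H).
Proof. by move=> x; apply: cvgM; [exact: cvg_cst|exact: continuous_sg_norm_powR]. Qed.

Let cshift (f : R -> R) (c : R) : continuous f -> continuous (fun x => f (c - x)).
Proof.
move=> cf x; apply: (@cvg_comp _ _ _ (fun x => c - x) f); last exact: cf.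
by apply: cvgB; [exact: cvg_cst|exact: cvg_id].
Qed.

Let cint (f : R -> R) u v : continuous f -> mu.-integrable `[u, v] (EFin \o f).
Proof.
move=> cf; apply: continuous_compact_integrable; first exact: segment_compact.
exact: continuous_subspaceT.
Qed.

Let kern (b1 b2 x : R) := fbm_dvar H (b2 - x) - fbm_dvar H (b1 - x).

Let ckern b1 b2 : continuous (kern b1 b2).
Proof. by move=> x; apply: cvgB; apply: cshift; exact: continuous_fbm_dvar. Qed.

Let integral_fbm_dvar_sub (b c d : R) : c <= d ->
  \int[mu]_(x in `[c, d]) fbm_dvar H (b - x) = fbm_var H (b - c) - fbm_var H (b - d).
Proof.
move=> cd.
rewrite (@FTC_right_except _ _ (fun x => - fbm_var H (b - x)) c d b)//.
- by ring.
- by apply: cint; apply: cshift; exact: continuous_fbm_dvar.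
- apply: continuous_subspaceT => x; apply: cvgN.
  exact: (@cshift (fbm_var H) b (continuous_fbm_var H0) x).
- move=> x _ xb; apply: is_derive_right_slope.
  have bx : b - x != 0 by rewrite subr_eq0 eq_sym.
  have D := is_derive_subl b x.
  have := is_deriveN (@is_derive1_comp _ (fbm_var H) (fun x => b - x) _ _ _ (is_derive_fbm_var H bx) D).
  by rewrite mulrN1 opprK.
Qed.

(** For H > 1/2 the function [fbm_dvar] is continuous, so the covariance is an honest integral. The
    kernel being nonnegative, pointwise bounds between step functions and [equilibrium] then carry
    over to covariances. *)
Lemma step_cov_fbm_integral (T b1 b2 : R) (p : seq (R * (R * R))) : steps_in T p ->
  step_cov (fbm_var H) b1 b2 p = \int[mu]_(x in `[0, T]) (step_fun p x * kern b1 b2 x).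
Proof.
move=> pT; rewrite (integral_step_funM pT); last by apply: cint; exact: ckern.
rewrite /step_cov !big_seq; apply: eq_bigr => q /pT[_ q12 _]; congr (_ * _).
have i1 c : mu.-integrable `[q.2.1, q.2.2] (EFin \o (fun x => fbm_dvar H (c - x))).
  by apply: cint; apply: cshift; exact: continuous_fbm_dvar.
rewrite RintegralB; [|exact: measurable_itv|exact: i1|exact: i1].
by rewrite !integral_fbm_dvar_sub// /incr_cov; ring.
Qed.

Variables (T : R).
Hypothesis T0 : 0 < T.

Let ES m := equilibrium_steps H T m.
Let esT m : steps_in T (ES m).
Proof. exact: equilibrium_steps_in. Qed.

Let mESk m b1 b2 (D : set R) : measurable_fun D (fun x => (step_fun (ES m) x * kern b1 b2 x)%:E).
Proof.
apply: measurable_funTS; apply/measurable_EFinP; apply: measurable_funM.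
  exact: measurable_step_fun.
exact: continuous_measurable_fun (@ckern b1 b2).
Qed.

Let step_covE m b1 b2 : ((step_cov (fbm_var H) b1 b2 (ES m))%:E =
  \int[mu]_(x in `]0%R, T[) (step_fun (ES m) x * kern b1 b2 x)%:E)%E.
Proof.
rewrite (@step_cov_fbm_integral T b1 b2 _ (@esT m)) EFin_Rintegral//; last first.
  by apply: integrable_step_funM; apply: cint; exact: ckern.
rewrite -integral_itv_obnd_cbnd; last exact: mESk.
by rewrite -integral_itv_bndo_bndc//; exact: mESk.
Qed.

Let mEk b1 b2 (D : set R) : measurable_fun D (fun x => (equilibrium H (T^-1 * x) * kern b1 b2 x)%:E).
Proof.
apply: measurable_funTS; apply/measurable_EFinP; apply: measurable_funM.
  by apply: (measurableT_comp (measurable_equilibrium H)); exact: measurable_funM.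
exact: continuous_measurable_fun (@ckern b1 b2).
Qed.

Lemma step_cov_equilibrium_le m b1 b2 : 0 <= b1 -> b1 <= b2 -> b2 <= T ->
  step_cov (fbm_var H) b1 b2 (ES m) <= equilibrium_const H * T `^ (2 * H - 1) * (b2 - b1).
Proof.
move=> b10 b12 b2T; rewrite -lee_fin step_covE -equilibrium_identity//.
apply: ge0_le_integral => //.
- move=> x; rewrite /= in_itv/= => xT; rewrite lee_fin mulr_ge0 ?equilibrium_steps_ge0//.
  exact: fbm_dvar_incr_ge0.
- exact: mESk.
- exact: mEk.
- move=> x; rewrite /= in_itv/= => xT; rewrite lee_fin ler_wpM2r//.
    exact: fbm_dvar_incr_ge0.
  exact: equilibrium_steps_le.
Qed.

Lemma step_cov_equilibrium_cvg b1 b2 : 0 <= b1 -> b1 <= b2 -> b2 <= T ->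
  step_cov (fbm_var H) b1 b2 (ES m) @[m --> \oo] -->
  equilibrium_const H * T `^ (2 * H - 1) * (b2 - b1).
Proof.
move=> b10 b12 b2T.
suff : (step_cov (fbm_var H) b1 b2 (ES m))%:E @[m --> \oo] -->
    (equilibrium_const H * T `^ (2 * H - 1) * (b2 - b1))%:E by move/fine_cvg.
under eq_fun do rewrite step_covE.
rewrite -equilibrium_identity//.
have k0 x : 0 <= kern b1 b2 x by exact: fbm_dvar_incr_ge0.
apply: (@dominated_cvg _ _ R mu `]0, T[%classic _
  (fun m x => (step_fun (ES m) x * kern b1 b2 x)%:E) _
  (fun x => (equilibrium H (T^-1 * x) * kern b1 b2 x)%:E)) => //.
- by move=> m; exact: mESk.
- move=> x; rewrite /= in_itv/= => xT; apply: cvg_EFin; first exact: nearW.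
  by apply: cvgMl; exact: equilibrium_steps_cvg.
- apply/integrableP; split; first exact: mEk.
  rewrite (_ : (\int[mu]_(x in _) _ = \int[mu]_(x in `]0%R, T[)
      (equilibrium H (T^-1 * x) * kern b1 b2 x)%:E)%E).
    by rewrite equilibrium_identity// ltry.
  by apply: eq_integral => x _; rewrite gee0_abs// lee_fin mulr_ge0 ?equilibrium_ge0.
- move=> m x; rewrite /= in_itv/= => xT.
  rewrite lee_fin ger0_norm ?mulr_ge0 ?equilibrium_steps_ge0//.
  by rewrite ler_wpM2r// equilibrium_steps_le.
Qed.

Let mES m (D : set R) : measurable_fun D (fun x => (step_fun (ES m) x)%:E).
Proof. apply: measurable_funTS; apply/measurable_EFinP; exact: measurable_step_fun. Qed.

Let mEq (D : set R) : measurable_fun D (fun x => (equilibrium H (T^-1 * x))%:E).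
Proof.
apply: measurable_funTS; apply/measurable_EFinP.
by apply: (measurableT_comp (measurable_equilibrium H)); exact: measurable_funM.
Qed.

Let step_massE m : ((step_mass (ES m))%:E = \int[mu]_(x in `]0%R, T[) (step_fun (ES m) x)%:E)%E.
Proof.
rewrite -(integral_step_fun (@esT m)) EFin_Rintegral//; last exact: integrable_step_fun.
rewrite -integral_itv_obnd_cbnd; last exact: mES.
by rewrite -integral_itv_bndo_bndc//; exact: mES.
Qed.

Lemma step_mass_equilibrium_le m : step_mass (ES m) <= T * equilibrium_mass H.
Proof.
rewrite -lee_fin step_massE -integral_equilibrium_scale//.
apply: ge0_le_integral => //.
- by move=> x; rewrite /= in_itv/= => xT; rewrite lee_fin equilibrium_steps_ge0.
- exact: mES.
- exact: mEq.
- by move=> x; rewrite /= in_itv/= => xT; rewrite lee_fin equilibrium_steps_le.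
Qed.

Lemma step_mass_equilibrium_cvg : step_mass (ES m) @[m --> \oo] --> T * equilibrium_mass H.
Proof.
suff : (step_mass (ES m))%:E @[m --> \oo] --> (T * equilibrium_mass H)%:E by move/fine_cvg.
under eq_fun do rewrite step_massE.
rewrite -integral_equilibrium_scale//.
apply: (@dominated_cvg _ _ R mu `]0, T[%classic _
  (fun m x => (step_fun (ES m) x)%:E) _
  (fun x => (equilibrium H (T^-1 * x))%:E)) => //.
- by move=> m; exact: mES.
- move=> x; rewrite /= in_itv/= => xT; apply: cvg_EFin; first exact: nearW.
  exact: equilibrium_steps_cvg.
- apply/integrableP; split; first exact: mEq.
  rewrite (_ : (\int[mu]_(x in _) _ = \int[mu]_(x in `]0%R, T[)
      (equilibrium H (T^-1 * x))%:E)%E).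
    by rewrite integral_equilibrium_scale// ltry.
  by apply: eq_integral => x _; rewrite gee0_abs// lee_fin equilibrium_ge0.
- move=> m x; rewrite /= in_itv/= => xT.
  by rewrite lee_fin ger0_norm ?equilibrium_steps_ge0// equilibrium_steps_le.
Qed.

Lemma step_mass_equilibrium_scale m : step_mass (ES m) = T * step_mass (equilibrium_steps H 1 m).
Proof.
rewrite /step_mass !big_map big_distrr/=; apply: eq_bigr => i _; rewrite !mul1r; ring.
Qed.

End equilibrium_steps_energy.

(** * Step integrals against processes with stationary increments *)

Section increments.
Context {R : realType} {d : measure_display} {Omega : measurableType d}.
Variable P : probability Omega R.
Implicit Types (Z : R -> Omega -> R) (m : R -> R).

(* m is half the variogram of Z. *)
Definition has_variogram Z m : Prop :=
  [/\ forall s t, 0 <= s -> 0 <= t -> sqint P (fun w => Z t w - Z s w),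
      forall x, m (- x) = m x &
      forall s t, 0 <= s -> 0 <= t ->
        ip P (fun w => Z t w - Z s w) (fun w => Z t w - Z s w) = 2 * m (t - s)].

Definition step_energy m (p q : seq (R * (R * R))) : R :=
  \sum_(r <- p) r.1 * step_cov m r.2.1 r.2.2 q.

Definition nonneg_steps (p : seq (R * (R * R))) : Prop :=
  forall q, q \in p -> 0 <= q.2.1 /\ 0 <= q.2.2.

Lemma steps_in_nonneg T p : steps_in T p -> nonneg_steps p.
Proof. by move=> pT q /pT[q1 q12 _]; split => //; exact: le_trans q12. Qed.

Lemma nonneg_steps_cons q p : nonneg_steps (q :: p) ->
  [/\ 0 <= q.2.1, 0 <= q.2.2 & nonneg_steps p].
Proof.
move=> h; have [|h1 h2] := h q; first exact: mem_head.
by split=> // r rp; apply: h; rewrite in_cons rp orbT.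
Qed.

Variables (Z : R -> Omega -> R) (m : R -> R).
Hypothesis Zm : has_variogram Z m.

Let sZ s t : 0 <= s -> 0 <= t -> sqint P (fun w => Z t w - Z s w).
Proof. by case: Zm => h _ _; exact: h. Qed.

(** Polarization. Only increments are assumed square integrable, so every increment is written as a
    difference of increments starting at time a. *)
Lemma ip_incr a b c e : 0 <= a -> 0 <= b -> 0 <= c -> 0 <= e ->
  ip P (fun w => Z b w - Z a w) (fun w => Z e w - Z c w) = incr_cov m a b c e.
Proof.
move=> a0 b0 c0 e0; case: Zm => _ mN ZV.
have sab := sZ a0 b0; have sce := sZ c0 e0; have sac := sZ a0 c0; have sae := sZ a0 e0.
have Q X Y : sqint P X -> sqint P Y ->
    ip P (fun w => X w - Y w) (fun w => X w - Y w) = ip P X X - 2 * ip P X Y + ip P Y Y.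
  move=> sX sY; have sXY := sqintB sX sY.
  by rewrite ipBl// !ipBr// (ipC P Y X); ring.
have E x y : (fun w => Z y w - Z x w) = (fun w => (Z y w - Z a w) - (Z x w - Z a w)).
  by apply/funext => w; ring.
have E1 := ZV c b c0 b0; have E2 := ZV e b e0 b0; have E3 := ZV a c a0 c0; have E4 := ZV a e a0 e0.
rewrite E Q// in E1; rewrite E Q// in E2.
rewrite [X in ip P _ X](E c e) ipBr// /incr_cov.
rewrite -(mN (a - e)) opprB -(mN (a - c)) opprB; lra.
Qed.

Lemma sqint_step_integral p : nonneg_steps p -> sqint P (step_integral Z p).
Proof.
elim: p => [_|q p IH /nonneg_steps_cons[q1 q2 p0]].
  rewrite (_ : step_integral Z [::] = fun=> 0); first exact: sqint_cst.
  by apply/funext => w; rewrite /step_integral big_nil.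
rewrite (_ : step_integral Z (q :: p) =
    fun w => q.1 * (Z q.2.2 w - Z q.2.1 w) + step_integral Z p w).
  by apply: sqintD; [apply: sqintZ; exact: sZ|exact: IH].
by apply/funext => w; rewrite /step_integral big_cons.
Qed.

Lemma ip_step_integral p Y : nonneg_steps p -> sqint P Y ->
  ip P (step_integral Z p) Y =
  \sum_(r <- p) r.1 * ip P (fun w => Z r.2.2 w - Z r.2.1 w) Y.
Proof.
move=> + sY; elim: p => [_|q p IH /nonneg_steps_cons[q1 q2 p0]].
  rewrite big_nil (_ : step_integral Z [::] = fun w => 0 * 0).
    by rewrite (ipZl _ (sqint_cst P 0) sY) mul0r.
  by apply/funext => w; rewrite /step_integral big_nil mul0r.
rewrite (_ : step_integral Z (q :: p) =
    fun w => q.1 * (Z q.2.2 w - Z q.2.1 w) + step_integral Z p w); last first.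
  by apply/funext => w; rewrite /step_integral big_cons.
have sq := sZ q1 q2.
rewrite ipDl//; [|exact: sqintZ|exact: sqint_step_integral].
by rewrite ipZl// IH// big_cons.
Qed.

Lemma ip_incr_step_integral a b p : 0 <= a -> 0 <= b -> nonneg_steps p ->
  ip P (fun w => Z b w - Z a w) (step_integral Z p) = step_cov m a b p.
Proof.
move=> a0 b0 p0; have sab := sZ a0 b0; rewrite ipC (ip_step_integral p0 sab) /step_cov.
rewrite !big_seq; apply: eq_bigr => q /p0[q1 q2]; congr (_ * _).
by rewrite ipC ip_incr.
Qed.

Lemma ip_step_integrals p q : nonneg_steps p -> nonneg_steps q ->
  ip P (step_integral Z p) (step_integral Z q) = step_energy m p q.
Proof.
move=> p0 q0; have sq := sqint_step_integral q0.
rewrite (ip_step_integral p0 sq) /step_energy !big_seq; apply: eq_bigr => r /p0[r1 r2].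
by rewrite ip_incr_step_integral.
Qed.

End increments.

Section brownian_variogram.
Context {R : realType}.
Notation mu := (@lebesgue_measure R).

Definition bm_var (x : R) : R := `|x| / 2.

Lemma bm_varN x : bm_var (- x) = bm_var x.
Proof. by rewrite /bm_var normrN. Qed.

Lemma continuous_bm_var : continuous bm_var.
Proof. by move=> x; apply: cvgM; [exact: norm_continuous|exact: cvg_cst]. Qed.

Lemma step_cov_bm (T y : R) (p : seq (R * (R * R))) : steps_in T p -> 0 <= y <= T ->
  step_cov bm_var 0 y p = \int[mu]_(x in `[0, y]) step_fun p x.
Proof.
move=> pT /andP[y0 yT].
transitivity (\int[mu]_(x in `[0, T]) (step_fun p x * (\1_(`[0, y] : set R) x * cst 1 x))).
  have i1 : mu.-integrable `[0, T] (EFin \o (fun x => \1_(`[0, y] : set R) x * cst 1 x)).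
    exact: (@integrable_indicM _ _ _ mu _ _ _ (measurable_itv _) (measurable_itv _) (integrable_cst_itv 0 T 1)).
  rewrite (integral_step_funM pT i1) /step_cov !big_seq; apply: eq_bigr => q /pT[q1 q12 q2].
  congr (_ * _); rewrite /incr_cov /bm_var.
  transitivity (\int[mu]_(x in `[q.2.1, q.2.2] `&` `[0, y]) (cst 1 x)); last first.
    rewrite [RHS]Rintegral_mkcond [LHS]Rintegral_mkcond; apply: eq_Rintegral => x _.
    rewrite !patchE in_setI indicE; case: (x \in `[q.2.1, q.2.2]%classic) => //=.
    by case: ifP => _; rewrite ?mul1r ?mul0r.
  have [qy|yq] := leP q.2.1 y; last first.
    rewrite (_ : _ `&` _ = set0).
      rewrite Rintegral_set0 !ler0_norm; [|lra|lra|lra|lra]; lra.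
    apply/seteqP; split => // x [] /=; rewrite !in_itv/= => /andP[? _] /andP[_ ?]; lra.
  have [q2y|yq2] := leP q.2.2 y.
    rewrite (_ : _ `&` _ = `[q.2.1, q.2.2]%classic).
      have h1 : 0 <= y - q.2.1 by lra.
      have h2 : 0 <= y - q.2.2 by lra.
      rewrite Rintegral_cst_itv// (ger0_norm h1) (ger0_norm h2).
      rewrite !ler0_norm; [|lra|lra]; lra.
    by apply/seteqP; split => [x []//|x] /=; rewrite !in_itv/= => /andP[? ?]; lra.
  rewrite (_ : _ `&` _ = `[q.2.1, y]%classic).
    rewrite Rintegral_cst_itv// (ger0_norm (_ : 0 <= y - q.2.1)); last lra.
    rewrite !ler0_norm; [|lra|lra|lra]; lra.
  apply/seteqP; split => [x []|x] /=; rewrite !in_itv/= => /andP[? ?].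
    by move=> /andP[? ?]; lra.
  by split; lra.
have sub : `[0, y] `<=` `[0, T].
  by move=> x; rewrite /= !in_itv/= => /andP[-> xy] /=; exact: le_trans yT.
transitivity (\int[mu]_(x in `[0, T]) (\1_(`[0, y] : set R) x * step_fun p x)).
  by apply: eq_Rintegral => x _; rewrite mulr1 mulrC.
by rewrite Rintegral_indicM.
Qed.

(** A crude bound, which suffices because for H > 1/2 the Brownian energy is of lower order in T. *)
Lemma incr_cov_bm_le (T a b c e : R) : 0 <= a -> a <= b -> b <= T -> c <= e ->
  incr_cov bm_var a b c e <= T.
Proof.
move=> a0 ab bT ce; rewrite /incr_cov /bm_var.
have h1 := ler_distD a b c; have h2 := ler_distD b a e.
have h3 : `|b - a| <= T by rewrite ger0_norm; lra.
rewrite (distrC a b) in h2; lra.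
Qed.

End brownian_variogram.

(** * Brownian, fractional Brownian and mixed motions *)

Section normal_facts.
Context {R : realType} {d : measure_display} {Omega : measurableType d}.
Variable P : probability Omega R.
Implicit Types X Y : Omega -> R.

Lemma centered_normal_sqint X s : measurable_fun setT X -> centered_normal P X s ->
  sqint P X /\ ip P X X = s ^+ 2.
Proof.
move=> mX Xs; have E := centered_normal_second_moment mX Xs.
have sX : sqint P X by apply: sqintP => //; rewrite E ltry.
by split=> //; apply/EFin_inj; rewrite -ip_sqrE.
Qed.

(** The scale is determined up to sign by the second moment; taking it to be the L^2 norm makes
    scales converge along L^2 limits. *)
Lemma centered_normal_sqrt_ip X s : measurable_fun setT X -> centered_normal P X s ->
  centered_normal P X (Num.sqrt (ip P X X)).
Proof.
move=> mX Xs; have [_ ->] := centered_normal_sqint mX Xs.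
rewrite sqrtr_sqr; have [s0|/ltW s0] := leP 0 s; first by rewrite ger0_norm.
by rewrite ler0_norm//; apply: centered_normalN.
Qed.

(** The law of X + Y is known from independence. Its second moment is the sum of the two second
    moments, so the cross term vanishes. *)
Lemma independent_normal_ip0 X Y :
  measurable_fun setT X -> measurable_fun setT Y ->
  (forall A B : set (measurableTypeR R), measurable A -> measurable B ->
    P (X @^-1` A `&` Y @^-1` B) = (P (X @^-1` A) * P (Y @^-1` B))%E) ->
  centered_normal P X (Num.sqrt (ip P X X)) -> centered_normal P Y (Num.sqrt (ip P Y Y)) ->
  ip P X Y = 0 /\
  centered_normal P (fun w => X w + Y w) (Num.sqrt (ip P X X + ip P Y Y)).
Proof.
move=> mX mY XY nX nY.
have [sX EX] := centered_normal_sqint mX nX; have [sY EY] := centered_normal_sqint mY nY.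
have := centered_normalD (sqrtr_ge0 _) (sqrtr_ge0 _) mX mY XY nX nY.
rewrite !sqr_sqrtr ?ip_ge0// => nXY; split=> //.
have mXY : measurable_fun setT (fun w => X w + Y w) by exact: measurable_funD.
have [sXY EXY] := centered_normal_sqint mXY nXY.
move: EXY; rewrite sqr_sqrtr ?addr_ge0 ?ip_ge0//.
rewrite ipDl// !ipDr// (ipC P Y X); lra.
Qed.

End normal_facts.

Section sigma_of_process.
Context {R : realType} {d : measure_display} {Omega : measurableType d}.
Variable P : probability Omega R.
Implicit Type X : R -> {RV P >-> R}.

Lemma sigma_of_linear X (D : set R) (l : seq (R * (R * R))) (A : set (measurableTypeR R)) :
  (forall q, q \in l -> D q.2.1 /\ D q.2.2) -> measurable A ->
  sigma_of X D ((fun w => \sum_(q <- l) q.1 * (X q.2.2 w - X q.2.1 w)) @^-1` A).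
Proof.
move=> lD mA.
pose G := [set X t @^-1` A | t in D & A in (measurable : set (set (measurableTypeR R)))].
pose T := g_sigma_algebraType G.
have mX t : D t -> measurable_fun setT (X t : T -> R).
  move=> Dt _ B mB; rewrite setTI; apply: sub_sigma_algebra.
  by exists t => //; exists B.
have : measurable_fun setT ((fun w => \sum_(q <- l) q.1 * (X q.2.2 w - X q.2.1 w)) : T -> R).
  elim: l lD => [_|q l IH qlD].
    rewrite (_ : (fun w => _) = fun=> 0); first exact: measurable_cst.
    by apply/funext => w; rewrite big_nil.
  rewrite (_ : (fun w => _) = (fun w => q.1 * (X q.2.2 w - X q.2.1 w) +
      \sum_(q <- l) q.1 * (X q.2.2 w - X q.2.1 w))); last first.
    by apply/funext => w; rewrite big_cons.
  have [|D1 D2] := qlD q; first exact: mem_head.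
  apply: measurable_funD.
    by apply: measurable_funM => //; apply: measurable_funB; exact: mX.
  by apply: IH => r rl; apply: qlD; rewrite in_cons rl orbT.
by move=> /(_ measurableT A mA); rewrite setTI.
Qed.

Lemma sigma_of_step_integral X (p : seq (R * (R * R))) (A : set (measurableTypeR R)) :
  nonneg_steps p -> measurable A ->
  sigma_of X `[0, +oo[ (step_integral (fun t => X t) p @^-1` A).
Proof.
move=> p0 mA; apply: sigma_of_linear => // q /p0[q1 q2].
by rewrite /= !in_itv/= q1 q2.
Qed.

End sigma_of_process.

Section brownian.
Context {R : realType} {d : measure_display} {Omega : measurableType d}.
Variable P : probability Omega R.
Variable W : R -> {RV P >-> R}.
Hypothesis BW : standard_brownian W.

Let mWB s t : measurable_fun setT (fun w => W t w - W s w).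
Proof. exact: measurable_funB. Qed.

Let nW s t : 0 <= s <= t -> centered_normal P (fun w => W t w - W s w) (Num.sqrt (t - s)).
Proof.
move=> st; case: BW => _ h _ _; apply: has_law_centered_normal; last exact: h.
by rewrite subr_ge0; case/andP: st.
Qed.

Lemma brownian_variogram : has_variogram P (fun t => W t) bm_var.
Proof.
have H s t : 0 <= s <= t -> sqint P (fun w => W t w - W s w) /\
    ip P (fun w => W t w - W s w) (fun w => W t w - W s w) = 2 * bm_var (t - s).
  move=> st; have [sW E] := centered_normal_sqint (mWB s t) (nW st).
  split=> //; rewrite E sqr_sqrtr; last by rewrite subr_ge0; case/andP: st.
  rewrite /bm_var ger0_norm; last by rewrite subr_ge0; case/andP: st.
  by field.
have N s t : (fun w => W t w - W s w) = (fun w => - (W s w - W t w)).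
  by apply/funext => w; rewrite opprB.
split=> [s t s0 t0| |s t s0 t0]; last 2 first.
- exact: bm_varN.
- have [st|/ltW ts] := leP s t; first by have [|_] := H s t; first by rewrite s0.
  have [|sW E] := H t s; first by rewrite t0.
  by rewrite N ipNl ?ipNr ?opprK ?E// -?(bm_varN (s - t)) ?opprB//; exact: sqintN.
have [st|/ltW ts] := leP s t; first by have [|sW _] := H s t; first by rewrite s0.
by have [|sW E] := H t s; [rewrite t0|rewrite N; exact: sqintN].
Qed.

Let lin (l : seq (R * R)) (w : Omega) : R := \sum_(q <- l) q.1 * (W q.2 w - W 0 w).

Let mlin l : measurable_fun setT (lin l).
Proof. by apply: measurable_sum => q; apply: measurable_funM => //; exact: mWB. Qed.

(** Induction on times in decreasing order: c (W_t - W_0) splits at the next time t' into c (W_t -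
    W_t'), independent of the past up to t', and c (W_t' - W_0), whose coefficient is merged into
    the next term. *)
Let lin_normal_path (l : seq (R * R)) (c t : R) :
  path (fun x y : R * R => y.2 <= x.2) (c, t) l ->
  0 <= t -> (forall q, q \in l -> 0 <= q.2) ->
  exists s, centered_normal P (lin ((c, t) :: l)) s.
Proof.
elim: l c t => [|[c' t'] l IH] c t.
  move=> _ t0 _; exists (c * Num.sqrt (t - 0)).
  rewrite (_ : lin _ = fun w => c * (W t w - W 0 w)); last first.
    by apply/funext => w; rewrite /lin big_cons big_nil addr0.
  by apply: centered_normalZ; apply: nW; rewrite lexx.
move=> /= /andP[t't pl] t0 l0.
have t'0 : 0 <= t' by apply: (l0 (c', t')); rewrite mem_head.
have l0' q : q \in l -> 0 <= q.2 by move=> ql; apply: l0; rewrite in_cons ql orbT.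
have pl' : path (fun x y : R * R => y.2 <= x.2) (c + c', t') l.
  by case: (l) pl.
have [s ns] := IH _ _ pl' t'0 l0'.
pose X := lin ((c + c', t') :: l); pose Y w := c * (W t w - W t' w).
have E : lin ((c, t) :: (c', t') :: l) = fun w => X w + Y w.
  by apply/funext => w; rewrite /X /Y /lin !big_cons/=; ring.
have mX : measurable_fun setT X by exact: mlin.
have mY : measurable_fun setT Y by apply: measurable_funM => //; exact: mWB.
have tt' : 0 <= t' <= t by rewrite t'0.
have nX := centered_normal_sqrt_ip mX ns.
have nY := centered_normal_sqrt_ip mY (centered_normalZ c (nW tt')).
exists (Num.sqrt (ip P X X + ip P Y Y)); rewrite E.
apply: (independent_normal_ip0 mX mY _ nX nY).2 => A B mA mB.
case: BW => _ _ indep _.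
have mB' : measurable ((fun x : R => c * x) @^-1` B : set (measurableTypeR R)).
  rewrite -[X in measurable X]setTI.
  have : measurable_fun setT ((fun x : R => c * x) : measurableTypeR R -> measurableTypeR R).
    exact: measurable_funM.
  exact.
apply: (indep _ _ tt' (X @^-1` A) _ _ mB').
rewrite /X /lin.
have -> : (fun w => \sum_(q <- (c + c', t') :: l) q.1 * (W q.2 w - W 0 w)) =
    (fun w => \sum_(q <- [seq (q.1, (0, q.2)) | q <- (c + c', t') :: l])
       q.1 * (W q.2.2 w - W q.2.1 w)).
  by apply/funext => w; rewrite big_map.
apply: sigma_of_linear => // q /mapP[r + ->] /=; rewrite in_cons => rl.
have r0t : 0 <= r.2 <= t'.
  case/orP : rl => [/eqP -> /=|rl]; first by rewrite t'0 lexx.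
  rewrite l0'//=.
  have := order_path_min (_ : transitive (fun x y : R * R => y.2 <= x.2)) pl'.
  move=> /(_ (fun y x z h1 h2 => le_trans h2 h1)) /allP/(_ _ rl) //.
by rewrite /= !in_itv/= lexx t'0.
Qed.

Lemma brownian_step_integral_normal (p : seq (R * (R * R))) : nonneg_steps p ->
  centered_normal P (step_integral (fun t => W t) p)
    (Num.sqrt (ip P (step_integral (fun t => W t) p) (step_integral (fun t => W t) p))).
Proof.
move=> p0.
have [mI _] := sqint_step_integral brownian_variogram p0.
(* Each step contributes its two endpoints with opposite coefficients; the list is then sorted by
   decreasing time. *)
pose l := flatten [seq [:: (q.1, q.2.2); (- q.1, q.2.1)] | q <- p].
have IE : step_integral (fun t => W t) p = lin l.
  apply/funext => w; rewrite /lin /l /step_integral; elim: (p) => [|q r IH].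
    by rewrite !big_nil.
  by rewrite big_cons IH /= !big_cons/=; ring.
have l0 q : q \in l -> 0 <= q.2.
  by move=> /flattenP[s /mapP[r /p0[r1 r2] ->]]; rewrite !inE => /orP[/eqP->|/eqP->].
suff [s ns] : exists s, centered_normal P (lin l) s.
  by apply: (@centered_normal_sqrt_ip _ _ _ _ _ s) => //; rewrite IE.
pose r (x y : R * R) := y.2 <= x.2.
have rtot : total r by move=> x y; exact: le_total.
have := sort_sorted rtot l; have := permEl (perm_sort r l).
case: (sort r l) => [|[c t] l'] pe sl.
  exists (0 * Num.sqrt (0 - 0)); move: pe; rewrite perm_sym => /perm_nilP ->.
  rewrite (_ : lin [::] = fun w => 0 * (W 0 w - W 0 w)); last first.
    by apply/funext => w; rewrite /lin big_nil mul0r.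
  by apply: centered_normalZ; apply: nW; rewrite lexx.
have [||s ns] := @lin_normal_path l' c t sl.
- by apply: (l0 (c, t)); rewrite -(perm_mem pe) mem_head.
- by move=> q ql; apply: l0; rewrite -(perm_mem pe) in_cons ql orbT.
exists s; rewrite (_ : lin l = lin ((c, t) :: l'))//.
by apply/funext => w; rewrite /lin; exact/esym/perm_big.
Qed.

End brownian.

Section fractional_brownian_motion.
Context {R : realType} {d : measure_display} {Omega : measurableType d}.
Variable P : probability Omega R.
Variables (H : R) (B : R -> {RV P >-> R}).
Hypotheses (H0 : 0 < H) (FB : fractional_brownian H B).

Let covB s t : 0 <= s -> 0 <= t ->
  (\int[P]_w (B t w * B s w)%:E = (fbm_cov H s t)%:E)%E.
Proof. by case: FB => _ _ h _ s0 t0; have := h s t s0 t0; rewrite unlock. Qed.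

Let sB t : 0 <= t -> sqint P (B t).
Proof.
move=> t0; apply: sqintP => //; have := covB t0 t0.
by under eq_integral do rewrite -expr2; move=> ->; rewrite ltry.
Qed.

Let ipB s t : 0 <= s -> 0 <= t -> ip P (B t) (B s) = fbm_cov H s t.
Proof. by move=> s0 t0; rewrite /ip /Rintegral covB. Qed.

Lemma fbm_variogram : has_variogram P (fun t => B t) (fbm_var H).
Proof.
have H2 : 2 * H != 0 by rewrite gt_eqF// mulr_gt0.
split=> [s t s0 t0| |s t s0 t0].
- by apply: sqintB; exact: sB.
- exact: fbm_varN.
- have sBs := sB s0; have sBt := sB t0; have sBB := sqintB sBt sBs.
  rewrite ipBl// !ipBr// !ipB// /fbm_cov /fbm_var !subrr normr0 powR0//.
  by rewrite (distrC s t); field.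
Qed.

(** The Gaussian property provides some law N(m, v) for the linear combination; its mean is 0 by
    linearity, which fixes m. *)
Lemma fbm_step_integral_normal (p : seq (R * (R * R))) : nonneg_steps p ->
  centered_normal P (step_integral (fun t => B t) p)
    (Num.sqrt (ip P (step_integral (fun t => B t) p) (step_integral (fun t => B t) p))).
Proof.
move=> p0.
have sI := sqint_step_integral fbm_variogram p0.
pose l := flatten [seq [:: (q.1, q.2.2); (- q.1, q.2.1)] | q <- p].
have IE : step_integral (fun t => B t) p =
    fun w => \sum_(i < size l) (nth (0, 0) l i).1 * B (nth (0, 0) l i).2 w.
  apply/funext => w; transitivity (\sum_(q <- l) q.1 * B q.2 w).
    rewrite /l /step_integral; elim: (p) => [|q r IH]; first by rewrite !big_nil.
    by rewrite big_cons IH /= !big_cons/=; ring.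
  by rewrite (big_nth (0, 0)) big_mkord.
have l0 q : q \in l -> 0 <= q.2.
  by move=> /flattenP[s /mapP[r /p0[r1 r2] ->]]; rewrite !inE => /orP[/eqP->|/eqP->].
case: FB => gp mean _ _.
have [i|m [v [v0 lawI]]] := gp (size l) (fun i => (nth (0, 0) l i).1) (fun i => (nth (0, 0) l i).2).
  by apply: l0; exact: mem_nth.
rewrite -IE in lawI.
have s1 := sqint_cst P 1.
have mB0 t : 0 <= t -> ip P (B t) (fun=> 1) = 0.
  move=> t0; have := mean t t0; rewrite unlock => E.
  rewrite /ip /Rintegral; under eq_integral do rewrite mulr1.
  by rewrite E.
have I0 : (\int[P]_w (step_integral (fun t => B t) p w)%:E = 0)%E.
  rewrite -[LHS]fineK; last exact: integrable_fin_num (sqint_integrable sI).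
  have -> : fine (\int[P]_w (step_integral (fun t => B t) p w)%:E)%E =
      ip P (step_integral (fun t => B t) p) (fun=> 1).
    by rewrite /ip /Rintegral; under [in RHS]eq_integral do rewrite mulr1.
  rewrite (ip_step_integral fbm_variogram p0 s1) big_seq big1// => q /p0[q1 q2].
  by rewrite ipBl ?mB0 ?subrr ?mulr0//; exact: sB.
have n := centered_normal_of_has_law v0 lawI (sqint_integrable sI) I0.
by apply: (centered_normal_sqrt_ip _ n); case: sI.
Qed.

End fractional_brownian_motion.

Section mixed_process.
Context {R : realType} {d : measure_display} {Omega : measurableType d}.
Variable P : probability Omega R.
Variables (H : R) (W B : R -> {RV P >-> R}).
Hypotheses (H0 : 0 < H) (BW : standard_brownian W) (FB : fractional_brownian H B).
Hypothesis WB : independent_processes W B.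

Let W' (t : R) (w : Omega) := W t w.
Let B' (t : R) (w : Omega) := B t w.
Let xi := mixed_fbm (fun t => W t) (fun t => B t).

Let VW : has_variogram P W' bm_var := brownian_variogram BW.
Let VB : has_variogram P B' (fbm_var H) := fbm_variogram H0 FB.

Let mixed_split p q : nonneg_steps p -> nonneg_steps q ->
  ip P (step_integral W' p) (step_integral B' q) = 0 /\
  centered_normal P (fun w => step_integral W' p w + step_integral B' q w)
    (Num.sqrt (ip P (step_integral W' p) (step_integral W' p) +
               ip P (step_integral B' q) (step_integral B' q))).
Proof.
move=> p0 q0.
have [mp _] := sqint_step_integral VW p0; have [mq _] := sqint_step_integral VB q0.
apply: independent_normal_ip0 => //.
- by move=> A C mA mC; apply: WB; exact: sigma_of_step_integral.
- exact: (brownian_step_integral_normal BW p0).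
- exact: (fbm_step_integral_normal H0 FB q0).
Qed.

Lemma ip_brownian_fbm p q : nonneg_steps p -> nonneg_steps q ->
  ip P (step_integral W' p) (step_integral B' q) = 0.
Proof. by move=> p0 q0; case: (mixed_split p0 q0). Qed.

Lemma step_integral_mixed p :
  step_integral xi p = fun w => step_integral W' p w + step_integral B' p w.
Proof.
apply/funext => w; rewrite /step_integral -big_split/=; apply: eq_bigr => q _.
by rewrite /xi /mixed_fbm /W' /B'; ring.
Qed.

Definition mixed_var (x : R) : R := bm_var x + fbm_var H x.

Lemma mixed_variogram : has_variogram P xi mixed_var.
Proof.
case: VW => sW NW EW; case: VB => sB NB EB.
have E s t : (fun w => xi t w - xi s w) = (fun w => (W' t w - W' s w) + (B' t w - B' s w)).
  by apply/funext => w; rewrite /xi /mixed_fbm /W' /B'; ring.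
split=> [s t s0 t0| |s t s0 t0].
- by rewrite E; apply: sqintD; [exact: sW|exact: sB].
- by move=> x; rewrite /mixed_var NW NB.
have s1 := sW _ _ s0 t0; have s2 := sB _ _ s0 t0; have s12 := sqintD s1 s2.
have n0 : nonneg_steps [:: (1, (s, t))] by move=> q; rewrite inE => /eqP ->.
have := ip_brownian_fbm n0 n0.
have I1 (X : R -> Omega -> R) : step_integral X [:: (1, (s, t))] = fun w => X t w - X s w.
  by apply/funext => w; rewrite /step_integral big_cons big_nil addr0 mul1r.
rewrite !I1 => E0.
have E0' := E0; rewrite ipC in E0'.
rewrite E (ipDl s1 s2 s12) (ipDr s1 s2 s1) (ipDr s1 s2 s2) E0 E0' EW// EB// /mixed_var.
by ring.
Qed.

Lemma mixed_step_integral_normal p : nonneg_steps p ->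
  centered_normal P (step_integral xi p)
    (Num.sqrt (ip P (step_integral xi p) (step_integral xi p))).
Proof.
move=> p0; have [_ n] := mixed_split p0 p0.
have [mI _] := sqint_step_integral mixed_variogram p0.
by apply: (centered_normal_sqrt_ip mI); rewrite step_integral_mixed; exact: n.
Qed.

Lemma ip_mixed_step_integrals p q : nonneg_steps p -> nonneg_steps q ->
  ip P (step_integral xi p) (step_integral xi q) =
  ip P (step_integral W' p) (step_integral W' q) + ip P (step_integral B' p) (step_integral B' q).
Proof.
move=> p0 q0; rewrite !step_integral_mixed.
have s1 := sqint_step_integral VW p0; have s2 := sqint_step_integral VB p0.
have s3 := sqint_step_integral VW q0; have s4 := sqint_step_integral VB q0.
have s34 := sqintD s3 s4.
rewrite ipDl// !ipDr// ip_brownian_fbm// (ipC P (step_integral B' p) (step_integral W' q)).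
by rewrite ip_brownian_fbm// addr0 add0r.
Qed.

End mixed_process.

(** * Variance of the maximum likelihood estimator *)

Lemma bounded_of_cvg (R : realType) (v : nat -> R) (l : R) : v n @[n --> \oo] --> l ->
  exists2 M, 0 <= M & forall n, `|v n| <= M.
Proof.
move=> vl; have : cvg (v n @[n --> \oo]) by apply/cvg_ex; exists l.
move=> /cvg_seq_bounded[M [_ vM]]; exists (`|M| + 1); first by rewrite addr_ge0.
by move=> n; apply: vM => //; apply: (le_lt_trans (ler_norm M)); rewrite ltrDl.
Qed.

(** * The score as an L^2 limit of integrals against the noise *)

Section wiener_limit.
Context {R : realType} {d : measure_display} {Omega : measurableType d}.
Notation mu := (@lebesgue_measure R).
Variable P : probability Omega R.
Variables (W B : R -> {RV P >-> R}) (H u theta T : R) (g : R -> R) (S : {RV P >-> R}).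
Hypotheses (H0 : 0 < H) (T0 : 0 < T).
Hypotheses (BW : standard_brownian W) (FB : fractional_brownian H B).
Hypothesis WB : independent_processes W B.
Hypothesis gK : mle_kernel H T g.

Let B' (t : R) (w : Omega) := B t w.
Let xi := mixed_fbm (fun t => W t) (fun t => B t).
Let Y (t : R) (w : Omega) := risk_process xi theta u t w - u.

Hypothesis SY : wiener_integral Y T g S.

Let VB : has_variogram P B' (fbm_var H) := fbm_variogram H0 FB.
Let VX : has_variogram P xi (mixed_var H) := mixed_variogram H0 BW FB WB.

Let G := \int[mu]_(t in `[0, T]) g t.
Let Z (w : Omega) := theta * G - S w.

Let ig : mu.-integrable `[0, T] (EFin \o g) := mle_kernel_integrable gK.

Let step_integral_Y p w : step_integral Y p w = theta * step_mass p - step_integral xi p w.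
Proof.
rewrite /step_integral /step_mass big_distrr/= -sumrB; apply: eq_bigr => q _.
by rewrite /Y /risk_process; ring.
Qed.

Let L1_step (s : nat -> seq (R * (R * R))) (q : R -> R) :
  (\int[mu]_(x in `[0%R, T]) ((step_fun (s n) x - g x) ^+ 2)%:E)%E @[n --> \oo] --> 0%E ->
  measurable_fun `[0, T] q -> (forall x, `[0, T]%classic x -> `|q x| <= 1) ->
  \int[mu]_(x in `[0, T]) (step_fun (s n) x * q x) @[n --> \oo] -->
  \int[mu]_(x in `[0, T]) (g x * q x).
Proof.
move=> sg mq q1.
apply: (@L1_cvg_integralM _ _ _ mu _ _ _ _ 1 (measurable_itv _)) => //.
- by move=> n; exact: integrable_step_fun.
apply: L2_cvg_L1_cvg => //.
- exact: lebesgue_measure_itvcc_fin.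
- by move=> n; apply: measurable_funTS; exact: measurable_step_fun.
- exact: mle_kernel_measurable gK.
Qed.

(* Z is the L^2 limit of the integrals against xi of the approximating steps,
   and the kernel equation says that Z represents evaluation of the drift. *)
Lemma drift_score_approximation : exists s : nat -> seq (R * (R * R)),
  [/\ forall n, steps_in T (s n), sqint P Z,
      (\int[P]_w ((step_integral xi (s n) w - Z w) ^+ 2)%:E)%E @[n --> \oo] --> 0%E &
      [/\ step_mass (s n) @[n --> \oo] --> G,
      forall y, 0 <= y <= T -> step_cov bm_var 0 y (s n) @[n --> \oo] -->
        \int[mu]_(x in `[0, y]) g x &
      forall y, 0 <= y <= T -> ip P (fun w => xi y w - xi 0 w) Z = y]].
Proof.
case: SY => s [sT' sg sS].
have sT n : steps_in T (s n) by move=> q; exact: sT'.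
have s0 n := steps_in_nonneg (sT n).
have sI n := sqint_step_integral VX (s0 n).
have mS : measurable_fun setT S by exact: measurable_funP.
have mass : step_mass (s n) @[n --> \oo] --> G.
  have c1 : \int[mu]_(x in `[0, T]) (step_fun (s n) x * cst 1 x) @[n --> \oo] -->
      \int[mu]_(x in `[0, T]) (g x * cst 1 x).
    by apply: L1_step => // x _; rewrite normr1.
  have E f : \int[mu]_(x in `[0, T]) (f x * cst 1 x) = \int[mu]_(x in `[0, T]) f x.
    by apply: eq_Rintegral => x _; rewrite mulr1.
  rewrite E in c1; apply: cvg_trans c1; apply: near_eq_cvg; apply: nearW => n.
  by rewrite E (integral_step_fun (sT n)).
have cW y : 0 <= y <= T -> step_cov bm_var 0 y (s n) @[n --> \oo] -->
    \int[mu]_(x in `[0, y]) g x.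
  move=> yT; have yT' := yT; case/andP: yT' => y0 yT'.
  have sub : `[0, y] `<=` `[0, T].
    by move=> x; rewrite /= !in_itv/= => /andP[-> xy] /=; exact: le_trans yT'.
  have c1 : \int[mu]_(x in `[0, T]) (step_fun (s n) x * \1_(`[0, y] : set R) x) @[n --> \oo] -->
      \int[mu]_(x in `[0, T]) (g x * \1_(`[0, y] : set R) x).
    apply: L1_step => // x _; rewrite indicE.
    by case: (x \in _); rewrite ?normr1 ?normr0.
  have E f : \int[mu]_(x in `[0, T]) (f x * \1_(`[0, y] : set R) x) = \int[mu]_(x in `[0, y]) f x.
    by rewrite -(@Rintegral_indicM _ _ _ mu _ _ f sub); apply: eq_Rintegral => x _; rewrite mulrC.
  rewrite E in c1; apply: cvg_trans c1; apply: near_eq_cvg; apply: nearW => n.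
  by rewrite E (step_cov_bm (sT n) yT).
have sYn n : sqint P (step_integral Y (s n)).
  rewrite (_ : step_integral Y (s n) = fun w => theta * step_mass (s n) - step_integral xi (s n) w).
    by apply: sqintB => //; exact: sqint_cst.
  by apply/funext => w; rewrite step_integral_Y.
(* The convergence makes one difference between a step integral and [S] square integrable, and the
   step integral is so too. *)
have sSq : sqint P S.
  have /fine_cvgP[[N _ fin] _] := sS.
  have /= finN := fin N (leqnn N).
  have mD : measurable_fun setT (fun w => step_integral Y (s N) w - S w).
    by apply: measurable_funB => //; case: (sYn N).
  have sD : sqint P (fun w => step_integral Y (s N) w - S w).
    by apply: sqintP => //; rewrite -(fineK finN) ltry.
  rewrite (_ : S = (fun w => step_integral Y (s N) w - (step_integral Y (s N) w - S w)) :> (Omega -> R)).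
    exact: sqintB.
  by apply/funext => w; rewrite subKr.
have sZ : sqint P Z by apply: sqintB => //; exact: sqint_cst.
have cZ : (\int[P]_w ((step_integral xi (s n) w - Z w) ^+ 2)%:E)%E @[n --> \oo] --> 0%E.
  have E w n : step_integral xi (s n) w - Z w =
      theta * (step_mass (s n) - G) - (step_integral Y (s n) w - S w).
    by rewrite step_integral_Y /Z; ring.
  have mY n : measurable_fun setT (fun w => ((step_integral Y (s n) w - S w) ^+ 2)%:E).
    apply/measurable_EFinP; apply: measurable_funX; apply: measurable_funB => //.
    by case: (sYn n).
  pose c n := 2 * (theta * (step_mass (s n) - G)) ^+ 2.
  (* From (x - y)^2 <= 2 x^2 + 2 y^2, where x is the error on the drift and y the error on the
     integral against Y. *)
  have ub n : (\int[P]_w ((step_integral xi (s n) w - Z w) ^+ 2)%:E <=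
      (c n)%:E + 2%:E * \int[P]_w ((step_integral Y (s n) w - S w) ^+ 2)%:E)%E.
    rewrite -ge0_integralZl//; last by move=> w _; rewrite lee_fin sqr_ge0.
    have -> : (c n)%:E = (\int[P]_w (cst (c n)%:E w))%E.
      by rewrite integral_cst//= probability_setT mule1.
    rewrite -ge0_integralD//; last 3 first.
    - by move=> w _; rewrite lee_fin mulr_ge0// sqr_ge0.
    - by move=> w _; rewrite mule_ge0// lee_fin sqr_ge0.
    - exact: measurable_funeM.
    apply: ge0_le_integral => //.
    - by move=> w _; rewrite lee_fin sqr_ge0.
    - apply/measurable_EFinP; apply: measurable_funX; apply: measurable_funB; last by case: sZ.
      by case: (sI n).
    - by apply: emeasurable_funD => //; exact: measurable_funeM.
    move=> w _; rewrite /cst -EFinM -EFinD lee_fin E /c.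
    move: (theta * _) (step_integral Y (s n) w - S w) => x y.
    have := sqr_ge0 (x + y); nra.
  have c0 : c n @[n --> \oo] --> (0 : R).
    have z : theta * (step_mass (s n) - G) @[n --> \oo] --> (0 : R).
      rewrite -(mulr0 theta) -(subrr G); apply: cvgM; first exact: cvg_cst.
      by apply: cvgB => //; exact: cvg_cst.
    have := cvgM (cvg_cst (2 : R)) (cvgM z z); rewrite !mulr0.
    exact.
  apply: (@squeeze_cvge _ _ _ _ (cst 0%E) _ (fun n => (c n)%:E +
    2%:E * \int[P]_w ((step_integral Y (s n) w - S w) ^+ 2)%:E)%E).
  - apply: nearW => n; rewrite ub andbT; apply: integral_ge0 => w _.
    by rewrite lee_fin sqr_ge0.
  - exact: cvg_cst.
  - rewrite -[X in _ --> X]add0e; apply: cvgeD => //.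
      by apply: cvg_EFin; [exact: nearW|exact: c0].
    by rewrite -[X in _ --> X](mule0 2%:E); apply: cvgeZl.
exists s; split => //; split => //.
pose D y := ip P (fun w => xi y w - xi 0 w) Z.
have sxi y z : 0 <= y -> 0 <= z -> sqint P (fun w => xi z w - xi y w) by case: VX => h _ _; exact: h.
have cD y : 0 <= y <= T -> ip P (fun w => xi y w - xi 0 w) (step_integral xi (s n)) @[n --> \oo] --> D y.
  by move=> /andP[y0 _]; apply: ip_cvgr => //; exact: sxi.
have mixE y n : 0 <= y -> ip P (fun w => xi y w - xi 0 w) (step_integral xi (s n)) =
    step_cov bm_var 0 y (s n) + step_cov (fbm_var H) 0 y (s n).
  move=> y0; rewrite (ip_incr_step_integral VX)// /step_cov -big_split/=.
  by apply: eq_bigr => q _; rewrite /incr_cov /mixed_var; ring.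
(* The limit of the fractional part of the covariance: the total limit [D] minus the Brownian part,
   which is the integral of [g]. Once E y = y minus that integral is known, D y = y follows. *)
pose E y := D y - \int[mu]_(x in `[0, y]) g x.
have cE y : 0 <= y <= T -> step_cov (fbm_var H) 0 y (s n) @[n --> \oo] --> E y.
  move=> yT.
  have c1 : ip P (fun w => xi y w - xi 0 w) (step_integral xi (s n)) -
      step_cov bm_var 0 y (s n) @[n --> \oo] --> E y by apply: cvgB; [exact: cD|exact: cW].
  apply: cvg_trans c1; apply: near_eq_cvg; apply: nearW => n; rewrite mixE; last by case/andP: yT.
  by rewrite addrAC subrr add0r.
have [M M0 normM] := bounded_of_cvg (ip_cvg sI sZ cZ).
(* By Cauchy-Schwarz, since by independence the fractional part of a step integral has smaller norm
   than the whole, and the whole converges. *)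
have Bbound n y : 0 <= y <= T ->
    `|step_cov (fbm_var H) 0 y (s n)| <= Num.sqrt (2 * fbm_var H T) * Num.sqrt M.
  move=> /andP[y0 yT].
  have sBy : sqint P (fun w => B' y w - B' 0 w) by case: VB => h _ _; exact: h.
  have sBn := sqint_step_integral VB (s0 n).
  rewrite -(ip_incr_step_integral VB)//.
  apply: (le_trans (ip_cauchy_schwarz_norm sBy sBn)).
  apply: ler_pM; rewrite ?sqrtr_ge0//; apply: ler_wsqrtr.
    case: VB => _ _ ->//; rewrite subr0 ler_pM2l//; apply: fbm_var_le => //.
    by rewrite ger0_norm.
  apply: le_trans (normM n); apply: (@le_trans _ _ (ip P (step_integral xi (s n)) (step_integral xi (s n)))); last exact: ler_norm.
  by rewrite (ip_mixed_step_integrals H0 BW FB WB)// lerDr ip_ge0.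
(* [D] is continuous because |D y - D z| is at most the norm of xi_y - xi_z times the norm of Z. *)
have Econt : {within `[0, T], continuous E}.
  have Dcont : {within `[0, T], continuous D}.
    apply/subspace_continuousP => y; rewrite /= in_itv/= => /andP[y0 yT].
    pose h z := Num.sqrt (2 * mixed_var H (y - z)) * Num.sqrt (ip P Z Z).
    have ch : h z @[z --> y] --> (0 : R).
      have -> : (0 : R) = h y.
        by rewrite /h subrr /mixed_var /bm_var normr0 fbm_var0// mul0r addr0 mulr0 sqrtr0 mul0r.
      apply: cvgM; last exact: cvg_cst.
      apply: (@cvg_comp _ _ _ (fun z => 2 * mixed_var H (y - z)) Num.sqrt); last exact: sqrt_continuous.
      apply: cvgM; first exact: cvg_cst.
      have cyz : (y - z) @[z --> y] --> y - y by apply: cvgB; [exact: cvg_cst|exact: cvg_id].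
      apply: (@cvg_comp _ _ _ (fun z => y - z) (mixed_var H)); first exact: cyz.
      by apply: cvgD; [exact: continuous_bm_var|exact: continuous_fbm_var].
    apply/cvgrPdist_le => e e0.
    move/cvgrPdist_le : ch => /(_ e e0).
    apply: filterS => z hz; rewrite /from_subspace /= in_itv/= => /andP[z0 zT].
    rewrite /D -ipBl ?sxi//; [|exact: sxi|exact: sxi].
    rewrite (_ : (fun w => _) = (fun w => xi y w - xi z w)); last first.
      by apply/funext => w; ring.
    apply: (le_trans (ip_cauchy_schwarz_norm (sxi _ _ z0 y0) sZ)).
    case: VX => _ _ ->//.
    by move: hz; rewrite sub0r normrN ger0_norm// mulr_ge0// sqrtr_ge0.
  move=> y; apply: cvgB; first exact: Dcont.
  exact: (parameterized_integral_continuous (ltW T0) ig).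
move=> y yT.
have := kernel_weak_equation H0 T0 gK sT sg cE Bbound Econt yT.
rewrite /E => /eqP; rewrite subr_eq subrK => /eqP; exact.
Qed.

End wiener_limit.

(** * Bounds on the information *)

Section score_information.
Context {R : realType} {d : measure_display} {Omega : measurableType d}.
Variable P : probability Omega R.
Variables (W B : R -> {RV P >-> R}) (H T : R).
Hypotheses (H0 : 0 < H) (T0 : 0 < T).
Hypotheses (BW : standard_brownian W) (FB : fractional_brownian H B).
Hypothesis WB : independent_processes W B.

Let W' (t : R) (w : Omega) := W t w.
Let B' (t : R) (w : Omega) := B t w.
Let xi := mixed_fbm (fun t => W t) (fun t => B t).

Let VW : has_variogram P W' bm_var := brownian_variogram BW.
Let VB : has_variogram P B' (fbm_var H) := fbm_variogram H0 FB.
Let VX : has_variogram P xi (mixed_var H) := mixed_variogram H0 BW FB WB.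

Variables (Z : Omega -> R) (G : R) (s : nat -> seq (R * (R * R))).
Hypotheses (sT : forall n, steps_in T (s n)) (sZ : sqint P Z).
Hypothesis cZ :
  (\int[P]_w ((step_integral xi (s n) w - Z w) ^+ 2)%:E)%E @[n --> \oo] --> 0%E.
Hypothesis sG : step_mass (s n) @[n --> \oo] --> G.
Hypothesis sWG : step_cov bm_var 0 T (s n) @[n --> \oo] --> G.
Hypothesis xiZ : forall y, 0 <= y <= T -> ip P (fun w => xi y w - xi 0 w) Z = y.

Let sxi y z : 0 <= y -> 0 <= z -> sqint P (fun w => xi z w - xi y w).
Proof. by case: VX => h _ _; exact: h. Qed.

Let s0 n := steps_in_nonneg (@sT n).
Let sI n := sqint_step_integral VX (@s0 n).

Lemma ip_step_score p : steps_in T p -> ip P (step_integral xi p) Z = step_mass p.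
Proof.
move=> pT; rewrite (ip_step_integral VX (steps_in_nonneg pT) sZ) /step_mass.
rewrite !big_seq; apply: eq_bigr => q /pT[q1 q12 q2].
have q2' := le_trans q1 q12.
congr (_ * _); rewrite (_ : (fun w => _) =
    (fun w => (xi q.2.2 w - xi 0 w) - (xi q.2.1 w - xi 0 w))).
  have T1 : 0 <= q.2.1 <= T by rewrite q1 (le_trans q12).
  have T2 : 0 <= q.2.2 <= T by rewrite q2' q2.
  by rewrite (ipBl (sxi (lexx 0) q2') (sxi (lexx 0) q1) sZ) (xiZ T1) (xiZ T2).
by apply/funext => w; ring.
Qed.

(** The kernel equation extends by linearity from increments to step integrals, whose product with Z
    has as expectation the mass of the step function. Along the approximating steps this mass tends
    to G. *)
Lemma score_information : ip P Z Z = G.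
Proof.
have c := ip_cvgr sI sZ sZ cZ.
have c' : step_mass (s n) @[n --> \oo] --> ip P Z Z.
  apply: cvg_trans c; apply: near_eq_cvg; apply: nearW => n.
  by rewrite ipC ip_step_score.
exact: (cvg_unique _ c' sG).
Qed.

Lemma score_normal : centered_normal P Z (Num.sqrt G).
Proof.
apply: (@centered_normal_L2_limit _ _ _ P (fun n => step_integral xi (s n))
  (fun n => Num.sqrt (ip P (step_integral xi (s n)) (step_integral xi (s n))))) => //.
- by move=> n; case: (sI n).
- by case: sZ.
- by move=> n; exact: (mixed_step_integral_normal H0 BW FB WB).
- rewrite -score_information.
  apply: (@cvg_comp _ _ _ (fun n => ip P (step_integral xi (s n)) (step_integral xi (s n))) Num.sqrt).
    exact: (ip_cvg sI sZ cZ).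
  exact: sqrt_continuous.
Qed.

Lemma mixed_step_energy p q : nonneg_steps p -> nonneg_steps q ->
  step_energy (mixed_var H) p q = step_energy bm_var p q + step_energy (fbm_var H) p q.
Proof.
move=> p0 q0; rewrite -(ip_step_integrals VX)// (ip_mixed_step_integrals H0 BW FB WB)//.
by rewrite -(ip_step_integrals VW)// -(ip_step_integrals VB).
Qed.

Lemma step_mass_sqr_le p : steps_in T p ->
  step_mass p ^+ 2 <= step_energy (mixed_var H) p p * G.
Proof.
move=> pT; have p0 := steps_in_nonneg pT; have sp := sqint_step_integral VX p0.
by have := ip_cauchy_schwarz sp sZ; rewrite ip_step_score// score_information (ip_step_integrals VX).
Qed.

Lemma information_ge : T ^+ 2 <= (T + T `^ (2 * H)) * G.
Proof.
have := ip_cauchy_schwarz (sxi (lexx 0) (ltW T0)) sZ.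
have TT : 0 <= T <= T by rewrite ltW/=.
rewrite (xiZ TT) score_information; case: VX => _ _ ->//; last exact: ltW.
by rewrite subr0 /mixed_var /bm_var /fbm_var (ger0_norm (ltW T0)) => h; apply: le_trans h _; lra.
Qed.

Lemma information_gt0 : 0 < G.
Proof.
have Tp : 0 < T + T `^ (2 * H) by apply: addr_gt0 => //; exact: powR_gt0.
by rewrite -(pmulr_rgt0 _ Tp); apply: lt_le_trans information_ge; exact: exprn_gt0.
Qed.

Let energy_ge0 m V p : has_variogram P V m -> nonneg_steps p -> 0 <= step_energy m p p.
Proof. by move=> Vm p0; rewrite -(ip_step_integrals Vm)// ip_ge0. Qed.

Let energy_cvg : step_energy (mixed_var H) (s n) (s n) @[n --> \oo] --> G.
Proof.
rewrite -score_information.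
apply: cvg_trans (ip_cvg sI sZ cZ); apply: near_eq_cvg; apply: nearW => n.
by rewrite (ip_step_integrals VX).
Qed.

Lemma information_le : G <= T.
Proof.
have b n : step_cov bm_var 0 T (s n) ^+ 2 <= T * step_energy (mixed_var H) (s n) (s n).
  have sWT : sqint P (fun w => W' T w - W' 0 w) by case: VW => h _ _; apply: h => //; exact: ltW.
  have := ip_cauchy_schwarz sWT (sqint_step_integral VW (@s0 n)).
  rewrite (ip_incr_step_integral VW)//; last exact: ltW.
  rewrite (ip_step_integrals VW)//; case: VW => _ _ ->//; last exact: ltW.
  rewrite subr0 /bm_var (ger0_norm (ltW T0)) => h; apply: le_trans h _.
  rewrite mulrCA divff// mulr1 ler_pM2l// mixed_step_energy// lerDl.
  exact: (energy_ge0 VB).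
have c1 : step_cov bm_var 0 T (s n) ^+ 2 @[n --> \oo] --> G ^+ 2 by apply: cvgM.
have c2 : T * step_energy (mixed_var H) (s n) (s n) @[n --> \oo] --> T * G.
  by apply: cvgM; [exact: cvg_cst|exact: energy_cvg].
have : G ^+ 2 <= T * G by apply: ler_cvg_to c1 c2 _; exact: nearW.
by rewrite expr2 ler_pM2r// information_gt0.
Qed.

Hypothesis H12 : 2^-1 < H < 1.

Let cT := equilibrium_const H * T `^ (2 * H - 1).

Let cT_gt0 : 0 < cT.
Proof. by rewrite mulr_gt0// ?powR_gt0// equilibrium_const_gt0. Qed.

Let ES m := equilibrium_steps H T m.
Let ES_in m : steps_in T (ES m).
Proof. exact: equilibrium_steps_in. Qed.

Let ES0 m := steps_in_nonneg (@ES_in m).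

Lemma fbm_energy_equilibrium_le m : step_energy (fbm_var H) (ES m) (ES m) <= cT * step_mass (ES m).
Proof.
rewrite /step_energy /step_mass big_distrr/= !big_seq; apply: ler_sum => q qE.
have [q1 q12 q2] := ES_in qE.
rewrite [leRHS]mulrCA ler_wpM2l//; first exact: equilibrium_steps_coef_ge0 qE.
exact: step_cov_equilibrium_le.
Qed.

(* Cauchy-Schwarz between the equilibrium steps and the approximations of Z, for
   the covariance of B alone. *)
Lemma information_equilibrium_le : equilibrium_const H * T `^ (2 * H - 1) * G <= T * equilibrium_mass H.
Proof.
rewrite -/cT.
have e n : (cT * step_mass (s n)) ^+ 2 <=
    cT * (T * equilibrium_mass H) * step_energy (mixed_var H) (s n) (s n).
  (* The limit in m is taken first, with n fixed: the constancy of the potential makes the pairing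
     depend on [s n] only through its mass. *)
  have c1 : step_energy (fbm_var H) (s n) (ES m) @[m --> \oo] --> cT * step_mass (s n).
    rewrite /step_energy /step_mass big_distrr/=.
    rewrite (_ : \sum_(i <- s n) _ = \sum_(i <- s n | i \in s n) i.1 * (cT * (i.2.2 - i.2.1))); last first.
      by rewrite [LHS]big_seq; apply: eq_bigr => i _; rewrite mulrCA.
    under eq_fun do rewrite big_seq.
    apply: cvg_big => [|q qs]; first exact: add_continuous.
    have [q1 q12 q2] := sT qs.
    apply: cvgM; first exact: cvg_cst.
    exact: step_cov_equilibrium_cvg.
  have c2 : step_energy (fbm_var H) (s n) (ES m) ^+ 2 @[m --> \oo] --> (cT * step_mass (s n)) ^+ 2.
    by apply: cvgM.
  apply: (ler_cvg_to c2 (cvg_cst _)); apply: nearW => m.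
  rewrite -(ip_step_integrals VB)//.
  apply: (le_trans (ip_cauchy_schwarz (sqint_step_integral VB (@s0 n)) (sqint_step_integral VB (@ES0 m)))).
  rewrite !(ip_step_integrals VB)// mulrC; apply: ler_pM.
  - exact: (energy_ge0 VB).
  - exact: (energy_ge0 VB).
  - apply: (le_trans (fbm_energy_equilibrium_le m)); rewrite ler_pM2l//.
    exact: step_mass_equilibrium_le.
  - by rewrite mixed_step_energy// lerDr; exact: (energy_ge0 VW).
have c1 : (cT * step_mass (s n)) ^+ 2 @[n --> \oo] --> (cT * G) ^+ 2.
  by apply: cvgM; (apply: cvgM; [exact: cvg_cst|exact: sG]).
have c2 : cT * (T * equilibrium_mass H) * step_energy (mixed_var H) (s n) (s n) @[n --> \oo] -->
    cT * (T * equilibrium_mass H) * G.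
  by apply: cvgM; [exact: cvg_cst|exact: energy_cvg].
have : (cT * G) ^+ 2 <= cT * (T * equilibrium_mass H) * G.
  by apply: ler_cvg_to c1 c2 _; exact: nearW.
have -> : (cT * G) ^+ 2 = cT * G * (cT * G) by [].
have -> : cT * (T * equilibrium_mass H) * G = cT * G * (T * equilibrium_mass H) by ring.
by rewrite ler_pM2l// mulr_gt0// information_gt0.
Qed.

(** Cauchy-Schwarz against the equilibrium steps at a fixed level m. Their Brownian energy is
    bounded by T C^2 since every covariance of increments is at most T. C may grow with m, but at
    fixed m this term is negligible against T^(2H) as T grows. *)
Lemma information_equilibrium_ge m :
  let C := \sum_(q <- equilibrium_steps H 1 m) q.1 in
  let J := step_mass (equilibrium_steps H 1 m) in
  (T * J) ^+ 2 <= (T * C ^+ 2 + equilibrium_const H * T `^ (2 * H - 1) * (T * J)) * G.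
Proof.
move=> /=; rewrite -/cT; set C := \sum_(q <- _) _; set J := step_mass (equilibrium_steps H 1 m).
have E1 : step_mass (ES m) = T * J by rewrite /ES step_mass_equilibrium_scale.
have E2 : \sum_(q <- ES m) q.1 = C by rewrite /C !big_map.
rewrite -E1; apply: (le_trans (step_mass_sqr_le (@ES_in m))).
rewrite ler_pM2r ?information_gt0// mixed_step_energy// lerD ?fbm_energy_equilibrium_le//.
have -> : T * C ^+ 2 = \sum_(q <- ES m) q.1 * \sum_(r <- ES m) r.1 * T.
  by rewrite -!big_distrl/= E2; ring.
rewrite /step_energy !big_seq; apply: ler_sum => q qE.
rewrite ler_wpM2l//; first exact: equilibrium_steps_coef_ge0 qE.
rewrite /step_cov !big_seq; apply: ler_sum => r rE.
rewrite ler_wpM2l//; first exact: equilibrium_steps_coef_ge0 rE.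
have [q1 q12 q2] := ES_in qE; have [r1 r12 r2] := ES_in rE.
exact: incr_cov_bm_le.
Qed.

End score_information.

Section mle_score.
Context {R : realType} {d : measure_display} {Omega : measurableType d}.
Notation mu := (@lebesgue_measure R).
Variable P : probability Omega R.
Variables (W B : R -> {RV P >-> R}) (H u theta T : R) (g : R -> R) (S : {RV P >-> R}).

Lemma mle_score (G := \int[mu]_(t in `[0, T]) g t)
    (xi := mixed_fbm (fun t => W t) (fun t => B t)) :
  0 < H -> 0 < T -> standard_brownian W -> fractional_brownian H B ->
  independent_processes W B -> mle_kernel H T g ->
  wiener_integral (fun t w => risk_process xi theta u t w - u) T g S ->
  [/\ 0 < G, centered_normal P (fun w => theta * G - S w) (Num.sqrt G),
      T ^+ 2 <= (T + T `^ (2 * H)) * G, G <= T &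
      2^-1 < H < 1 ->
      equilibrium_const H * T `^ (2 * H - 1) * G <= T * equilibrium_mass H /\
      forall m, (T * step_mass (equilibrium_steps H 1 m)) ^+ 2 <=
        (T * (\sum_(q <- equilibrium_steps H 1 m) q.1) ^+ 2 +
         equilibrium_const H * T `^ (2 * H - 1) * (T * step_mass (equilibrium_steps H 1 m))) * G].
Proof.
move=> H0 T0 BW FB WB gK SY.
have [s [sT sZ cZ [sG sW xiZ]]] := drift_score_approximation H0 T0 BW FB WB gK SY.
have sWT : step_cov bm_var 0 T (s n) @[n --> \oo] --> G by apply: sW; rewrite lexx ltW.
split.
- exact: (information_gt0 H0 T0 BW FB WB sT sZ cZ sG xiZ).
- exact: (score_normal H0 BW FB WB sT sZ cZ sG xiZ).
- exact: (information_ge H0 T0 BW FB WB sT sZ cZ sG xiZ).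
- exact: (information_le H0 T0 BW FB WB sT sZ cZ sG sWT xiZ).
- move=> H12; split; first exact: (information_equilibrium_le H0 T0 BW FB WB sT sZ cZ sG xiZ H12).
  by move=> m; exact: (information_equilibrium_ge H0 T0 BW FB WB sT sZ cZ sG xiZ H12).
Qed.

End mle_score.

(** * Asymptotics of the information *)

Section information_asymptotics.
Context {R : realType}.

Lemma cvg_powR_neg (p : R) : 0 < p -> x `^ (- p) @[x --> +oo] --> (0 : R).
Proof.
move=> p0; apply/cvgr0Pnorm_le => e e0.
exists (e `^ (- p^-1)); split; first exact: num_real.
move=> x /ltW ex; rewrite ger0_norm ?powR_ge0//.
have x0 : 0 < x by apply: lt_le_trans ex; exact: powR_gt0.
rewrite powRN -[e]invrK lef_pV2 ?posrE ?invr_gt0 ?powR_gt0//.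
have -> : e^-1 = (e `^ (- p^-1)) `^ p.
  by rewrite -powRrM mulNr mulVf ?gt_eqF// powR_inv1// ltW.
by apply: ge0_ler_powR => //; rewrite ?nnegrE ?powR_ge0// ltW.
Qed.

Variables (H : R) (G : R -> R).
Hypothesis G0 : forall T, 0 < T -> 0 < G T.

Lemma information_asymptotics_lt : H < 2^-1 ->
  (forall T, 0 < T -> T ^+ 2 <= (T + T `^ (2 * H)) * G T) ->
  (forall T, 0 < T -> G T <= T) ->
  Num.sqrt T / Num.sqrt (G T) @[T --> +oo] --> (1 : R).
Proof.
move=> H12 Gge Gle.
have c : T / G T @[T --> +oo] --> (1 : R).
  apply: (@squeeze_cvgr _ _ _ R (fun=> 1) (fun T => 1 + T `^ (- (1 - 2 * H)))).
  - near=> T; have T0 : 0 < T by near: T; exact: nbhs_pinfty_gt.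
    have g0 := G0 T0.
    rewrite ler_pdivlMr// mul1r Gle//= ler_pdivrMr//.
    rewrite -(ler_pM2l T0) -expr2; apply: le_trans (Gge T T0) _.
    rewrite mulrA ler_pM2r// mulrDr mulr1 lerD2l.
    have -> : - (1 - 2 * H) = 2 * H - 1 by ring.
    rewrite powRD; last by rewrite (gt_eqF T0) implybT.
    by rewrite (powR_inv1 (ltW T0)) mulrCA divff ?mulr1// gt_eqF.
  - exact: cvg_cst.
  - rewrite -[X in _ --> X]addr0; apply: cvgD; first exact: cvg_cst.
    by apply: cvg_powR_neg; lra.
have c2 : Num.sqrt (T / G T) @[T --> +oo] --> (1 : R).
  rewrite -(sqrtr1 R).
  by apply: (@cvg_comp _ _ _ (fun T => T / G T) Num.sqrt); [exact: c|exact: sqrt_continuous].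
apply: cvg_trans c2; apply: near_eq_cvg; near=> T.
have T0 : 0 < T by near: T; exact: nbhs_pinfty_gt.
by rewrite sqrtrM ?ltW// sqrtrV// ltW// G0.
Unshelve. all: by end_near. Qed.

(** The level m is fixed first, so that c / J m is within e/2 above c / M; only then is T taken
    large enough to make the Brownian term C^2 / J^2 T^(1 - 2H) smaller than e/2. The lower bound c
    / M holds for every T > 0. *)
Lemma information_asymptotics_gt (c M : R) (C J : nat -> R) : 2^-1 < H < 1 -> 0 < c -> 0 < M ->
  (forall T, 0 < T -> c * T `^ (2 * H - 1) * G T <= T * M) ->
  (forall T m, 0 < T -> (T * J m) ^+ 2 <= (T * C m ^+ 2 + c * T `^ (2 * H - 1) * (T * J m)) * G T) ->
  J m @[m --> \oo] --> M ->
  T `^ (1 - H) / Num.sqrt (G T) @[T --> +oo] --> Num.sqrt (c / M).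
Proof.
move=> /andP[H12 H1] c0 M0 Gle Gge JM.
have cv : T `^ (2 - 2 * H) / G T @[T --> +oo] --> c / M.
  apply/cvgrPdist_le => e e0.
  have cJ : c / J m @[m --> \oo] --> c / M.
    by apply: cvgM; [exact: cvg_cst|apply: cvgV => //; rewrite gt_eqF].
  have [m [Jm0 cJm]] : exists m, 0 < J m /\ c / J m <= c / M + e / 2.
    have e2 : 0 < e / 2 by rewrite divr_gt0.
    move/cvgrPdist_le : cJ => /(_ _ e2)[N1 _ h1].
    move/cvgrPdist_lt : JM => /(_ _ M0)[N2 _ h2].
    exists (maxn N1 N2); split.
      by have /= := h2 (maxn N1 N2) (leq_maxr _ _); rewrite ltr_norml => /andP[_]; lra.
    by have /= := h1 (maxn N1 N2) (leq_maxl _ _); rewrite ler_norml => /andP[+ _]; lra.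
  have z : C m ^+ 2 / J m ^+ 2 * T `^ (- (2 * H - 1)) @[T --> +oo] --> (0 : R).
    rewrite -[X in _ --> X](mulr0 (C m ^+ 2 / J m ^+ 2)).
    apply: cvgM; first exact: cvg_cst.
    by apply: cvg_powR_neg; lra.
  have e2 : 0 < e / 2 by rewrite divr_gt0.
  move/cvgr0Pnorm_le : z => /(_ _ e2) z.
  near=> T; have T0 : 0 < T by near: T; exact: nbhs_pinfty_gt.
  have zT : `|C m ^+ 2 / J m ^+ 2 * T `^ (- (2 * H - 1))| <= e / 2 by near: T.
  have g0 := G0 T0.
  pose t := T `^ (2 * H - 1); have t0 : 0 < t by exact: powR_gt0.
  have tE : T `^ (2 - 2 * H) = T / t.
    have -> : 2 - 2 * H = 1 - (2 * H - 1) by ring.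
    by rewrite powRD ?(gt_eqF T0) ?implybT// powRN powRr1 ?ltW.
  have lo : c / M <= T `^ (2 - 2 * H) / G T.
    rewrite tE ler_pdivlMr// ler_pdivlMr//.
    have -> : c / M * G T * t = c * t * G T / M by ring.
    by rewrite ler_pdivrMr// Gle.
  have hi : T `^ (2 - 2 * H) / G T <= C m ^+ 2 / J m ^+ 2 * T `^ (- (2 * H - 1)) + c / J m.
    rewrite tE powRN -/t ler_pdivrMr// ler_pdivrMr//.
    have := Gge T m T0; rewrite -/t => h.
    rewrite -(ler_pM2l (mulr_gt0 T0 (exprn_gt0 2 Jm0))).
    have -> : T * J m ^+ 2 * T = (T * J m) ^+ 2 by ring.
    apply: le_trans h _; rewrite le_eqVlt; apply/orP; left; apply/eqP.
    by field; rewrite !gt_eqF.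
  move: zT; rewrite ger0_norm; last by rewrite mulr_ge0 ?powR_ge0// divr_ge0// sqr_ge0.
  by move=> zT; rewrite distrC ger0_norm ?subr_ge0//; lra.
have c2 : Num.sqrt (T `^ (2 - 2 * H) / G T) @[T --> +oo] --> Num.sqrt (c / M).
  by apply: (@cvg_comp _ _ _ (fun T => T `^ (2 - 2 * H) / G T) Num.sqrt); [exact: cv|exact: sqrt_continuous].
apply: cvg_trans c2; apply: near_eq_cvg; near=> T.
have T0 : 0 < T by near: T; exact: nbhs_pinfty_gt.
rewrite sqrtrM ?powR_ge0// sqrtrV; last by rewrite ltW// G0.
have -> : 2 - 2 * H = (1 - H) + (1 - H) by ring.
rewrite powRD ?(gt_eqF T0) ?implybT// -expr2 sqrtr_sqr ger0_norm ?powR_ge0//.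
Unshelve. all: by end_near. Qed.

End information_asymptotics.

(** * Ruin probability and delta method *)

Section ruin_probability.
Context {R : realType} {d : measure_display} {Omega : measurableType d}.
Variables (P : probability Omega R) (xi : R -> Omega -> R) (u : R).
Hypothesis mxi : forall t, measurable_fun setT (xi t).
Hypothesis cxi : forall w, {within `[0, +oo[, continuous (fun t => xi t w)}.

Let ruin (theta : R) : set Omega := [set w | (ereal_inf
  [set (risk_process xi theta u t w)%:E | t in `[0%R, +oo[] < 0)%E].

Let ruinE theta w : ruin theta w <-> exists2 t, 0 <= t & risk_process xi theta u t w < 0.
Proof.
split.
  move=> /ereal_inf_lt[_ [t /= + <-]]; rewrite in_itv/= andbT => t0.
  by rewrite lte_fin; exists t.
move=> [t t0 Xt]; apply: (@le_lt_trans _ _ (risk_process xi theta u t w)%:E); last by rewrite lte_fin.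
by apply: ereal_inf_lbound; exists t => //=; rewrite in_itv/= t0.
Qed.

(* By continuity of the paths, ruin happens at a rational time. *)
Let measurable_ruin theta : measurable (ruin theta).
Proof.
have -> : ruin theta = \bigcup_(q : rat) [set w | 0 <= ratr q :> R /\ risk_process xi theta u (ratr q) w < 0].
  apply/seteqP; split => w.
    move=> /ruinE[t t0 Xt].
    have c : {within `[0, +oo[, continuous (fun t => risk_process xi theta u t w)}.
      move=> x; rewrite /risk_process; apply: cvgB; last exact: cxi.
      apply: cvgD; first exact: cvg_cst.
      apply: (continuous_subspaceT (f := fun t => theta * t)) => y.
      by apply: cvgM; [exact: cvg_cst|exact: cvg_id].
    move/subspace_continuousP : c => /(_ t); rewrite /= in_itv/= t0 => /(_ erefl) c.
    have := cvgr_lt _ c 0 Xt; rewrite near_withinE => -[e /= e0 he].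
    have te : t < t + e by rewrite ltrDl.
    have [q] := rat_in_itvoo te; rewrite in_itv/= => /andP[tq qe].
    have q0 : 0 <= ratr q :> R by apply: le_trans t0 (ltW tq).
    exists q => //; split => //; apply: (he (ratr q)); last by rewrite in_itv/= q0.
    by rewrite /= ltr0_norm; lra.
  by move=> [q _ [q0 Xq]]; apply/ruinE; exists (ratr q).
apply: bigcupT_measurable_rat => q; have [q0|q0] := boolP (0 <= ratr q :> R); last first.
  rewrite (_ : [set w | _] = set0); first exact: measurable0.
  by apply/seteqP; split => w //= -[].
rewrite (_ : [set w | _] = (fun w => risk_process xi theta u (ratr q) w) @^-1` `]-oo, 0[); last first.
  by apply/seteqP; split => w /=; rewrite in_itv/=; [case|split].
rewrite -[X in measurable X]setTI.
have m : measurable_fun setT (fun w => risk_process xi theta u (ratr q) w).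
  by apply: measurable_funB => //; exact: mxi.
by apply: m.
Qed.

(** At every time t >= 0 a larger drift gives a larger risk process, so the ruin events are
    nested. *)
Lemma ruin_prob_nonincreasing : nonincreasing_fun (ruin_prob P xi ^~ u).
Proof.
move=> t s ts; rewrite /ruin_prob fine_le ?fin_num_measure//; try exact: measurable_ruin.
apply: le_measure; rewrite ?inE; try exact: measurable_ruin.
move=> w /ruinE[r r0 Xr]; apply/ruinE; exists r => //.
by apply: le_lt_trans Xr; rewrite /risk_process lerB// lerD2l ler_wpM2r.
Qed.

Lemma measurable_ruin_prob : measurable_fun setT (ruin_prob P xi ^~ u).
Proof. by apply: nonincreasing_measurable => //; exact: ruin_prob_nonincreasing. Qed.

End ruin_probability.

(** Carathéodory's form of the derivative: the difference quotient extended by its limit at 0. It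
    reduces the delta method to limits of products and compositions. *)
Lemma slope_factor (R : realType) (psi : R -> R) (theta : R) : derivable psi theta 1 ->
  exists q : R -> R, [/\ q 0 = derive1 psi theta, {for 0, continuous q} &
    forall h, psi (theta + h) - psi theta = h * q h].
Proof.
move=> dpsi.
have c : h^-1 *: (psi (h *: 1 + theta) - psi theta) @[h --> (0 : R)^'] --> derive1 psi theta.
  by rewrite derive1E; exact: dpsi.
exists (fun h => if h == 0 then derive1 psi theta else h^-1 * (psi (theta + h) - psi theta)).
split; first by rewrite eqxx.
  apply/continuous_withinNx; rewrite eqxx; apply: cvg_trans c; apply: near_eq_cvg; near=> h.
  have /negbTE -> : h != 0 by near: h; exact: nbhs_dnbhs_neq.
  have -> : h%:A = h by rewrite /GRing.scale/= mulr1.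
  by rewrite /GRing.scale/= (addrC h).
move=> h; case: eqP => [->|/eqP h0]; first by rewrite addr0 subrr mul0r.
by rewrite mulVKf.
Unshelve. all: by end_near. Qed.

Section delta_method.
Context {R : realType} {d : measure_display} {Omega : measurableType d}.
Variable P : probability Omega R.
Notation N := (@normal_prob R 0 1).

(** As Z T is exactly normal for each T > 0, the expectation is an integral against one fixed normal
    law, in which only the integrand depends on T; it converges pointwise and f is bounded. *)
Lemma delta_method_normal (psi : R -> R) (theta l : R) (a G : R -> R) (Z : R -> Omega -> R) :
  measurable_fun setT psi -> derivable psi theta 1 ->
  (forall T, 0 < T -> 0 < a T) -> (a T)^-1 @[T --> +oo] --> (0 : R) ->
  (forall T, 0 < T -> 0 < G T) ->
  a T / Num.sqrt (G T) @[T --> +oo] --> l ->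
  (forall T, 0 < T -> measurable_fun setT (Z T)) ->
  (forall T, 0 < T -> centered_normal P (Z T) (Num.sqrt (G T))) ->
  cvg_in_distribution P (fun T w => a T * (psi (theta - Z T w / G T) - psi theta))
    (gaussian_prob 0 (l ^+ 2 * derive1 psi theta ^+ 2)).
Proof.
move=> mpsi dpsi a0 ainv G0 al mZ nZ f cf [M fM].
have [q [q0 cq qE]] := slope_factor dpsi.
set D := derive1 psi theta in q0 *.
have mf : measurable_fun setT (fun x => (f x)%:E).
  by apply/measurable_EFinP; exact: continuous_measurable_fun.
pose F (T x : R) := (f (a T * (psi (theta - Num.sqrt (G T) * x / G T) - psi theta)))%:E.
have mh T : measurable_fun setT (fun z : R => (f (a T * (psi (theta - z / G T) - psi theta)))%:E).
  apply: (measurableT_comp mf); apply: measurable_funM => //; apply: measurable_funB => //.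
  apply: (measurableT_comp mpsi); apply: measurable_funB => //.
  exact: measurable_funM.
have mF T : measurable_fun setT (F T).
  by apply: (measurableT_comp (mh T)); exact: measurable_funM.
(* This is the product of a / sqrt G, which converges to l, and 1 / a, which tends to 0. Hence the
   argument of psi tends to theta. *)
have invG : (Num.sqrt (G T))^-1 @[T --> +oo] --> (0 : R).
  have c : a T / Num.sqrt (G T) * (a T)^-1 @[T --> +oo] --> (0 : R).
    by rewrite -(mulr0 l); apply: cvgM.
  apply: cvg_trans c; apply: near_eq_cvg; near=> T.
  have T0 : 0 < T by near: T; exact: nbhs_pinfty_gt.
  by rewrite mulrAC divff ?mul1r// gt_eqF// a0.
have pw x : F T x @[T --> +oo] --> (f (- (l * D) * x))%:E.
  have ch : - (x * (Num.sqrt (G T))^-1) @[T --> +oo] --> (0 : R).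
    by rewrite -oppr0 -(mulr0 x); apply: cvgN; apply: cvgM => //; exact: cvg_cst.
  have cqh : q (- (x * (Num.sqrt (G T))^-1)) @[T --> +oo] --> D.
    by rewrite -q0; apply: (@cvg_comp _ _ _ (fun T => - (x * (Num.sqrt (G T))^-1)) q); [exact: ch|exact: cq].
  have c : a T / Num.sqrt (G T) * - x * q (- (x * (Num.sqrt (G T))^-1)) @[T --> +oo] --> l * - x * D.
    by apply: cvgM => //; apply: cvgM => //; exact: cvg_cst.
  have -> : - (l * D) * x = l * - x * D by ring.
  apply: cvg_EFin; first exact: nearW.
  have cfc : f (a T / Num.sqrt (G T) * - x * q (- (x * (Num.sqrt (G T))^-1))) @[T --> +oo] --> f (l * - x * D).
    by apply: (@cvg_comp _ _ _ (fun T => a T / Num.sqrt (G T) * - x * q (- (x * (Num.sqrt (G T))^-1))) f); [exact: c|exact: cf].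
  apply: cvg_trans cfc; apply: near_eq_cvg; near=> T.
  have T0 : 0 < T by near: T; exact: nbhs_pinfty_gt.
  rewrite /F/=; congr f.
  have -> : Num.sqrt (G T) * x / G T = x * (Num.sqrt (G T))^-1.
    rewrite -[X in _ / X](sqr_sqrtr (ltW (G0 T T0))); field.
    by rewrite gt_eqF// sqrtr_gt0 G0.
  by rewrite qE; ring.
have lim : (\int[N]_x F T x)%E @[T --> +oo] --> (\int[N]_x (f (- (l * D) * x))%:E)%E.
  (* Dominated convergence is applied along an arbitrary sequence tending to infinity. *)
  apply/cvge_pinftyP => v vy.
  apply: (@dominated_cvg _ _ R N setT measurableT (fun n => F (v n)) _ (fun=> M%:E)) => //.
  - by move=> n; exact: mF.
  - by move=> x _; move/cvge_pinftyP : (pw x); apply.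
  - apply/integrableP; split => //.
    by rewrite integral_cst//= probability_setT mule1 ltry.
  - by move=> n x _; rewrite /F/= lee_fin.
rewrite [X in _ --> X](_ : _ = (\int[N]_x (f (- (l * D) * x))%:E)%E); last first.
  have v0 : 0 <= l ^+ 2 * D ^+ 2 by rewrite mulr_ge0// sqr_ge0.
  have n1 : centered_normal (gaussian_prob 0 (l ^+ 2 * D ^+ 2)) id (Num.sqrt (l ^+ 2 * D ^+ 2)).
    by apply: has_law_centered_normal.
  (* The scale of the limit is - l D, of either sign; by symmetry it describes the same law as |l
     D|. *)
  have n2 : centered_normal (gaussian_prob 0 (l ^+ 2 * D ^+ 2)) id (- (l * D)).
    move: n1; rewrite -exprMn sqrtr_sqr; case: (leP 0 (l * D)) => [h|/ltW h].
      by rewrite ger0_norm//; exact: centered_normalN.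
    by rewrite ler0_norm.
  have mid : measurable_fun (setT : set (measurableTypeR R)) (id : measurableTypeR R -> R).
    exact: measurable_id.
  exact: (integral_centered_normal mid n2 mf).
apply: cvg_trans lim; apply: near_eq_cvg; near=> T.
have T0 : 0 < T by near: T; exact: nbhs_pinfty_gt.
exact/esym/(integral_centered_normal (mZ T T0) (nZ T T0) (mh T)).
Unshelve. all: by end_near. Qed.

End delta_method.

Theorem theorem3p4 (R : realType) (d : measure_display)
    (Omega : measurableType d) (P : probability Omega R)
    (W BH : R -> {RV P >-> R}) (H u theta : R)
    (g : R -> R -> R) (S : R -> {RV P >-> R}) :
  let xi := mixed_fbm W BH in
  let X := risk_process xi theta u in
  let Y := fun t w => X t w - u in
  let psi := fun th : R => ruin_prob P xi th u in
  let psi_hat := fun T w => psi (drift_mle g S T w) in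
  0 < H < 1 -> H != 2^-1 -> 0 < u ->
  standard_brownian W ->
  fractional_brownian H BH ->
  independent_processes W BH ->
  (\forall th \near theta,
     derivable psi th 1 /\ {for th, continuous (derive1 psi)}) ->
  (forall t : R, 0 < t -> mle_kernel H t (fun s => g s t)) ->
  (forall T : R, 0 < T -> wiener_integral Y T (fun s => g s T) (S T)) ->
  (2^-1 < H ->
    cvg_in_distribution P
      (fun T w => T `^ (1 - H) * (psi_hat T w - psi theta))
      (gaussian_prob 0
        (2 * H * Gamma (H + 2^-1) * Gamma (3 - 2 * H) / Gamma (3 / 2 - H) *
         derive1 psi theta ^+ 2))) /\
  (H < 2^-1 ->
    cvg_in_distribution P
      (fun T w => Num.sqrt T * (psi_hat T w - psi theta))
      (gaussian_prob 0 (derive1 psi theta ^+ 2))).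
Proof.
move=> xi X Y psi psi_hat /andP[H0 H1] Hn u0 BW FB WB dpsi gK SY.
pose G T := \int[@lebesgue_measure R]_(t in `[0, T]) g t T.
have mxi t : measurable_fun setT (xi t) by exact: measurable_funD.
have cxi w : {within `[0, +oo[, continuous (fun t => xi t w)}.
  case: BW => _ _ _ cW; case: FB => _ _ _ cB.
  by move=> t; apply: cvgD; [exact: cW|exact: cB].
have mpsi : measurable_fun setT psi := measurable_ruin_prob P u mxi cxi.
have dpsi0 : derivable psi theta 1 by have [] := nbhs_singleton dpsi.
have score T (T0 : 0 < T) := mle_score H0 T0 BW FB WB (gK T T0) (SY T T0).
have G0 T : 0 < T -> 0 < G T by move=> /score[].
have mZ T : 0 < T -> measurable_fun setT (fun w => theta * G T - S T w).
  by move=> _; exact: measurable_funB.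
have nZ T : 0 < T -> centered_normal P (fun w => theta * G T - S T w) (Num.sqrt (G T)).
  by move=> /score[].
have limit (a : R -> R) (l v : R) :
    (forall T, 0 < T -> 0 < a T) -> (a T)^-1 @[T --> +oo] --> (0 : R) ->
    a T / Num.sqrt (G T) @[T --> +oo] --> l -> v = l ^+ 2 * derive1 psi theta ^+ 2 ->
    cvg_in_distribution P (fun T w => a T * (psi_hat T w - psi theta)) (gaussian_prob 0 v).
  move=> a0 ai al -> f cf bf.
  have c := delta_method_normal mpsi dpsi0 a0 ai G0 al mZ nZ cf bf.
  apply: cvg_trans c; apply: near_eq_cvg; near=> T.
  have T0 : 0 < T by near: T; exact: nbhs_pinfty_gt.
  apply: eq_integral => w _; congr ((f (_ * (psi _ - _)))%:E).
  (* The score is Z = theta G - S, so the estimator S / G is theta - Z / G. *)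
  by rewrite /drift_mle -/(G T); field; rewrite gt_eqF ?G0.
split=> H2.
- have H12 : 2^-1 < H < 1 by rewrite H2.
  have c0 := equilibrium_const_gt0 H12.
  have g1 : 0 < Gamma (3 / 2 - H) :> R by apply: Gamma_gt0; lra.
  have g2 : 0 < Gamma (3 - 2 * H) :> R by apply: Gamma_gt0; lra.
  have M0 : 0 < equilibrium_mass H by rewrite divr_gt0// exprn_gt0.
  apply: (limit _ (Num.sqrt (equilibrium_const H / equilibrium_mass H))).
  + by move=> T T0; exact: powR_gt0.
  + under eq_fun do rewrite -powRN.
    by apply: cvg_powR_neg; rewrite subr_gt0.
  + apply: (information_asymptotics_gt (C := fun m => \sum_(q <- equilibrium_steps H 1 m) q.1)
      (J := fun m => step_mass (equilibrium_steps H 1 m)) G0 H12 c0 M0).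
    * by move=> T T0; have [_ _ _ _ /(_ H12)[]] := score T T0.
    * by move=> T m T0; have [_ _ _ _ /(_ H12)[_]] := score T T0; apply.
    * by rewrite -[equilibrium_mass H]mul1r; exact: step_mass_equilibrium_cvg.
  (* One factor Gamma(3/2 - H) of the constant cancels against the square in the mass, which leaves
     the stated variance. *)
  + rewrite sqr_sqrtr; last by rewrite divr_ge0// ltW.
    congr (_ * _); rewrite /equilibrium_const /equilibrium_mass.
    move: (Gamma _) (Gamma _) (Gamma _) g1 g2 => x y z z0 y0.
    by field; rewrite !gt_eqF.
- apply: (limit Num.sqrt 1); last by rewrite expr1n mul1r.
  + by move=> T T0; rewrite sqrtr_gt0.
  + have c := @cvg_powR_neg R 2^-1 _.
    apply: cvg_trans (c _); last by [].
    apply: near_eq_cvg; near=> T.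
    have T0 : 0 < T by near: T; exact: nbhs_pinfty_gt.
    by rewrite powRN powR12_sqrt// ltW.
  + apply: (information_asymptotics_lt G0 H2).
    * by move=> T T0; have [] := score T T0.
    * by move=> T T0; have [] := score T T0.
Unshelve. all: by end_near. Qed.
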